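(* Let $n\in\{2,3\}$ and let $\Omega\subset\mathbb R^n$ be a regular domain with bounded boundary $\partial\Omega$ (either a bounded domain or an exterior domain), with unit outward normal $\nu$. For $\varepsilon\in]0,1]$, let $u^\varepsilon$ be a classical solution of $$i\varepsilon\partial_tu^\varepsilon+\frac{\varepsilon^2}{2}\Delta u^\varepsilon=(|u^\varepsilon|^2-1)u^\varepsilon\ \text{ in }\Omega,\qquad \frac{\partial u^\varepsilon}{\partial\nu}=0\ \text{ on }\partial\Omega,$$ and let $(\rho,\phi)$ be a classical solution of $$\left\{\begin{aligned}&\partial_t\rho+\mathrm{div}(\rho\nabla\phi)=0&&\text{in }\Omega,\\&\partial_t\phi+\tfrac12|\nabla\phi|^2+\rho-1=0&&\text{in }\Omega,\\&\nabla\phi\cdot\nu=0&&\text{on }\partial\Omega,\end{aligned}\right.$$ satisfying, for some fixed $T>0$, $$u^\varepsilon\in C([0,T];X^2(\Omega)),\quad |u^\varepsilon|^2-1\in C([0,T];L^2(\Omega)),$$ $$\rho\in C([0,T];X^1(\Omega)),\quad \rho-1\in C([0,T];L^2(\Omega)),$$ $$\nabla\phi,\nabla^2\phi,\nabla^3\phi\in C([0,T];L^2(\Omega)\cap L^\infty(\Omega)).$$ Assume that initially, with $u_0^\varepsilon=u^\varepsilon|_{t=0}$, $\rho_0=\rho|_{t=0}$, $\phi_0=\phi|_{t=0}$, $$\left\|\varepsilon\nabla u_0^\varepsilon-iu_0^\varepsilon\nabla\phi_0\right\|_{L^2(\Omega)}+\left\||u_0^\varepsilon|^2-\rho_0\right\|_{L^2(\Omega)}=\mathcal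 O(\varepsilon).$$ Then $$|u^\varepsilon|^2-\rho=\mathcal O(\varepsilon)\quad\text{in }L^\infty([0,T];L^2(\Omega)),$$ $$\varepsilon\,\mathrm{Im}(\overline{u^\varepsilon}\nabla u^\varepsilon)-\rho\nabla\phi=\mathcal O(\varepsilon)\quad\text{in }L^\infty([0,T];L^1_{\rm loc}(\Omega)).$$
   Context: For an integer $k\ge1$, $X^k(\Omega)=\{u\in L^\infty(\Omega):\nabla u\in H^{k-1}(\Omega)\}$ (Zhidkov space). $u^\varepsilon$ is complex-valued; $\rho$ and $\phi$ are real-valued and independent of $\varepsilon$. The notation $\mathcal O(\varepsilon)$ refers to bounds by a constant times $\varepsilon$, the constant being independent of $\varepsilon\in]0,1]$. *)

(* Defs.v *)
From HB Require Import structures.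
From mathcomp Require Import all_boot all_order all_algebra.
From mathcomp Require Import complex.
From mathcomp Require Import all_classical all_reals all_analysis.

Set Implicit Arguments.
Unset Strict Implicit.
Unset Printing Implicit Defensive.

Import Order.TTheory GRing.Theory Num.Theory.
Import numFieldNormedType.Exports.

Local Open Scope classical_set_scope.
Local Open Scope ring_scope.

Section measurable_rV.
Context {d : measure_display} {T : measurableType d}.
Variable n : nat.

(* The product sigma-algebra, generated by the coordinates; over the reals it
   is the Borel sigma-algebra. *)
Let coord : 'I_n -> 'rV[T]_n -> T := fun i v => v ord0 i.

HB.instance Definition _ := @isMeasurable.Build (measure_tuple_display d)
  'rV[T]_n (g_sigma_preimage coord) (@sigma_algebra0 _ _ _)
  (@sigma_algebraC _ _) (@sigma_algebra_bigcup _ _ _).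

Lemma measurable_coord (i : 'I_n) :
  measurable_fun [set: 'rV[T]_n] (fun v : 'rV[T]_n => v ord0 i).
Proof.
move=> _ Y mY; rewrite setTI; apply: sub_sigma_algebra => /=.
rewrite -bigcup_seq/=; exists i => /=; first by rewrite mem_index_enum.
by exists Y => //; rewrite setTI.
Qed.

Lemma measurable_fun_rV d' (S : measurableType d') (f : S -> 'rV[T]_n) :
  (forall i, measurable_fun [set: S] (fun x => f x ord0 i)) ->
  measurable_fun [set: S] f.
Proof.
move=> mf _ A mA.
have -> : [set: S] `&` f @^-1` A = f @^-1` A by rewrite setTI.
suff H : g_sigma_preimage (fun i => coord i \o f) `<=` measurable.
  by apply: H; rewrite g_sigma_preimage_comp; exists A => //; rewrite setTI.
apply: smallest_sub; first exact: sigma_algebra_measurable.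
rewrite -bigcup_seq; apply: bigcup_sub => i _.
by move=> B [C mC <-]; exact: mf.
Qed.

End measurable_rV.

Section lebesgue_rV.
Context {R : realType}.

Definition consrV n (p : R * 'rV[R]_n) : 'rV[R]_n.+1 :=
  row_mx (p.1)%:M p.2 : 'rV_(1 + n).

Lemma consrV0 n (p : R * 'rV[R]_n) : consrV p ord0 ord0 = p.1.
Proof.
rewrite (_ : ord0 = lshift n ord0 :> 'I_(1 + n)); last exact/val_inj.
by rewrite [LHS]row_mxEl mxE eqxx.
Qed.

Lemma consrVS n (p : R * 'rV[R]_n) (j : 'I_n) :
  consrV p ord0 (lift ord0 j) = p.2 ord0 j.
Proof.
rewrite (_ : lift ord0 j = rshift 1 j :> 'I_(1 + n)); last exact/val_inj.
by rewrite [LHS]row_mxEr.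
Qed.

Lemma measurable_consrV n : measurable_fun [set: R * 'rV[R]_n] (@consrV n).
Proof.
apply: measurable_fun_rV => i; case: (unliftP ord0 i) => [j|] ->.
  under eq_fun do rewrite consrVS.
  exact: (measurableT_comp (@measurable_coord _ R n j) measurable_snd).
under eq_fun do rewrite consrV0.
exact: measurable_fst.
Qed.

Definition lebesgue_consrV n (m : set 'rV[R]_n -> \bar R) :
    set 'rV[R]_n.+1 -> \bar R :=
  pushforward (@lebesgue_measure R \x m)%E (@consrV n).

Section lebesgue_consrV_measure.
Context n (m : {sigma_finite_measure set 'rV[R]_n -> \bar R}).

Let mpre (A : set 'rV[R]_n.+1) : measurable A -> measurable (@consrV n @^-1` A).
Proof.
by move=> mA; rewrite -[X in measurable X]setTI; exact: measurable_consrV.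
Qed.

Let lebesgue_consrV_set0 : lebesgue_consrV m set0 = 0%E.
Proof. by rewrite /lebesgue_consrV /pushforward preimage_set0 measure0. Qed.

Let lebesgue_consrV_ge0 A : (0 <= lebesgue_consrV m A)%E.
Proof. exact: integral_ge0. Qed.

Let lebesgue_consrV_sigma_additive : semi_sigma_additive (lebesgue_consrV m).
Proof.
move=> F mF tF mUF; rewrite /lebesgue_consrV /pushforward preimage_bigcup.
apply: measure_semi_sigma_additive.
- by move=> k; exact: mpre.
- apply/trivIsetP => /= i j _ _ ij; rewrite -preimage_setI.
  by move/trivIsetP : tF => /(_ _ _ _ _ ij) ->//; rewrite preimage_set0.
- by rewrite -preimage_bigcup; exact: mpre.
Qed.

HB.instance Definition _ := isMeasure.Build _ _ _ (lebesgue_consrV m)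
  lebesgue_consrV_set0 lebesgue_consrV_ge0 lebesgue_consrV_sigma_additive.

Let lebesgue_consrV_sigma_finite : sigma_finite setT (lebesgue_consrV m).
Proof.
have /sigma_finiteP[F [TF ndF Foo]] := sigma_finiteT (@lebesgue_measure R).
have /sigma_finiteP[G [TG ndG Goo]] := sigma_finiteT m.
pose g (v : 'rV[R]_n.+1) := (v ord0 ord0, \row_j v ord0 (lift ord0 j)).
have gK : cancel (@consrV n) g.
  move=> [x v]; rewrite /g consrV0; congr pair.
  by apply/rowP => j; rewrite mxE consrVS.
have mg : measurable_fun [set: 'rV[R]_n.+1] g.
  apply/measurable_fun_pair; first exact: (@measurable_coord _ R).
  apply: measurable_fun_rV => j; under eq_fun do rewrite mxE.
  exact: (@measurable_coord _ R).
exists (fun k => g @^-1` (F k `*` G k)).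
  apply/esym; rewrite -subTset => v _.
  have [i _ Fi] : (\bigcup_i F i) (g v).1 by rewrite -TF.
  have [j _ Gj] : (\bigcup_j G j) (g v).2 by rewrite -TG.
  exists (maxn i j) => //; split.
  - by move: Fi; exact/subsetPset/ndF/leq_maxl.
  - by move: Gj; exact/subsetPset/ndG/leq_maxr.
move=> k; have [mF Fk] := Foo k; have [mG Gk] := Goo k; split.
  by rewrite -[X in measurable X]setTI; apply: mg => //; exact: measurableX.
rewrite /lebesgue_consrV /pushforward -comp_preimage (_ : g \o _ = id); last first.
  by apply/funext => p /=; rewrite gK.
rewrite preimage_id product_measure1E//.
by rewrite lte_mul_pinfty// ge0_fin_numE.
Qed.

HB.instance Definition _ := Measure_isSigmaFinite.Build _ _ _
  (lebesgue_consrV m) lebesgue_consrV_sigma_finite.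

End lebesgue_consrV_measure.

(* Lebesgue measure on R^n, as the n-fold product of the one-dimensional one. *)
Fixpoint lebesgue_rV n : {sigma_finite_measure set 'rV[R]_n -> \bar R} :=
  match n with
  | 0 => \d_(0 : 'rV[R]_0)
  | m.+1 => lebesgue_consrV (lebesgue_rV m)
  end.

End lebesgue_rV.

Section calculus.
Context {R : realType} {n : nat}.
Implicit Types (f g : 'rV[R]_n -> R) (w : R -> 'rV[R]_n -> R).
Implicit Types (u : 'rV[R]_n -> R[i]) (O : set 'rV[R]_n).

(* The norm carried by 'rV[R]_n is the sup norm: it only serves for the
   topology. Lengths are Euclidean. *)
Definition dotv (v v' : 'rV[R]_n) : R := \sum_i v ord0 i * v' ord0 i.
Definition enorm (v : 'rV[R]_n) : R := Num.sqrt (dotv v v).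
Definition cenorm (z : 'rV[R[i]]_n) : R :=
  Num.sqrt (\sum_i ComplexField.Normc.normc (z ord0 i) ^+ 2).

Definition pderiv (i : 'I_n) f (x : 'rV[R]_n) : R :=
  'D_(delta_mx ord0 i : 'rV[R]_n) f x.
Definition pderivable (i : 'I_n) f (x : 'rV[R]_n) : Prop :=
  derivable f x (delta_mx ord0 i : 'rV[R]_n).
Definition grad f x : 'rV[R]_n := \row_i pderiv i f x.
Definition laplacian f x : R := \sum_i pderiv i (pderiv i f) x.
Definition divergence (F : 'rV[R]_n -> 'rV[R]_n) x : R :=
  \sum_i pderiv i (fun y => F y ord0 i) x.
Definition tderiv w (t : R) (x : 'rV[R]_n) : R := derive1 (fun s => w s x) t.

(* Complex-valued functions of real variables are differentiated componentwise. *)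
Definition reP u (x : 'rV[R]_n) : R := complex.Re (u x).
Definition imP u (x : 'rV[R]_n) : R := complex.Im (u x).
Definition cgrad u x : 'rV[R[i]]_n :=
  \row_i (pderiv i (reP u) x +i* pderiv i (imP u) x)%C.
Definition claplacian u x : R[i] :=
  (laplacian (reP u) x +i* laplacian (imP u) x)%C.
Definition ctderiv (w : R -> 'rV[R]_n -> R[i]) t x : R[i] :=
  (tderiv (fun s => reP (w s)) t x +i* tderiv (fun s => imP (w s)) t x)%C.

Definition C1_on O f : Prop :=
  {within O, continuous f} /\
  forall i, (forall x, O x -> pderivable i f x) /\
            {within O, continuous (pderiv i f)}.

Definition boundary O : set 'rV[R]_n := closure O `\` interior O.

Definition local_defining_function O (p : 'rV[R]_n) g : Prop :=
  exists U : set 'rV[R]_n,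
    [/\ open U, U p, C1_on U g & forall x, U x -> grad g x != 0] /\
    (forall x, U x -> (O x <-> g x < 0) /\ (boundary O x <-> g x = 0)).

(* A domain whose boundary is locally a C^1 hypersurface, the domain lying on
   one side of it; C^1 is what the outward unit normal requires. *)
Definition regular_domain O : Prop :=
  [/\ open O, connected O, O !=set0 &
      forall p, boundary O p -> exists g, local_defining_function O p g].

Definition outward_unit_normal O (p nu : 'rV[R]_n) : Prop :=
  exists g, local_defining_function O p g /\
            nu = (enorm (grad g p))^-1 *: grad g p.

End calculus.

Section spaces.
Context {R : realType} {n : nat}.
Implicit Types (f g : 'rV[R]_n -> R) (O K : set 'rV[R]_n).

Definition Lp_norm O (p : \bar R) f : \bar R :=
  ('N[@lebesgue_rV R n]_p[EFin \o (f \_ O)])%E.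

Definition in_Lp O (p : \bar R) f : Prop :=
  measurable_fun O f /\ (Lp_norm O p f < +oo)%E.

Definition in_L1loc O f : Prop :=
  measurable_fun O f /\
  forall K, compact K -> K `<=` O -> (Lp_norm K 1%:E f < +oo)%E.

Definition test_function O f : Prop :=
  C1_on setT f /\
  exists K, [/\ compact K, K `<=` O & forall x, ~ K x -> f x = 0].

(* Weak derivatives are tested against compactly supported C^1 functions, as in
   Gilbarg and Trudinger; the notion is the same with smooth test functions. *)
Definition weak_pderiv O (i : 'I_n) f g : Prop :=
  [/\ in_L1loc O f, in_L1loc O g & forall psi, test_function O psi ->
    (\int[@lebesgue_rV R n]_(x in O) (f x * pderiv i psi x)%:E =
     - \int[@lebesgue_rV R n]_(x in O) (g x * psi x)%:E)%E].

(* The infima below range over the representatives of a weak derivative, which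
   all coincide almost everywhere. *)
Fixpoint in_H O (m : nat) f : Prop :=
  in_Lp O 2%:E f /\
  if m is m'.+1 then
    forall i, exists2 g, weak_pderiv O i f g & in_H O m' g
  else True.

Fixpoint H_norm O (m : nat) f : \bar R :=
  (Lp_norm O 2%:E f +
   if m is m'.+1 then
     \sum_(i < n) ereal_inf [set H_norm O m' g | g in weak_pderiv O i f]
   else 0)%E.

(* Zhidkov space; meaningful for k >= 1. *)
Definition in_X O (k : nat) f : Prop :=
  in_Lp O +oo%E f /\
  forall i, exists2 g, weak_pderiv O i f g & in_H O k.-1 g.

Definition X_norm O (k : nat) f : \bar R :=
  (Lp_norm O +oo f +
   \sum_(i < n) ereal_inf [set H_norm O k.-1 g | g in weak_pderiv O i f])%E.

Definition in_L2Loo O f : Prop := in_Lp O 2%:E f /\ in_Lp O +oo%E f.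
Definition L2Loo_norm O f : \bar R := (Lp_norm O 2%:E f + Lp_norm O +oo f)%E.

(* C([0,T]; E), where E is given by its membership predicate and its norm. *)
Definition time_continuous (T : R) (E : ('rV[R]_n -> R) -> Prop)
    (N : ('rV[R]_n -> R) -> \bar R) (w : R -> 'rV[R]_n -> R) : Prop :=
  forall t : R, 0 <= t <= T ->
    E (w t) /\
    N (fun x => w s x - w t x) @[s --> within `[0, T]%classic (nbhs t)] --> 0%E.

Definition C_L2 T O := time_continuous T (in_Lp O 2%:E) (Lp_norm O 2%:E).
Definition C_L2Loo T O := time_continuous T (in_L2Loo O) (L2Loo_norm O).
Definition C_X T O k := time_continuous T (in_X O k) (X_norm O k).

(* The norm of L^oo([0,T]; L^p(O)) for functions continuous in time. *)
Definition LooLp_norm (T : R) O (p : \bar R) (w : R -> 'rV[R]_n -> R) : \bar R :=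
  ereal_sup [set Lp_norm O p (w t) | t in `[0, T]%classic].

Definition big_O_eps (N : R -> \bar R) : Prop :=
  exists C : R, forall eps : R, 0 < eps <= 1 -> (N eps <= (C * eps)%:E)%E.

End spaces.

Section equations.
Context {R : realType} {n : nat}.
Implicit Types (w : R -> 'rV[R]_n -> R) (O : set 'rV[R]_n) (T eps : R).

Definition jointly_continuous (I : set R) O w : Prop :=
  {within I `*` O, continuous (fun p : R * 'rV[R]_n => w p.1 p.2)}.

Definition continuous_up_to_boundary T O w : Prop :=
  exists2 w', jointly_continuous `[0, T] (closure O) w' &
    forall (t : R) x, 0 <= t <= T -> O x -> w t x = w' t x.

Definition C1_in_time T O w : Prop :=
  (forall (t : R) x, 0 < t < T -> O x -> derivable (fun s => w s x) t 1) /\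
  jointly_continuous `]0, T[ O (tderiv w).

Definition C1_in_space T O w : Prop :=
  jointly_continuous `[0, T] O w /\
  forall i, (forall (t : R) x, 0 <= t <= T -> O x -> pderivable i (w t) x) /\
            jointly_continuous `[0, T] O (fun t => pderiv i (w t)).

Definition C2_in_space T O w : Prop :=
  C1_in_space T O w /\ forall i, C1_in_space T O (fun t => pderiv i (w t)).

(* C^1 in time and C^2 in space inside O, with a gradient continuous up to the
   boundary, so that the Neumann condition makes sense pointwise. *)
Definition classical_Neumann T O w : Prop :=
  [/\ C1_in_time T O w, C2_in_space T O w, continuous_up_to_boundary T O w &
      forall i, continuous_up_to_boundary T O (fun t => pderiv i (w t))].

(* The values of w outside O are irrelevant, so the normal derivative on the
   boundary is the trace of the gradient taken from inside O. *)
Definition Neumann_condition T O w : Prop :=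
  forall (t : R) p nu, 0 <= t <= T -> boundary O p -> outward_unit_normal O p nu ->
    dotv (grad (w t) x) nu @[x --> within O (nbhs p)] --> (0 : R).

Definition GP_solution T O eps (u : R -> 'rV[R]_n -> R[i]) : Prop :=
  let re t := reP (u t) in let im t := imP (u t) in
  [/\ classical_Neumann T O re, classical_Neumann T O im,
      forall (t : R) x, 0 < t < T -> O x ->
        'i%C * eps%:C%C * ctderiv u t x + (eps ^+ 2 / 2)%:C%C * claplacian (u t) x =
        (`|u t x| ^+ 2 - 1) * u t x,
      Neumann_condition T O re & Neumann_condition T O im].

Definition hydro_solution T O (rho phi : R -> 'rV[R]_n -> R) : Prop :=
  [/\ C1_in_time T O rho /\ C1_in_space T O rho,
      classical_Neumann T O phi,
      forall (t : R) x, 0 < t < T -> O x ->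
        tderiv rho t x + divergence (fun y => rho t y *: grad (phi t) y) x = 0,
      forall (t : R) x, 0 < t < T -> O x ->
        tderiv phi t x + enorm (grad (phi t) x) ^+ 2 / 2 + rho t x - 1 = 0 &
      Neumann_condition T O phi].

Definition density (u : 'rV[R]_n -> R[i]) (x : 'rV[R]_n) : R :=
  ComplexField.Normc.normc (u x) ^+ 2.

Definition momentum eps (u : 'rV[R]_n -> R[i]) (x : 'rV[R]_n) : 'rV[R]_n :=
  \row_i (eps * complex.Im (conjc (u x) * cgrad u x ord0 i)).

Definition modulated_gradient eps (u : 'rV[R]_n -> R[i]) (phi : 'rV[R]_n -> R)
    (x : 'rV[R]_n) : 'rV[R[i]]_n :=
  \row_i (eps%:C%C * cgrad u x ord0 i - 'i%C * u x * (pderiv i phi x)%:C%C).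

End equations.

(* Main.v *)
Require Import Defs.
From mathcomp Require Import all_boot all_order all_algebra.
From mathcomp Require Import finmap complex ring lra.
From mathcomp Require Import all_classical all_reals all_analysis.
From mathcomp Require Import measurable_realfun ess_sup_inf.

Set Implicit Arguments.
Unset Strict Implicit.
Unset Printing Implicit Defensive.

Import Order.TTheory GRing.Theory Num.Theory.
Import numFieldNormedType.Exports.

Local Open Scope classical_set_scope.
Local Open Scope ring_scope.

(** The proof compares the wave with the limit flow through the modulated energy
    [H(t) = 1/2 \int |eps grad u - i u grad phi|^2 + (|u|^2 - rho)^2], which is
    [O(eps^2)] at the initial time. Write [u = a + i b], [v = grad phi],
    [A = eps grad a + b v], [B = eps grad b - a v] (the real and the imaginary
    part of the modulated gradient) and [N = |u|^2 - rho].

    Once the gradients of the time derivatives of [a] and [b] are integrated by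
    parts, the equations turn the time derivative of the energy density into
      [- sum_(i, k) (A_i A_k + B_i B_k) d_k v_i - 1/2 N^2 div v
       + eps^2 / 4 (div v) Laplacian(|u|^2) + div Q]
    with an energy flux [Q] built from [A], [B] and [v]
    ([energy_density_identity]). The first two terms are bounded by the energy
    because [grad v] is bounded. The flux [Q] is tangent to the boundary because
    [grad a], [grad b] and [v] satisfy the Neumann condition, so that [div Q]
    integrates to zero. In the third term the Laplacian is integrated by parts
    onto [div v] ([lap_mass_by_parts]); since [eps / 2 grad |u|^2 = a A + b B],
    what remains is [- eps / 2 (grad div v) . (a A + b B)], where [grad div v] is
    bounded and square integrable. The function [|u|^2] is not bounded uniformly in [eps], but it is [N + rho], and the spare factor
    [eps] absorbs the contribution of [N] ([dispersive_bound]). Altogether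
    [H' <= C (H + eps^2)] with [C] independent of [eps], and Gronwall's lemma
    gives [H = O(eps^2)] on [[0, T]] ([energy_bound]). The density estimate is
    part of this bound. The momentum differs from [rho v] by [a B - b A + N v],
    which on a compact set is [O(eps)] in [L^1] because there the mass is
    integrable ([momentum_gap_L1]).

    Two points need analysis. Integrals of divergences must vanish on a domain
    whose boundary is merely of class C^1 and which may be unbounded. No trace
    theory is used: there are test functions, tending to 1 on the domain, whose
    gradients are asymptotically orthogonal in the mean to every integrable
    field whose normal component tends to zero at the boundary
    ([exhausting_tests]), and integration by parts against test functions only
    needs Fubini and the fundamental theorem of calculus
    ([integral_pderiv0]). They give [no_flux_divergence] and its variant
    [weak_no_flux_divergence] for the weak third derivatives of [phi].

    Secondly, [H] must be differentiated although the equations hold pointwise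
    and [A], [B] involve [grad u], which has no time derivative. The difference
    quotients of [a], [b], [rho] and [v] converge in [L^2] at interior times, by
    the equations ([quotient_conv2]); the increment of [H] is written by means
    of these quotients only, the gradients of the increments of [a] and [b]
    being integrated by parts before the limit is taken
    ([half_energy_quotient], [energy_is_derive]). The Sobolev-type hypotheses
    are used through the classical derivatives, with which the weak ones
    coincide almost everywhere ([weak_classical]). *)

(** * Square-integrable functions *)
Section square_integrable.
Context d (S : measurableType d) (R : realType).
Variables (mu : {measure set S -> \bar R}) (D : set S).
Hypothesis mD : measurable D.
Implicit Types (f g h : S -> R).

Definition L1 f := mu.-integrable D (EFin \o f).
Definition L2 f := measurable_fun D f /\ L1 (fun x => f x ^+ 2).
Local Notation I f := (Rintegral mu D f).

Lemma L1_measurable f : L1 f -> measurable_fun D f.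
Proof. by move=> /measurable_int /measurable_EFinP. Qed.

Lemma L1_eq f g : (forall x, D x -> f x = g x) -> L1 f -> L1 g.
Proof.
move=> fg; apply: eq_integrable => // x /set_mem Dx /=.
by rewrite fg.
Qed.

Lemma L1_le f g : measurable_fun D f -> (forall x, D x -> `|f x| <= g x) ->
  L1 g -> L1 f.
Proof.
move=> mf fg; apply: le_integrable => //; first exact/measurable_EFinP.
by move=> x Dx /=; rewrite lee_fin (le_trans (fg x Dx))// ler_norm.
Qed.

Lemma L1D f g : L1 f -> L1 g -> L1 (fun x => f x + g x).
Proof. by move=> Lf Lg; apply: (integrableD mD Lf Lg). Qed.

Lemma L1B f g : L1 f -> L1 g -> L1 (fun x => f x - g x).
Proof. by move=> Lf Lg; apply: (integrableB mD Lf Lg). Qed.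

Lemma L1Z (c : R) f : L1 f -> L1 (fun x => c * f x).
Proof. by move=> Lf; apply: (integrableZl mD c Lf). Qed.

Lemma L1N f : L1 f -> L1 (fun x => - f x).
Proof. by move=> /(L1Z (-1)); apply: L1_eq => x _; rewrite mulN1r. Qed.

Lemma L1_0 : L1 (fun=> 0).
Proof. exact: integrable0. Qed.

Lemma L1_sum (T : Type) (r : seq T) (P : pred T) (F : T -> S -> R) :
  (forall i, L1 (F i)) -> L1 (fun x => \sum_(i <- r | P i) F i x).
Proof.
move=> LF; elim: r => [|i r IH].
  by apply: (L1_eq _ L1_0) => x _; rewrite big_nil.
under eq_fun do rewrite big_cons.
by case: (P i) => //; apply: L1D.
Qed.

Lemma L1_norm f : L1 f -> L1 (fun x => `|f x|).
Proof. exact: integrable_norm. Qed.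

Lemma L1_bddM (M : R) f g : measurable_fun D f ->
  (forall x, D x -> `|f x| <= M) -> L1 g -> L1 (fun x => f x * g x).
Proof.
move=> mf fM Lg; apply: (@L1_le _ (fun x => M * `|g x|)).
- by apply: measurable_funM => //; exact: L1_measurable.
- by move=> x Dx; rewrite normrM ler_wpM2r// fM.
- exact/L1Z/L1_norm.
Qed.

Lemma I_eq f g : (forall x, D x -> f x = g x) -> I f = I g.
Proof. by move=> fg; apply: eq_Rintegral => x /set_mem; exact: fg. Qed.

Lemma I_D f g : L1 f -> L1 g -> I (fun x => f x + g x) = I f + I g.
Proof. exact: RintegralD. Qed.

Lemma I_B f g : L1 f -> L1 g -> I (fun x => f x - g x) = I f - I g.
Proof. exact: RintegralB. Qed.

Lemma I_Z (c : R) f : L1 f -> I (fun x => c * f x) = c * I f.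
Proof. exact: RintegralZl. Qed.

Lemma I_0 : I (fun=> 0) = 0.
Proof. by rewrite /Rintegral integral0. Qed.

Lemma I_sum (T : Type) (r : seq T) (P : pred T) (F : T -> S -> R) :
  (forall i, L1 (F i)) ->
  I (fun x => \sum_(i <- r | P i) F i x) = \sum_(i <- r | P i) I (F i).
Proof.
move=> LF; elim: r => [|i r IH].
  rewrite big_nil -[RHS]I_0; apply: I_eq => x _; by rewrite big_nil.
rewrite big_cons; under eq_fun do rewrite big_cons.
by case: (P i) => //; rewrite I_D ?IH//; exact: L1_sum.
Qed.

Lemma I_ge0 f : (forall x, D x -> 0 <= f x) -> 0 <= I f.
Proof. exact: Rintegral_ge0. Qed.

Lemma I_le f g : L1 f -> L1 g -> (forall x, D x -> f x <= g x) -> I f <= I g.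
Proof. exact: le_Rintegral. Qed.

Lemma I_norm f : L1 f -> `|I f| <= I (fun x => `|f x|).
Proof. exact: le_normr_Rintegral. Qed.

Lemma I_EFin f : L1 f -> (I f)%:E = (\int[mu]_(x in D) (f x)%:E)%E.
Proof. by move=> Lf; rewrite /Rintegral fineK//; exact: integrable_fin_num. Qed.

Lemma I_dominated (F : nat -> S -> R) f g :
  (forall k, measurable_fun D (F k)) ->
  (forall x, D x -> F k x @[k --> \oo] --> f x) ->
  (forall k x, D x -> `|F k x| <= g x) -> L1 g ->
  L1 f /\ I (F k) @[k --> \oo] --> I f.
Proof.
move=> mF Ff Fg Lg.
have LF k : L1 (F k) by apply: L1_le Lg => //; exact: Fg.
have mf : measurable_fun D f.
  by apply: (measurable_fun_cvg mF) => x Dx; apply: Ff.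
have [||||//|Lf _ If] := @dominated_convergence _ _ _ mu D mD
  (fun k => EFin \o F k) (EFin \o f) (EFin \o g).
- by move=> k; apply/measurable_EFinP.
- exact/measurable_EFinP.
- apply: aeW => x Dx; apply: cvg_EFin; first exact: nearW.
  exact: Ff.
- exact: Lg.
- by apply: aeW => x k Dx /=; rewrite lee_fin Fg.
by split=> //; apply: fine_cvg; rewrite I_EFin.
Qed.

Lemma L2_eq f g : (forall x, D x -> f x = g x) -> L2 f -> L2 g.
Proof.
move=> fg [mf Lf]; split; last by apply: L1_eq Lf => x Dx; rewrite fg.
by apply: eq_measurable_fun mf => x /set_mem; exact: fg.
Qed.

Lemma L2M f g : L2 f -> L2 g -> L1 (fun x => f x * g x).
Proof.
move=> [mf Lf] [mg Lg]; apply: L1_le (L1D Lf Lg).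
  exact: measurable_funM.
move=> x _; rewrite ler_norml; apply/andP; split; nra.
Qed.

Lemma L2Z (c : R) f : L2 f -> L2 (fun x => c * f x).
Proof.
move=> [mf Lf]; split; first exact: measurable_funM.
by apply: L1_eq (L1Z (c ^+ 2) Lf) => x _; rewrite exprMn.
Qed.

Lemma L2D f g : L2 f -> L2 g -> L2 (fun x => f x + g x).
Proof.
move=> Lf Lg; split; first by apply: measurable_funD; [case: Lf|case: Lg].
apply: L1_eq (L1D (L1D Lf.2 Lg.2) (L1Z 2 (L2M Lf Lg))) => x _.
by rewrite sqrrD; ring.
Qed.

Lemma L2N f : L2 f -> L2 (fun x => - f x).
Proof. by move=> /(L2Z (-1)); apply: L2_eq => x _; rewrite mulN1r. Qed.

Lemma L2B f g : L2 f -> L2 g -> L2 (fun x => f x - g x).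
Proof. by move=> Lf /L2N; exact: L2D. Qed.

Lemma L2_0 : L2 (fun=> 0).
Proof. by split=> //; apply: L1_eq L1_0 => x _; rewrite expr0n. Qed.

Lemma L2_sum (T : Type) (r : seq T) (P : pred T) (F : T -> S -> R) :
  (forall i, L2 (F i)) -> L2 (fun x => \sum_(i <- r | P i) F i x).
Proof.
move=> LF; elim: r => [|i r IH].
  by apply: (L2_eq _ L2_0) => x _; rewrite big_nil.
under eq_fun do rewrite big_cons.
by case: (P i) => //; apply: L2D.
Qed.

Lemma L2_bddM (M : R) f g : measurable_fun D f ->
  (forall x, D x -> `|f x| <= M) -> L2 g -> L2 (fun x => f x * g x).
Proof.
move=> mf fM Lg; split; first by apply: measurable_funM => //; case: Lg.
apply: (@L1_eq (fun x => f x ^+ 2 * g x ^+ 2)).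
  by move=> x _; rewrite exprMn.
apply: (@L1_bddM (M ^+ 2)); [exact: measurable_funX| |exact: Lg.2].
by move=> x Dx; rewrite normrX lerXn2r ?nnegrE ?fM// (le_trans _ (fM x Dx)).
Qed.

Definition n2 f : R := Num.sqrt (I (fun x => f x ^+ 2)).

Lemma n2_ge0 f : 0 <= n2 f. Proof. exact: sqrtr_ge0. Qed.

Lemma n2_sqr f : n2 f ^+ 2 = I (fun x => f x ^+ 2).
Proof. by rewrite sqr_sqrtr//; apply: I_ge0 => x _; exact: sqr_ge0. Qed.

Lemma n2_eq f g : (forall x, D x -> f x = g x) -> n2 f = n2 g.
Proof. by move=> fg; congr Num.sqrt; apply: I_eq => x Dx; rewrite fg. Qed.

(** Cauchy-Schwarz, from the nonnegative quadratic form
    [l |-> \int (l f + g)^2]. *)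
Lemma Cauchy_Schwarz_L2 f g : L2 f -> L2 g -> `|I (fun x => f x * g x)| <= n2 f * n2 g.
Proof.
move=> Lf Lg; set p := I _.
have Q l : 0 <= l ^+ 2 * n2 f ^+ 2 + l * 2 * p + n2 g ^+ 2.
  have Lff := L1Z (l ^+ 2) Lf.2; have Lfg := L1Z (l * 2) (L2M Lf Lg).
  rewrite !n2_sqr /p -!I_Z; [|exact: L2M|exact: Lf.2].
  rewrite -(I_D Lff Lfg) -(I_D (L1D Lff Lfg) Lg.2).
  apply: I_ge0 => x _.
  rewrite (_ : _ + _ = (l * f x + g x) ^+ 2) ?sqr_ge0//; ring.
have := n2_ge0 f; have := n2_ge0 g; move: (n2 f) (n2 g) Q => F G Q G0 F0.
rewrite -ler_sqr ?nnegrE ?mulr_ge0// real_normK ?num_real// exprMn.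
have [F00|Fn] := eqVneq F 0.
  have p0 : p = 0.
    apply: contrapT => /eqP pn; have := Q (- (G ^+ 2 + 1) / (2 * p)).
    rewrite F00 (_ : _ + _ = - 1)//; first by rewrite oppr_ge0 ler10.
    by field.
  by rewrite p0 F00 expr0n/= mul0r.
have := Q (- p / F ^+ 2).
rewrite (_ : _ + _ = G ^+ 2 - p ^+ 2 / F ^+ 2); last by field.
rewrite subr_ge0 ler_pdivrMr ?exprn_gt0 ?lt_neqAle ?F0 1?eq_sym ?Fn//.
by rewrite mulrC.
Qed.

Lemma n2D f g : L2 f -> L2 g -> n2 (fun x => f x + g x) <= n2 f + n2 g.
Proof.
move=> Lf Lg; rewrite -ler_sqr ?nnegrE ?addr_ge0 ?n2_ge0//.
rewrite sqrrD n2_sqr.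
have -> : I (fun x => (f x + g x) ^+ 2) =
    n2 f ^+ 2 + 2 * I (fun x => f x * g x) + n2 g ^+ 2.
  have Lfg := L1Z 2 (L2M Lf Lg).
  rewrite !n2_sqr -I_Z; last exact: L2M.
  rewrite -(I_D Lf.2 Lfg) -(I_D (L1D Lf.2 Lfg) Lg.2).
  by apply: I_eq => x _; ring.
rewrite lerD2r lerD2l -[leRHS]mulr_natl ler_pM2l//.
exact: le_trans (ler_norm _) (Cauchy_Schwarz_L2 Lf Lg).
Qed.

Lemma n2Z (c : R) f : L2 f -> n2 (fun x => c * f x) = `|c| * n2 f.
Proof.
move=> Lf; rewrite /n2 -sqrtr_sqr -sqrtrM ?sqr_ge0// -I_Z ?Lf.2//.
by congr Num.sqrt; apply: I_eq => x _; rewrite exprMn.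
Qed.

Lemma n2_le f g : L2 f -> L2 g -> (forall x, D x -> `|f x| <= `|g x|) -> n2 f <= n2 g.
Proof.
move=> Lf Lg fg; rewrite ler_wsqrtr// I_le ?Lf.2 ?Lg.2// => x Dx.
by rewrite -(real_normK (num_real (f x))) -(real_normK (num_real (g x)))
  lerXn2r ?nnegrE ?fg.
Qed.

(** Fatou's lemma turns uniform bounds on truncated norms into membership. *)
Lemma L2_truncated f (chi : nat -> S -> R) (C : R) : measurable_fun D f ->
  (forall k, measurable_fun D (chi k)) -> (forall k x, D x -> 0 <= chi k x) ->
  (forall x, D x -> chi k x @[k --> \oo] --> (1 : R)) ->
  (forall k, L1 (fun x => chi k x * f x ^+ 2)) ->
  (forall k, I (fun x => chi k x * f x ^+ 2) <= C) ->
  L2 f /\ I (fun x => f x ^+ 2) <= C.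
Proof.
move=> mf mchi chi0 chi1 Lk Ik.
have mf2 : measurable_fun D (fun x => f x ^+ 2) by exact: measurable_funX.
have int_le : (\int[mu]_(x in D) (f x ^+ 2)%:E <= C%:E)%E.
  have -> : (\int[mu]_(x in D) (f x ^+ 2)%:E =
     \int[mu]_(x in D) limn_einf (fun k => (chi k x * f x ^+ 2)%:E))%E.
    apply: eq_integral => x /set_mem Dx.
    have h : (chi k x * f x ^+ 2)%:E @[k --> \oo] --> (f x ^+ 2)%:E.
      apply: cvg_EFin; first exact: nearW.
      rewrite -[X in _ --> X]mul1r; apply: cvgMl; exact: chi1.
    by rewrite is_cvg_limn_einfE; [rewrite (cvg_lim _ h)|apply: cvgP h].
  apply: le_trans (fatou mu mD _ _) _.
  - move=> k; apply/measurable_EFinP; apply: measurable_funM => //.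
  - by move=> k x Dx; rewrite lee_fin mulr_ge0 ?sqr_ge0 ?chi0.
  rewrite limn_einf_lim; apply: lime_le; first exact: is_cvg_einfs.
  apply: nearW => k; apply: (@le_trans _ _ (\int[mu]_(x in D) (chi k x * f x ^+ 2)%:E)%E).
    by apply: ereal_inf_lbound; exists k => /=.
  by rewrite -I_EFin// lee_fin.
have Lf : L1 (fun x => f x ^+ 2).
  apply/integrableP; split; first exact/measurable_EFinP.
  rewrite (eq_integral (fun x => (f x ^+ 2)%:E)); last first.
    by move=> x _ /=; rewrite ger0_norm ?sqr_ge0.
  exact: le_lt_trans int_le (ltry _).
by split => //; rewrite -lee_fin I_EFin.
Qed.

Section convergence.
Context {I0 : Type} (F : set_system I0) {FF : Filter F}.
Implicit Types (p q : I0 -> S -> R).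

(** Convergence in [L^2(D)] along [F]. Membership of [p s] is only asked near the
    limit, since difference quotients degenerate at the base time. *)
Definition conv2 p f := L2 f /\ forall e : R, 0 < e ->
  \forall s \near F, L2 (p s) /\ n2 (fun x => p s x - f x) <= e.

(** Convergence in [L^oo(D)], with suprema in place of essential suprema: all
    the functions met here are continuous on an open set. *)
Definition convoo p f := [/\ measurable_fun D f,
  exists M : R, forall x, D x -> `|f x| <= M &
  forall e : R, 0 < e ->
  \forall s \near F, measurable_fun D (p s) /\
    forall x, D x -> `|p s x - f x| <= e].

Lemma conv2_L2 p f : conv2 p f -> L2 f.
Proof. by case. Qed.

Lemma conv2_near p f : conv2 p f -> \forall s \near F, L2 (p s).
Proof. by move=> [_ /(_ _ ltr01)]; apply: filterS => s []. Qed.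

Lemma conv2_cst f : L2 f -> conv2 (fun=> f) f.
Proof.
move=> Lf; split=> // e e0; apply: nearW => s; split=> //.
rewrite /n2 (@I_eq _ (fun=> 0)) ?I_0 ?sqrtr0 ?ltW// => x _.
by rewrite subrr expr0n.
Qed.

Lemma convoo_cst f M : measurable_fun D f -> (forall x, D x -> `|f x| <= M) ->
  convoo (fun=> f) f.
Proof.
move=> mf fM; split=> //; first by exists M.
by move=> e e0; apply: nearW => s; split=> // x _; rewrite subrr normr0 ltW.
Qed.

Lemma conv2_eq p q f g : (\forall s \near F, forall x, D x -> p s x = q s x) ->
  (forall x, D x -> f x = g x) -> conv2 p f -> conv2 q g.
Proof.
move=> pq fg [Lf H]; split; first exact: L2_eq Lf.
move=> e /H; apply: filterS2 pq => s pq [Lp ?]; split; first exact: L2_eq Lp.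
by rewrite (@n2_eq _ (fun x => p s x - f x))// => x Dx; rewrite pq ?fg.
Qed.

Lemma conv2D p q f g : conv2 p f -> conv2 q g ->
  conv2 (fun s x => p s x + q s x) (fun x => f x + g x).
Proof.
move=> [Lf Hp] [Lg Hq]; split; first exact: L2D.
move=> e e0; have e2 : 0 < e / 2 by rewrite divr_gt0.
apply: filterS2 (Hp _ e2) (Hq _ e2) => s [Lp pe] [Lq qe].
split; first exact: L2D.
rewrite (@n2_eq _ (fun x => (p s x - f x) + (q s x - g x))); last first.
  by move=> x _; ring.
apply: le_trans (n2D (L2B Lp Lf) (L2B Lq Lg)) _; lra.
Qed.

Lemma conv2Z (c : R) p f : conv2 p f ->
  conv2 (fun s x => c * p s x) (fun x => c * f x).
Proof.
move=> [Lf Hp]; split; first exact: L2Z.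
move=> e e0; have e2 : 0 < e / (`|c| + 1) by rewrite divr_gt0// ltr_wpDl.
apply: filterS (Hp _ e2) => s [Lp pe]; split; first exact: L2Z.
rewrite (@n2_eq _ (fun x => c * (p s x - f x))); last by move=> x _; ring.
rewrite n2Z; last exact: L2B.
apply: (@le_trans _ _ (`|c| * (e / (`|c| + 1)))); first by rewrite ler_wpM2l.
rewrite mulrCA -[leRHS]mulr1 ler_wpM2l ?(ltW e0)//.
by rewrite ler_pdivrMr ?ltr_wpDl// mul1r lerDl.
Qed.

Lemma conv2N p f : conv2 p f -> conv2 (fun s x => - p s x) (fun x => - f x).
Proof.
move/(conv2Z (-1)); apply: conv2_eq; last by move=> x _; rewrite mulN1r.
by apply: nearW => s x _; rewrite mulN1r.
Qed.

Lemma conv2B p q f g : conv2 p f -> conv2 q g ->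
  conv2 (fun s x => p s x - q s x) (fun x => f x - g x).
Proof. by move=> Hp /conv2N; exact: conv2D. Qed.

Lemma conv2_sum (T : Type) (r : seq T) (P : pred T) (p : T -> I0 -> S -> R) (f : T -> S -> R) :
  (forall i, conv2 (p i) (f i)) ->
  conv2 (fun s x => \sum_(i <- r | P i) p i s x)
        (fun x => \sum_(i <- r | P i) f i x).
Proof.
move=> H; elim: r => [|i r IH].
  apply: (conv2_eq _ _ (conv2_cst L2_0)).
    by apply: nearW => s x _; rewrite big_nil.
  by move=> x _; rewrite big_nil.
apply: (@conv2_eq (fun s x => if P i then p i s x + \sum_(j <- r | P j) p j s x
   else \sum_(j <- r | P j) p j s x) _
  (fun x => if P i then f i x + \sum_(j <- r | P j) f j x
   else \sum_(j <- r | P j) f j x)).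
- by apply: nearW => s x _; rewrite big_cons.
- by move=> x _; rewrite big_cons.
- by case: (P i) => //; exact: conv2D.
Qed.

Lemma convooD p q f g : convoo p f -> convoo q g ->
  convoo (fun s x => p s x + q s x) (fun x => f x + g x).
Proof.
move=> [mf [M fM] Hp] [mg [K gK] Hq]; split; first exact: measurable_funD.
  exists (M + K) => x Dx; apply: le_trans (ler_normD _ _) _.
  by rewrite lerD ?fM ?gK.
move=> e e0; have e2 : 0 < e / 2 by rewrite divr_gt0.
apply: filterS2 (Hp _ e2) (Hq _ e2) => s [Lp pe] [Lq qe].
split=> [|x Dx]; first exact: measurable_funD.
rewrite (_ : _ - _ = (p s x - f x) + (q s x - g x)); last by ring.
by rewrite (splitr e) (le_trans (ler_normD _ _))// lerD ?pe ?qe.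
Qed.

(** The second factor is bounded near the limit, so the product rule only
    needs [p q - f g = (p - f) q + f (q - g)]. *)
Lemma conv2M p q f g : conv2 p f -> convoo q g ->
  conv2 (fun s x => p s x * q s x) (fun x => f x * g x).
Proof.
move=> [Lf Hp] [mg [M gM] Hq].
have fgL (h k : S -> R) K : L2 h -> measurable_fun D k ->
    (forall x, D x -> `|k x| <= K) -> L2 (fun x => h x * k x).
  by move=> Lh mk kK; apply: (L2_eq _ (L2_bddM mk kK Lh)) => x _; rewrite mulrC.
split; first exact: fgL gM.
move=> e e0; set K := `|M| + 1; set G := n2 f + 1.
have K0 : 0 < K by rewrite ltr_wpDl.
have G0 : 0 < G by rewrite ltr_wpDl ?n2_ge0.
have e1 : 0 < e / 2 / K by rewrite !divr_gt0.
have e2 : 0 < Num.min 1 (e / 2 / G) by rewrite lt_min ltr01 !divr_gt0.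
apply: filterS2 (Hp _ e1) (Hq _ e2) => s [Lp pe] [mq qe].
have qK x : D x -> `|q s x| <= K.
  move=> Dx; rewrite -[q s x](subrK (g x)) (le_trans (ler_normD _ _))//.
  rewrite addrC lerD//; first exact: le_trans (gM x Dx) (ler_norm _).
  by apply: le_trans (qe x Dx) _; rewrite ge_min lexx.
have Lpq := fgL _ _ _ Lp mq qK; split=> //.
have L1' := fgL _ _ _ (L2B Lp Lf) mq qK.
have qgG x : D x -> `|q s x - g x| <= e / 2 / G.
  by move=> Dx; apply: le_trans (qe x Dx) _; rewrite ge_min lexx orbT.
have L2' := fgL _ _ _ Lf (measurable_funB mq mg) qgG.
rewrite (@n2_eq _ (fun x => (p s x - f x) * q s x + f x * (q s x - g x))); last first.
  by move=> x _; ring.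
apply: le_trans (n2D L1' L2') _; rewrite (splitr e) lerD//.
- apply: (@le_trans _ _ (n2 (fun x => K * (p s x - f x)))).
    apply: n2_le => //; first exact/L2Z/L2B.
    by move=> x Dx; rewrite mulrC !normrM (gtr0_norm K0) ler_wpM2r// qK.
  rewrite n2Z; last exact: L2B.
  by rewrite (gtr0_norm K0) mulrC -ler_pdivlMr.
- apply: (@le_trans _ _ (n2 (fun x => e / 2 / G * f x))).
    apply: n2_le => //; first exact: L2Z.
    have h0 : 0 <= e / 2 / G by rewrite ltW// !divr_gt0.
    move=> x Dx; rewrite mulrC normrM [leRHS]normrM (ger0_norm h0).
    by rewrite ler_wpM2r// qgG.
  have h0 : 0 <= e / 2 / G by rewrite ltW// !divr_gt0.
  rewrite n2Z// (ger0_norm h0) -(mulrA (e / 2)).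
  rewrite -[leRHS]mulr1 ler_wpM2l ?divr_ge0 ?(ltW e0)//.
  by rewrite mulrC ler_pdivrMr// mul1r lerDl.
Qed.

(** Products of two [L^2] limits converge in [L^1]; this is how every limit of
    integrals in the energy derivative is taken. *)
Lemma cvg_I p q f g : conv2 p f -> conv2 q g ->
  I (fun x => p s x * q s x) @[s --> F] --> I (fun x => f x * g x).
Proof.
move=> [Lf Hp] [Lg Hq]; apply/cvgrPdist_le => e e0.
set K := n2 f + n2 g + 1.
have K0 : 0 < K by rewrite /K; have := n2_ge0 f; have := n2_ge0 g; lra.
have e1 : 0 < Num.min 1 (e / K) by rewrite lt_min ltr01 divr_gt0.
apply: filterS2 (Hp _ e1) (Hq _ e1) => s [Lp pe] [Lq qe].
have pe' : n2 (fun x => p s x - f x) <= e / K.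
  by apply: le_trans pe _; rewrite ge_min lexx orbT.
have qe' : n2 (fun x => q s x - g x) <= e / K.
  by apply: le_trans qe _; rewrite ge_min lexx orbT.
have pe1 : n2 (fun x => p s x - f x) <= 1.
  by apply: le_trans pe _; rewrite ge_min lexx.
have La := L2M (L2B Lp Lf) (L2B Lq Lg).
have Lb := L2M (L2B Lp Lf) Lg; have Lc := L2M Lf (L2B Lq Lg).
have Ca := Cauchy_Schwarz_L2 (L2B Lp Lf) (L2B Lq Lg).
have Cb := Cauchy_Schwarz_L2 (L2B Lp Lf) Lg.
have Cc := Cauchy_Schwarz_L2 Lf (L2B Lq Lg).
rewrite distrC -(I_B (L2M Lp Lq) (L2M Lf Lg)).
rewrite (@I_eq _ (fun x => (p s x - f x) * (q s x - g x) + (p s x - f x) * g x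
    + f x * (q s x - g x))); last by move=> x _; ring.
rewrite (I_D (L1D La Lb) Lc) (I_D La Lb).
apply: le_trans (ler_normD _ _) _.
apply: le_trans (lerD (ler_normD _ _) (lexx _)) _.
apply: le_trans (lerD (lerD Ca Cb) Cc) _.
set P := n2 _ in pe' pe1 *; set Q := n2 _ in qe' *.
have -> : e = e / K * (1 + n2 g + n2 f) by rewrite /K; field; rewrite -/K gt_eqF.
have P0 : 0 <= P by exact: n2_ge0. have Q0 : 0 <= Q by exact: n2_ge0.
have f0 := n2_ge0 f; have g0 := n2_ge0 g.
move: (e / K) pe' qe' => r pr qr.
have := ler_wpM2r g0 pr; have := ler_wpM2l f0 qr.
have : P * Q <= 1 * r by exact: ler_pM.
lra.
Qed.

End convergence.

End square_integrable.

(** * Borel sets and Lebesgue measure of row vectors *)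
Section measure_rV.
Context {R : realType}.

Lemma ball_rVP n (x y : 'rV[R]_n) (r : R) :
  ball x r y <-> 0 < r /\ forall i, `|x ord0 i - y ord0 i| < r.
Proof.
split=> [[r0 H]|[r0 H]]; split=> // i; first exact: H.
by move=> j; rewrite (ord1 i); exact: H.
Qed.

Lemma ler_coord n (x : 'rV[R]_n) (M : R) : 0 <= M ->
  (forall i, `|x ord0 i| <= M) -> `|x| <= M.
Proof.
move=> M0 H; rewrite [leLHS]/Num.Def.normr/= mx_normrE.
by apply/bigmax_leP; split=> // -[i j] _ /=; rewrite ord1.
Qed.

Lemma coord_le n (x : 'rV[R]_n) i : `|x ord0 i| <= `|x|.
Proof.
rewrite [leRHS]/Num.Def.normr/= mx_normrE.
exact: (@le_bigmax_cond _ _ _ 0 (ord0, i) predT (fun ij => `|x ij.1 ij.2|)).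
Qed.

Lemma measurable_preim_coord n (i : 'I_n) (A : set R) : measurable A ->
  measurable [set y : 'rV[R]_n | A (y ord0 i)].
Proof.
by move=> mA; rewrite -[X in measurable X]setTI; exact: measurable_coord.
Qed.

Lemma measurable_box n (A : 'I_n -> set R) : (forall i, measurable (A i)) ->
  measurable [set y : 'rV[R]_n | forall i, A i (y ord0 i)].
Proof.
move=> mA; rewrite (_ : mkset _ =
  \big[setI/setT]_(i < n) [set y : 'rV[R]_n | A i (y ord0 i)]); last first.
  rewrite -bigcap_seq; apply/seteqP; split=> y /= H i.
    by move=> _; exact: H.
  by apply: (H i); rewrite /= mem_index_enum.
by apply: bigsetI_measurable => i _; exact: measurable_preim_coord.
Qed.

Lemma measurable_ball_rV n (x : 'rV[R]_n) (r : R) : measurable (ball x r).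
Proof.
have [r0|r0] := ltP 0 r; last first.
  rewrite (_ : ball x r = set0) ?measurable0//.
  by apply/seteqP; split=> // y /ball_rVP[]; rewrite ltNge r0.
rewrite (_ : ball x r = [set y | forall i, ball (x ord0 i) r (y ord0 i)]).
  apply: (@measurable_box n (fun i => ball (x ord0 i) r)) => i.
  exact: measurable_ball.
apply/seteqP; split=> y /=; first by move=> /ball_rVP[_ H] i; exact: H.
by move=> H; apply/ball_rVP; split=> // i; exact: H.
Qed.

Definition open_boxes n : set (set 'rV[R]_n) := [set B | exists lo hi : 'rV[R]_n,
  B = [set y : 'rV[R]_n | forall i, lo ord0 i < y ord0 i < hi ord0 i]].

Lemma open_boxes_setI n : setI_closed (@open_boxes n).
Proof.
move=> _ _ [lo [hi ->]] [lo' [hi' ->]].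
exists (\row_i Num.max (lo ord0 i) (lo' ord0 i)).
exists (\row_i Num.min (hi ord0 i) (hi' ord0 i)).
apply/seteqP; split=> y /=.
  move=> [H H'] i; rewrite !mxE gt_max lt_min.
  by move: (H i) (H' i) => /andP[-> ->] /andP[-> ->].
by move=> H; split=> i; move: (H i); rewrite !mxE gt_max lt_min =>
  /andP[/andP[? ?] /andP[? ?]]; apply/andP.
Qed.

Lemma measurable_open_boxes n : @open_boxes n `<=` measurable.
Proof.
move=> _ [lo [hi ->]].
rewrite (_ : mkset _ = [set y : 'rV[R]_n | forall i,
    `](lo ord0 i), (hi ord0 i)[%classic (y ord0 i)]).
  by apply: (@measurable_box n (fun i => `](lo ord0 i), (hi ord0 i)[%classic)).
by apply/seteqP; split=> y H i; have := H i; rewrite /= in_itv.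
Qed.

(** The countably many boxes with rational corners that an open set contains
    cover it. *)
Lemma open_sigma_boxes n (U : set 'rV[R]_n) : open U -> <<s @open_boxes n >> U.
Proof.
move=> oU; pose B (q : 'rV[rat]_n * 'rV[rat]_n) := [set y : 'rV[R]_n |
  forall i, (ratr (q.1 ord0 i) : R) < y ord0 i < ratr (q.2 ord0 i)].
pose BU q := if `[< B q `<=` U >] then B q else set0.
have -> : U = \bigcup_q BU q.
  apply/seteqP; split; last first.
    by move=> y [q _]; rewrite /BU; case: asboolP => // BqU; exact: BqU.
  move=> x Ux; have /nbhs_ballP[e /= e0 xeU] : nbhs x U by exact: open_nbhs_nbhs.
  have lo i : {q : rat | ratr q \in `]x ord0 i - e, x ord0 i[}.
    by apply/cid; apply: rat_in_itvoo; rewrite gtrBl.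
  have hi i : {q : rat | ratr q \in `]x ord0 i, x ord0 i + e[}.
    by apply/cid; apply: rat_in_itvoo; rewrite ltrDl.
  exists (\row_i sval (lo i), \row_i sval (hi i)) => //.
  rewrite /BU asboolT => [i|y Hy].
    move: (svalP (lo i)) (svalP (hi i)).
    by rewrite /= !mxE !in_itv/= => /andP[_ ->] /andP[->].
  apply: xeU; apply/ball_rVP; split=> // i.
  move: (svalP (lo i)) (svalP (hi i)) (Hy i).
  rewrite /= !mxE !in_itv/= ltr_distlC => /andP[h1 h2] /andP[h3 h4] /andP[h5 h6].
  by rewrite (lt_trans h1 h5) (lt_trans h6 h4).
have BUs q : <<s @open_boxes n >> (BU q).
  rewrite /BU; case: asboolP => _; last exact: sigma_algebra0.
  apply: sub_sigma_algebra; exists (\row_i ratr (q.1 ord0 i)).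
  exists (\row_i ratr (q.2 ord0 i)).
  by apply/seteqP; split=> y /= H i; have := H i; rewrite !mxE.
apply: (@countable_bigcupT_measurable _ (g_sigma_algebraType (@open_boxes n))) => //.
Qed.

Lemma open_measurable_rV n (U : set 'rV[R]_n) : open U -> measurable U.
Proof.
move=> /open_sigma_boxes; apply: smallest_sub; last exact: measurable_open_boxes.
exact: sigma_algebra_measurable.
Qed.

Lemma measurable_rVE n : @measurable _ 'rV[R]_n = <<s @open_boxes n >>.
Proof.
apply/seteqP; split; last first.
  apply: smallest_sub; last exact: measurable_open_boxes.
  exact: sigma_algebra_measurable.
apply: smallest_sub; first exact: smallest_sigma_algebra.
rewrite -bigcup_seq; apply: bigcup_sub => i _ _ [B mB <-]; rewrite setTI.
suff : measurable_fun [set: g_sigma_algebraType (@open_boxes n)]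
    (fun y : g_sigma_algebraType (@open_boxes n) => (y : 'rV[R]_n) ord0 i).
  by move=> /(_ measurableT _ mB); rewrite setTI.
apply: (measurability _ (RGenOpens.measurableE R)).
move=> _ [_ [a [b ->] <-]]; rewrite setTI; apply: open_sigma_boxes.
apply: (@open_comp _ _ (fun y : 'rV[R]_n => y ord0 i)); last exact: interval_open.
by move=> y _; exact: coord_continuous.
Qed.

Lemma closed_measurable_rV n (A : set 'rV[R]_n) : closed A -> measurable A.
Proof.
by move/closed_openC/open_measurable_rV/measurableC; rewrite setCK.
Qed.

Lemma compact_closed_rV n (K : set 'rV[R]_n) : compact K -> closed K.
Proof. by apply: compact_closed; exact: norm_hausdorff. Qed.

Lemma compact_measurable_rV n (K : set 'rV[R]_n) : compact K -> measurable K.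
Proof. by move=> /compact_closed_rV/closed_measurable_rV. Qed.

Lemma continuous_measurable_rV n (O : set 'rV[R]_n) (f : 'rV[R]_n -> R) :
  open O -> {within O, continuous f} -> measurable_fun O f.
Proof.
move=> oO; rewrite continuous_open_subspace// => cf.
apply: (measurability _ (RGenOpens.measurableE R)).
move=> _ [_ [a [b ->] <-]]; apply: open_measurable_rV.
rewrite openE => x [Ox fx]; apply: filterI; first exact: open_nbhs_nbhs.
apply: cf; first exact/mem_set.
by apply: open_nbhs_nbhs; split=> //; exact: interval_open.
Qed.

Lemma measurable_fun_rV_on d' (S : measurableType d') n (D : set S)
    (f : S -> 'rV[R]_n) : measurable D ->
  (forall i, measurable_fun D (fun x => f x ord0 i)) -> measurable_fun D f.
Proof.
move=> mD mf.
have := @measurable_fun_rV _ R n _ S (fun x => \row_i ((fun x => f x ord0 i) \_ D) x).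
move=> H; apply: (@eq_measurable_fun _ _ _ _ D
   (fun x => \row_i ((fun x => f x ord0 i) \_ D) x)).
  move=> x xD; apply/rowP => i; rewrite mxE /patch; by rewrite xD.
apply: measurable_funTS; apply: H => i.
under eq_fun do rewrite mxE.
exact/(measurable_restrictT _ mD).
Qed.

Lemma measurable_row_on n (Om : set 'rV[R]_n) m (f : 'rV[R]_n -> 'rV[R]_m) :
  open Om -> (forall i, {within Om, continuous (fun x => f x ord0 i)}) ->
  measurable_fun Om f.
Proof.
move=> oO cf; apply: measurable_fun_rV_on; first exact: open_measurable_rV.
by move=> i; exact: continuous_measurable_rV.
Qed.

Lemma lebesgue_rVS n (A : set 'rV[R]_n.+1) :
  lebesgue_rV n.+1 A =
  (@lebesgue_measure R \x lebesgue_rV n)%E (@consrV R n @^-1` A).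
Proof. by []. Qed.

Lemma measurable_consrV_preim n (A : set 'rV[R]_n.+1) : measurable A ->
  measurable (@consrV R n @^-1` A).
Proof.
by move=> mA; rewrite -[X in measurable X]setTI; exact: measurable_consrV.
Qed.

Lemma lebesgue_ball n (c : 'rV[R]_n) (r : R) : 0 < r ->
  lebesgue_rV n (ball c r) = ((2 * r) ^+ n)%:E.
Proof.
move=> r0; elim: n c => [|n IH] c.
  rewrite /= expr0 diracE (_ : _ \in _)//; apply/mem_set/ball_rVP; split=> //.
  by case.
rewrite lebesgue_rVS (_ : _ @^-1` _ =
   ball (c ord0 ord0) r `*` ball (\row_j c ord0 (lift ord0 j)) r); last first.
  apply/seteqP; split=> -[x v] /=.
    move=> /ball_rVP[_ H]; split.
      by have := H ord0; rewrite consrV0.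
    by apply/ball_rVP; split=> // i; have := H (lift ord0 i); rewrite consrVS mxE.
  move=> [H1 /ball_rVP[_ H2]]; apply/ball_rVP; split=> // i.
  case: (unliftP ord0 i) => [j|] ->.
    by have := H2 j; rewrite consrVS mxE.
  by rewrite consrV0; exact: H1.
rewrite product_measure1E; [|exact: measurable_ball|exact: measurable_ball_rV].
rewrite IH [X in (X * _)%E](lebesgue_measure_ball _ (ltW r0)) -EFinM exprS.
by rewrite mulr_natl.
Qed.

(** Lines in a coordinate direction see the set in a segment of length at
    most [e], and the other coordinates stay in a box: hence the volume is
    [O(e)], one coordinate being integrated at a time. *)
Lemma lebesgue_thin n (i : 'I_n) (A : set 'rV[R]_n) (c : 'rV[R]_n) (r e : R) :
  measurable A -> 0 < r -> 0 <= e -> A `<=` ball c r ->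
  (forall x y, A x -> A y -> (forall j, j != i -> x ord0 j = y ord0 j) ->
     `|x ord0 i - y ord0 i| <= e) ->
  (lebesgue_rV n A <= (2 * e * (2 * r) ^+ n.-1)%:E)%E.
Proof.
move=> + r0 e0; elim: n i A c => [|n IH] i A c mA Ac HA; first by have := ltn_ord i.
rewrite lebesgue_rVS; set B := _ @^-1` A.
have mB : measurable B by exact: measurable_consrV_preim.
pose c' : 'rV[R]_n := \row_j c ord0 (lift ord0 j).
have AcB x v : A (consrV (x, v)) -> ball (c ord0 ord0) r x /\ ball c' r v.
  move=> /Ac /ball_rVP[_ H]; split.
    by have := H ord0; rewrite consrV0.
  by apply/ball_rVP; split=> // j; have := H (lift ord0 j); rewrite consrVS mxE.
case: (unliftP ord0 i) => [j|] ij; last first.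
  rewrite ij in HA.
  have -> : (@lebesgue_measure R \x lebesgue_rV n)%E B =
            (@lebesgue_measure R \x^ lebesgue_rV n)%E B.
    by apply: product_measure_unique => // X Y mX mY; exact: product_measure2E.
  rewrite /product_measure2.
  apply: (@le_trans _ _ (\int[lebesgue_rV n]_(v in ball c' r) (2 * e)%:E)%E).
    rewrite [leRHS]integral_mkcond; apply: ge0_le_integral => //.
    - exact: measurable_fun_ysection.
    - apply/(measurable_restrictT _ (measurable_ball_rV _ _)) => //.
    - move=> v _ /=; rewrite /patch; case: ifPn => [_|/negP vc]; last first.
        rewrite (_ : ysection B v = set0) ?measure0//.
        apply/seteqP; split=> // x; rewrite /ysection/= inE => /AcB[_ ?].
        by apply: vc; exact/mem_set.
      have [->|/set0P[x0]] := eqVneq (ysection B v) set0.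
        by rewrite measure0 lee_fin mulr_ge0.
      rewrite /ysection /= inE => Bx0.
      apply: (@le_trans _ _ (lebesgue_measure `[x0 - e, x0 + e]%classic)).
        apply: le_measure; rewrite ?inE//; first exact: measurable_ysection.
        move=> x; rewrite /ysection /= inE => Bx.
        have := HA _ _ Bx Bx0; rewrite !consrV0 in_itv/= -ler_distlC distrC; apply.
        move=> k; case: (unliftP ord0 k) => [l ->|-> /eqP//] _.
        by rewrite !consrVS.
      rewrite lebesgue_measure_itv/= lte_fin; case: ifPn => _.
        by rewrite -EFinD lee_fin; lra.
      by rewrite lee_fin mulr_ge0.
  rewrite integral_cst; last exact: measurable_ball_rV.
  by rewrite [X in (_ * X)%E](lebesgue_ball _ r0) -EFinM.
have n0 : n = n.-1.+1 by rewrite prednK//; case: j {ij} => j; exact: leq_ltn_trans.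
rewrite /product_measure1.
apply: (@le_trans _ _ (\int[@lebesgue_measure R]_(x in ball (c ord0 ord0) r)
   (2 * e * (2 * r) ^+ n.-1)%:E)%E).
  rewrite [leRHS]integral_mkcond; apply: ge0_le_integral => //.
  - exact: measurable_fun_xsection.
  - apply/(measurable_restrictT _ (measurable_ball _ _)) => //.
  - move=> x _ /=; rewrite /patch; case: ifPn => [_|/negP xc]; last first.
      rewrite (_ : xsection B x = set0) ?measure0//.
      apply/seteqP; split=> // v; rewrite /xsection/= inE => /AcB[? _].
      by apply: xc; exact/mem_set.
    apply: (IH j _ c'); first exact: measurable_xsection.
      by move=> v; rewrite /xsection/= inE => /AcB[].
    move=> v w; rewrite /xsection/= !inE => Bv Bw vw.
    have := HA _ _ Bv Bw; rewrite ij !consrVS; apply=> k.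
    case: (unliftP ord0 k) => [l ->|->]; last by rewrite !consrV0.
    rewrite (inj_eq lift_inj) !consrVS; exact: vw.
rewrite integral_cst; last exact: measurable_ball.
rewrite [X in (_ * X)%E](lebesgue_measure_ball _ (ltW r0)) -EFinM lee_fin.
rewrite [n.+1.-1]/= [X in _ <= _ * _ ^+ X]n0 exprS (mulr_natl r 2).
by rewrite -(mulrA (2 * e)) (mulrC _ (r *+ 2)).
Qed.

(** Nonempty open sets have positive measure, so an essential bound on a
    continuous function holds everywhere. *)
Lemma ae_le_continuous n (O : set 'rV[R]_n) (f : 'rV[R]_n -> R) (M : R) :
  open O -> {within O, continuous f} ->
  {ae lebesgue_rV n, forall x, O x -> `|f x| <= M} ->
  forall x, O x -> `|f x| <= M.
Proof.
move=> oO; rewrite continuous_open_subspace// => cf [N [mN N0 subN]] x Ox.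
rewrite leNgt; apply/negP => Mf.
have : nbhs x [set y | O y /\ M < `|f y|].
  apply: filterI; first exact: open_nbhs_nbhs.
  have cn : {for x, continuous (fun y => `|f y|)}.
    apply: continuous_comp; last exact: norm_continuous.
    by apply: cf; exact/mem_set.
  by apply: cvgr_gt cn _ Mf.
move=> /nbhs_ballP[r /= r0 xr].
have : (lebesgue_rV n (ball x r) <= lebesgue_rV n N)%E.
  apply: le_measure; rewrite ?inE//; first exact: measurable_ball_rV.
  move=> y /xr[Oy My]; apply: subN => /= /(_ Oy).
  by rewrite leNgt My.
by rewrite [X in (_ <= X)%E]N0 lebesgue_ball// lee_fin leNgt exprn_gt0// mulr_gt0.
Qed.

End measure_rV.

(** * Partial derivatives and functions of class C^1 *)
Section mean_value.
Context {R : realType}.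

Lemma MVT_ball (f df : R -> R) (m r a b : R) :
  (forall c, `|c - m| < r -> is_derive c (1 : R) f (df c)) ->
  `|a - m| < r -> `|b - m| < r ->
  exists2 c, `|c - m| < r & f b - f a = df c * (b - a).
Proof.
move=> Hf; wlog ab : a b / a < b.
  move=> H am bm; have [ab|ba|<-] := ltgtP a b; first exact: H.
    have [c cm E] := H _ _ ba bm am; exists c => //.
    by rewrite -opprB E; ring.
  by exists a => //; rewrite !subrr mulr0.
rewrite !ltr_distl => /andP[a1 a2] /andP[b1 b2].
have In c : c \in `[a, b] -> `|c - m| < r.
  rewrite in_itv/= => /andP[ac cb]; rewrite ltr_distl.
  by rewrite (lt_le_trans a1 ac) (le_lt_trans cb b2).
have [c cab E] := @MVT _ f df _ _ ab
  (fun x xab => Hf x (In x (subset_itv_oo_cc xab)))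
  (derivable_within_continuous (fun x xab => @ex_derive _ _ _ _ _ _ _ (Hf x (In x xab)))).
by exists c => //; apply: In; exact: subset_itv_oo_cc.
Qed.

Lemma is_deriveP (f : R -> R) (a l : R) :
  is_derive a (1 : R) f l <-> (f (h + a) - f a) / h @[h --> 0^'] --> l.
Proof.
have E : (fun h : R => h^-1 *: ((f \o shift a) (h *: (1 : R)) - f a)) =
         (fun h => (f (h + a) - f a) / h).
  by apply/funext => h /=; rewrite scaler1 /GRing.scale/= mulrC.
split=> [[d <-]|H].
  by move: d; rewrite /derivable /derive E => /cvg_ex[m Hm]; rewrite (cvg_lim _ Hm).
have dv : derivable f a (1 : R) by apply/cvg_ex; exists l; rewrite E.
by apply: DeriveDef => //; rewrite /derive E; exact: cvg_lim.
Qed.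

Lemma is_derive_epsP (f : R -> R) (a l : R) :
  is_derive a (1 : R) f l <->
  (forall e, 0 < e -> exists2 r, 0 < r & forall s, 0 < `|s - a| < r ->
    `|(f s - f a) / (s - a) - l| <= e).
Proof.
rewrite is_deriveP; split=> [/cvgrPdistC_le H e /H|H].
  move=> /nbhs_ballP[r /= r0 Hr]; exists r => // s /andP[s0 sr].
  have := Hr (s - a); rewrite /= subrK; apply.
    by rewrite /ball/= sub0r normrN.
  by rewrite -normr_gt0.
apply/cvgrPdistC_le => e /H[r r0 Hr]; apply/nbhs_ballP; exists r => //= h.
rewrite /ball/= sub0r normrN => hr h0.
by have := Hr (h + a); rewrite addrK; apply; rewrite normr_gt0 h0.
Qed.

(** The mixed difference quotient is a value of the mixed derivative [Gsh] by
    two applications of the mean value theorem; letting the second increment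
    tend to zero first gives the derivative of [Gh]. *)
Lemma schwarz (G Gs Gsh : R -> R -> R) (Gh : R -> R) (s0 h0 r : R) : 0 < r ->
  (forall s h, `|s - s0| < r -> `|h - h0| < r ->
    is_derive s (1 : R) (G^~ h) (Gs s h) /\
    is_derive h (1 : R) (Gs s) (Gsh s h)) ->
  (forall s, `|s - s0| < r -> is_derive h0 (1 : R) (G s) (Gh s)) ->
  (forall e, 0 < e -> exists2 d, 0 < d & forall s h, `|s - s0| < d ->
    `|h - h0| < d -> `|Gsh s h - Gsh s0 h0| <= e) ->
  is_derive s0 (1 : R) Gh (Gsh s0 h0).
Proof.
move=> r0 H1 H2 H3; apply/is_derive_epsP => e /H3[d0 d00 Hd].
exists (Num.min r d0); first by rewrite lt_min r0.
move=> s; rewrite lt_min => /and3P[ss0 sr sd].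
have m0 : 0 < Num.min r d0 by rewrite lt_min r0.
have sn : s - s0 != 0 by rewrite -normr_gt0.
pose Q (h : R) := ((G s (h + h0) - G s h0) / h - (G s0 (h + h0) - G s0 h0) / h) / (s - s0).
have cQ : Q h - Gsh s0 h0 @[h --> 0^'] --> (Gh s - Gh s0) / (s - s0) - Gsh s0 h0.
  apply: cvgB; last exact: cvg_cst.
  apply: cvgM; last exact: cvg_cst.
  apply: cvgB; first exact/is_deriveP/H2.
  by apply/is_deriveP/H2; rewrite subrr normr0.
have cQn : `|Q h - Gsh s0 h0| @[h --> 0^'] -->
  `|(Gh s - Gh s0) / (s - s0) - Gsh s0 h0| by apply: cvg_norm.
rewrite -[leLHS](cvg_lim (@norm_hausdorff _ _) cQn).
apply: (@limr_le _ _ _ _ e (fun h => `|Q h - Gsh s0 h0|) (cvgP _ cQn)).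
apply/nbhs_ballP; exists (Num.min r d0) => //= h.
rewrite /ball/= sub0r normrN => hm hn.
have hr : `|h + h0 - h0| < r by move: hm; rewrite addrK lt_min => /andP[].
have hd : `|h + h0 - h0| < d0 by move: hm; rewrite addrK lt_min => /andP[].
have z1 : `|s0 - s0| < Num.min r d0 by rewrite subrr normr0.
have z2 : `|h0 - h0| < Num.min r d0 by rewrite subrr normr0.
have z0 : `|h0 - h0| < r by rewrite subrr normr0.
have HD c : `|c - s0| < Num.min r d0 -> is_derive c (1 : R)
    (fun s => G s (h + h0) - G s h0) (Gs c (h + h0) - Gs c h0).
  rewrite lt_min => /andP[cr _].
  exact: is_deriveB (H1 _ _ cr hr).1 (H1 _ _ cr z0).1.
have hs : `|s - s0| < Num.min r d0 by rewrite lt_min sr.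
have [c cm E] := MVT_ball HD z1 hs.
have HG k : `|k - h0| < Num.min r d0 -> is_derive k (1 : R) (Gs c) (Gsh c k).
  rewrite lt_min => /andP[kr _]; move: cm; rewrite lt_min => /andP[cr _].
  exact: (H1 c k cr kr).2.
have hh : `|h + h0 - h0| < Num.min r d0 by rewrite lt_min hr.
have [k km E'] := MVT_ball HG z2 hh.
have -> : Q h = Gsh c k.
  rewrite /Q -mulrBl.
  rewrite (_ : _ - _ - _ = G s (h + h0) - G s h0 - (G s0 (h + h0) - G s0 h0)); last by ring.
  by rewrite E E' addrK; field; rewrite hn sn.
by move: cm km; rewrite !lt_min => /andP[_ ?] /andP[_ ?]; exact: Hd.
Qed.

End mean_value.

#[export] Instance nbhs_rV_filter (R : realType) n (x : 'rV[R]_n) :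
  ProperFilter (nbhs x).
Proof. exact: nbhs_pfilter. Qed.

Section partial_derivatives.
Context {R : realType} {n : nat}.
Implicit Types (f g : 'rV[R]_n -> R) (x y : 'rV[R]_n) (i j : 'I_n).

Definition ei i : 'rV[R]_n := delta_mx ord0 i.

Lemma eiE i j : ei i ord0 j = (j == i)%:R.
Proof. by rewrite mxE eqxx. Qed.

Definition is_pder i f x (l : R) := is_derive x (ei i) f l.

Lemma is_pder_val i f x l : is_pder i f x l -> pderiv i f x = l.
Proof. by move=> H; rewrite /pderiv; case: H. Qed.

Lemma is_pder_ex i f x l : is_pder i f x l -> pderivable i f x.
Proof. by case. Qed.

Lemma pderivableP i f x : pderivable i f x -> is_pder i f x (pderiv i f x).
Proof. by move=> H; apply: DeriveDef. Qed.

Lemma is_pder_line i f x (h l : R) :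
  is_pder i f (x + h *: ei i) l <->
  is_derive h (1 : R) (fun k => f (x + k *: ei i)) l.
Proof.
have E : (fun k : R => k^-1 *: ((f \o shift (x + h *: ei i)) (k *: ei i) - f (x + h *: ei i))) =
         (fun k : R => k^-1 *: (((fun k => f (x + k *: ei i)) \o shift h) (k *: (1 : R)) -
            f (x + h *: ei i))).
  apply/funext => k /=; congr (_ *: (f _ - _)).
  by rewrite scaler1 scalerDl addrCA.
split=> -[]; rewrite /derivable /derive.
  by rewrite E => d v; apply: DeriveDef.
by rewrite -E => d v; apply: DeriveDef.
Qed.

Lemma is_pder0 i f x l :
  is_pder i f x l <-> is_derive (0 : R) (1 : R) (fun k => f (x + k *: ei i)) l.
Proof. by rewrite -is_pder_line scale0r addr0. Qed.

Lemma is_pder_near i f g x l : (\near x, f x = g x) -> is_pder i f x l ->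
  is_pder i g x l.
Proof. exact: near_eq_is_derive. Qed.

Lemma near_pderiv i f g x : (\near x, f x = g x) -> pderiv i f x = pderiv i g x.
Proof. exact: near_eq_derive. Qed.

Lemma is_pder_cst i (c : R) x : is_pder i (fun=> c) x 0.
Proof. exact: is_derive_cst. Qed.

Lemma is_pderD i f g x a b : is_pder i f x a -> is_pder i g x b ->
  is_pder i (fun y => f y + g y) x (a + b).
Proof. by move=> Hf Hg; apply: is_deriveD. Qed.

Lemma is_pderB i f g x a b : is_pder i f x a -> is_pder i g x b ->
  is_pder i (fun y => f y - g y) x (a - b).
Proof. by move=> Hf Hg; apply: is_deriveB. Qed.

Lemma is_pderM i f g x a b : is_pder i f x a -> is_pder i g x b ->
  is_pder i (fun y => f y * g y) x (a * g x + f x * b).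
Proof.
move=> Hf Hg; have := is_deriveM Hf Hg.
by rewrite /GRing.scale/= addrC (mulrC (g x)).
Qed.

Lemma is_pderZ i (c : R) f x a : is_pder i f x a ->
  is_pder i (fun y => c * f y) x (c * a).
Proof. by move=> Hf; have := is_pderM (is_pder_cst i c x) Hf; rewrite mul0r add0r. Qed.

Lemma is_pderN i f x a : is_pder i f x a -> is_pder i (fun y => - f y) x (- a).
Proof.
by move=> /(is_pderZ (-1)); rewrite mulN1r; under eq_fun do rewrite mulN1r.
Qed.

Lemma is_pder_sum (T : Type) (r : seq T) (P : pred T) i
    (f : T -> 'rV[R]_n -> R) x (a : T -> R) :
  (forall t, is_pder i (f t) x (a t)) ->
  is_pder i (fun y => \sum_(t <- r | P t) f t y) x (\sum_(t <- r | P t) a t).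
Proof.
move=> H; elim: r => [|t r IH].
  by under eq_fun do rewrite big_nil; rewrite big_nil; exact: is_pder_cst.
rewrite big_cons; under eq_fun do rewrite big_cons.
by case: (P t) => //; exact: is_pderD.
Qed.

Lemma is_pder_comp i (g : R -> R) f x (a b : R) : is_derive (f x) (1 : R) g a ->
  is_pder i f x b -> is_pder i (fun y => g (f y)) x (a * b).
Proof.
move=> Hg /is_pder0 Hf; apply/is_pder0.
by apply: is_derive1_comp Hf => /=; rewrite scale0r addr0.
Qed.

Lemma is_pder_coord i j x : is_pder i (fun y => y ord0 j) x (i == j)%:R.
Proof.
apply/is_pder0.
have -> : (fun k : R => (x + k *: ei i) ord0 j) = (fun k : R => x ord0 j + (i == j)%:R * k).
  by apply/funext => k; rewrite !mxE eqxx eq_sym mulrC.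
have := is_deriveD (is_derive_cst (x ord0 j : R) (0 : R) (1 : R))
  (is_deriveZ ((i == j)%:R : R) (is_derive_id (0 : R) (1 : R))).
by rewrite add0r /GRing.scale/= mulr1.
Qed.

(** On an open set this amounts to [C1_on], whose subspace limits it replaces by
    plain limits, point by point. *)
Definition c1 (O : set 'rV[R]_n) f :=
  forall x, O x -> f y @[y --> x] --> f x /\
    forall i, pderivable i f x /\ pderiv i f y @[y --> x] --> pderiv i f x.

Lemma c1P (O : set 'rV[R]_n) f : open O -> C1_on O f <-> c1 O f.
Proof.
move=> oO; rewrite /C1_on /c1; rewrite continuous_open_subspace//; split.
  move=> [cf H] x Ox; split; first exact/cf/mem_set.
  move=> i; have [H1] := H i; rewrite continuous_open_subspace// => H2.
  by split; [exact: H1|exact/H2/mem_set].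
move=> H; split; first by move=> x /set_mem/H[].
move=> i; split; first by move=> x /H[_ /(_ i)[]].
by rewrite continuous_open_subspace// => x /set_mem/H[_ /(_ i)[]].
Qed.

Lemma c1_sub (O O' : set 'rV[R]_n) f : O `<=` O' -> c1 O' f -> c1 O f.
Proof. by move=> OO' H x /OO'; exact: H. Qed.

Lemma c1_cont O f x : c1 O f -> O x -> f y @[y --> x] --> f x.
Proof. by move=> H /H[]. Qed.

Lemma c1_pder O f i x : c1 O f -> O x -> is_pder i f x (pderiv i f x).
Proof. by move=> H /H[_ /(_ i)[/pderivableP]]. Qed.

Arguments c1_pder {O f i x}.

Lemma c1_pderiv_cont O f i x : c1 O f -> O x ->
  pderiv i f y @[y --> x] --> pderiv i f x.
Proof. by move=> H /H[_ /(_ i)[]]. Qed.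

Arguments c1_pderiv_cont {O f i x}.

Lemma cvg_near_eq f g x : (\near x, f x = g x) -> f y @[y --> x] --> f x ->
  g y @[y --> x] --> g x.
Proof.
move=> fg; have <- := nbhs_singleton fg; exact: cvg_trans (near_eq_cvg fg).
Qed.

Lemma c1_intro O f (df : 'I_n -> 'rV[R]_n -> R) : open O ->
  (forall x, O x -> f y @[y --> x] --> f x) ->
  (forall i x, O x -> is_pder i f x (df i x)) ->
  (forall i x, O x -> df i y @[y --> x] --> df i x) -> c1 O f.
Proof.
move=> oO cf pf cdf x Ox; split; first exact: cf.
move=> i; split; first exact: is_pder_ex (pf i x Ox).
have nE : \forall y \near x, df i y = pderiv i f y.
  by apply: filterS (open_nbhs_nbhs (conj oO Ox)) => y Oy; rewrite (is_pder_val (pf i y Oy)).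
exact: cvg_near_eq nE (cdf i x Ox).
Qed.

Lemma c1_near O f g : open O -> (forall x, O x -> f x = g x) -> c1 O f -> c1 O g.
Proof.
move=> oO fg H; have fgn x : O x -> \near x, f x = g x.
  by move=> Ox; apply: filterS (open_nbhs_nbhs (conj oO Ox)) => y; exact: fg.
apply: (c1_intro (df := fun i => pderiv i f)) => //.
- by move=> x Ox; apply: cvg_near_eq (fgn x Ox) (c1_cont H Ox).
- by move=> i x Ox; apply: is_pder_near (fgn x Ox) _; exact: c1_pder H Ox.
- by move=> i x Ox; exact: c1_pderiv_cont H Ox.
Qed.

Lemma c1_cst O (c : R) : open O -> c1 O (fun=> c).
Proof.
move=> oO; apply: (c1_intro (df := fun _ => fun=> 0)) => //.
- by move=> x _; exact: cvg_cst.
- by move=> i x _; exact: is_pder_cst.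
- by move=> i x _; exact: cvg_cst.
Qed.

Lemma c1D O f g : open O -> c1 O f -> c1 O g -> c1 O (fun x => f x + g x).
Proof.
move=> oO Hf Hg.
apply: (c1_intro (df := fun i x => pderiv i f x + pderiv i g x)) => //.
- by move=> x Ox; apply: cvgD; [exact: c1_cont Hf Ox|exact: c1_cont Hg Ox].
- by move=> i x Ox; apply: is_pderD; [exact: c1_pder Hf Ox|exact: c1_pder Hg Ox].
- move=> i x Ox; apply: cvgD; [exact: c1_pderiv_cont Hf Ox|exact: c1_pderiv_cont Hg Ox].
Qed.

Lemma c1M O f g : open O -> c1 O f -> c1 O g -> c1 O (fun x => f x * g x).
Proof.
move=> oO Hf Hg.
apply: (c1_intro (df := fun i x => pderiv i f x * g x + f x * pderiv i g x)) => //.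
- by move=> x Ox; apply: cvgM; [exact: c1_cont Hf Ox|exact: c1_cont Hg Ox].
- by move=> i x Ox; apply: is_pderM; [exact: c1_pder Hf Ox|exact: c1_pder Hg Ox].
- move=> i x Ox; have [? ? ? ?] := And4 (c1_pderiv_cont (i := i) Hf Ox)
    (c1_pderiv_cont (i := i) Hg Ox) (c1_cont Hf Ox) (c1_cont Hg Ox).
  by apply: cvgD; apply: cvgM.
Qed.

Lemma c1Z O (c : R) f : open O -> c1 O f -> c1 O (fun x => c * f x).
Proof. by move=> oO; apply: c1M => //; exact: c1_cst. Qed.

Lemma c1N O f : open O -> c1 O f -> c1 O (fun x => - f x).
Proof.
by move=> oO /(c1Z (-1) oO); apply: c1_near => // x _; rewrite mulN1r.
Qed.

Lemma c1B O f g : open O -> c1 O f -> c1 O g -> c1 O (fun x => f x - g x).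
Proof. by move=> oO Hf /(c1N oO); exact: c1D. Qed.

Lemma c1_sum O (T : Type) (r : seq T) (P : pred T) (f : T -> 'rV[R]_n -> R) :
  open O -> (forall t, c1 O (f t)) -> c1 O (fun x => \sum_(t <- r | P t) f t x).
Proof.
move=> oO H; elim: r => [|t r IH].
  by under eq_fun do rewrite big_nil; exact: c1_cst.
under eq_fun do rewrite big_cons.
by case: (P t) => //; exact: c1D.
Qed.

Lemma c1_prod O (T : Type) (r : seq T) (P : pred T) (f : T -> 'rV[R]_n -> R) :
  open O -> (forall t, c1 O (f t)) -> c1 O (fun x => \prod_(t <- r | P t) f t x).
Proof.
move=> oO H; elim: r => [|t r IH].
  by under eq_fun do rewrite big_nil; exact: c1_cst.
under eq_fun do rewrite big_cons.
by case: (P t) => //; exact: c1M.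
Qed.

Lemma c1_coord O j : open O -> c1 O (fun x => x ord0 j).
Proof.
move=> oO; apply: (c1_intro (df := fun i => fun=> (i == j)%:R)) => //.
- by move=> x _; exact: coord_continuous.
- by move=> i x _; exact: is_pder_coord.
- by move=> i x _; exact: cvg_cst.
Qed.

Lemma c1_comp O (g dg : R -> R) f : open O ->
  (forall s, is_derive s (1 : R) g (dg s)) -> continuous g -> continuous dg ->
  c1 O f -> c1 O (fun x => g (f x)).
Proof.
move=> oO Hg cg cdg Hf.
apply: (c1_intro (df := fun i x => dg (f x) * pderiv i f x)) => //.
- by move=> x Ox; apply: continuous_comp; [exact: c1_cont Hf Ox|exact: cg].
- by move=> i x Ox; exact: (@is_pder_comp i g f x _ _ (Hg (f x)) (c1_pder Hf Ox)).
- move=> i x Ox; apply: cvgM; last exact: c1_pderiv_cont Hf Ox.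
  apply: (@continuous_comp _ _ _ f dg); [exact: c1_cont Hf Ox|exact: cdg].
Qed.

Lemma nbhs_linei i x (h : R) (P : set 'rV[R]_n) : nbhs (x + h *: ei i) P ->
  exists2 r, 0 < r & forall k, `|k - h| < r -> P (x + k *: ei i).
Proof.
move=> /nbhs_ballP[r /= r0 Hr]; exists r => // k kr; apply: Hr.
apply/ball_rVP; split=> // j; rewrite !mxE.
rewrite (_ : _ - _ = (h - k) * ((ord0 == ord0 :> 'I_1) && (j == i))%:R); last by ring.
rewrite normrM; case: (_ && _); rewrite ?normr1 ?mulr1 ?normr0 ?mulr0//.
by rewrite distrC.
Qed.

Lemma nbhs_plane i j x (P : set 'rV[R]_n) : nbhs x P ->
  exists2 r, 0 < r & forall k l, `|k| < r -> `|l| < r ->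
   P (x + k *: ei i + l *: ei j).
Proof.
move=> /nbhs_ballP[r /= r0 Hr]; exists (r / 2); first by rewrite divr_gt0.
move=> k l kr lr; apply: Hr; apply/ball_rVP; split=> // m; rewrite !mxE.
rewrite opprD addrA opprD addrA subrr sub0r.
apply: le_lt_trans (ler_normB _ _) _; rewrite normrN (splitr r) ltrD// normrM.
  apply: le_lt_trans kr; case: (_ && _); by rewrite ?normr1 ?mulr1 ?normr0 ?mulr0.
apply: le_lt_trans lr; case: (_ && _); by rewrite ?normr1 ?mulr1 ?normr0 ?mulr0.
Qed.

(** Schwarz's theorem, applied in the plane through [x] spanned by the two
    coordinate directions. *)
Lemma pderiv_sym O f i j x : open O -> c1 O f -> (forall k, c1 O (pderiv k f)) ->
  O x -> pderiv i (pderiv j f) x = pderiv j (pderiv i f) x.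
Proof.
move=> oO Hf Hdf Ox; apply: is_pder_val; apply/is_pder0.
have [r r0 Hr] := nbhs_plane i j (open_nbhs_nbhs (conj oO Ox)).
have S := @schwarz R (fun s h => f (x + s *: ei i + h *: ei j))
  (fun s h => pderiv i f (x + s *: ei i + h *: ei j))
  (fun s h => pderiv j (pderiv i f) (x + s *: ei i + h *: ei j))
  (fun s => pderiv j f (x + s *: ei i)) 0 0 r r0.
have -> : pderiv j (pderiv i f) x =
  pderiv j (pderiv i f) (x + 0 *: ei i + 0 *: ei j) by rewrite !scale0r !addr0.
apply: S.
- move=> s h; rewrite !subr0 => sr hr; split.
    have -> : (fun y : R => f (x + y *: ei i + h *: ei j)) =
              (fun y : R => f ((x + h *: ei j) + y *: ei i)).
      by apply/funext => y; rewrite addrAC.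
    rewrite (addrAC x); apply/is_pder_line; apply: c1_pder Hf _.
    by rewrite addrAC; exact: Hr.
  by apply/is_pder_line; apply: c1_pder (Hdf i) _; exact: Hr.
- move=> s; rewrite subr0 => sr; apply/is_pder0; apply: c1_pder Hf _.
  by have := Hr s 0 sr; rewrite scale0r addr0 normr0; exact.
- move=> e e0; have /cvgrPdistC_le/(_ _ e0)/(nbhs_plane i j)[d d0 Hd] :=
    c1_pderiv_cont (i := j) (Hdf i) Ox.
  exists d => // s h; rewrite !subr0 => sd hd.
  by rewrite !scale0r !addr0; exact: Hd.
Qed.

End partial_derivatives.

Section smooth_step.
Context {R : realType}.

(** The positive part is squared to be of class C^1. *)
Definition ppos2 (s : R) : R := Num.max s 0 ^+ 2.

Lemma ppos2_ge0 s : 0 <= ppos2 s. Proof. exact: sqr_ge0. Qed.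

Lemma is_derive_ppos2 (s : R) : is_derive s (1 : R) ppos2 (2 * Num.max s 0).
Proof.
apply/is_derive_epsP => e e0; have [s0|s0|->] := ltgtP s 0.
- exists (- s); first by rewrite oppr_gt0.
  move=> t /andP[_]; rewrite ltr_distl => /andP[_]; rewrite subrr => t0.
  by rewrite /ppos2 !max_r ?(ltW s0) ?(ltW t0)// subrr mul0r mulr0 subr0 normr0 ltW.
- exists (Num.min s e); first by rewrite lt_min s0.
  move=> t /andP[ts]; rewrite lt_min => /andP[tss tse].
  have t0 : 0 < t by move: tss; rewrite ltr_distl subrr => /andP[].
  rewrite /ppos2 !max_l ?ltW//.
  rewrite (_ : _ - _ = t - s) ?ltW//; field.
  by rewrite -normr_gt0.
- exists e => // t; rewrite subr0 => /andP[t0 te].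
  rewrite /ppos2 maxxx mulr0 expr0n/= !subr0 normrM normfV normrX.
  rewrite ler_pdivrMr// expr2 ler_pM//; last first.
    by rewrite /Num.max; case: ifP => _ //; rewrite normr0.
  by apply: le_trans (ltW te); rewrite /Num.max; case: ifP => _ //; rewrite normr0.
Qed.

(** A C^1 step from [0] to [1] over the unit interval. Gluing two parabolas
    keeps the derivative explicit and bounded by 4. *)
Definition step (s : R) : R := 1 - ppos2 (1 - ppos2 s).
Definition dstep (s : R) : R := 4 * Num.max s 0 * Num.max (1 - ppos2 s) 0.

Lemma is_derive_step s : is_derive s (1 : R) step (dstep s).
Proof.
rewrite /step.
have H1 : is_derive s (1 : R) (fun s => 1 - ppos2 s) (0 - 2 * Num.max s 0).
  exact: (is_deriveB (is_derive_cst (1 : R) s (1 : R)) (is_derive_ppos2 s)).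
have H2 := is_derive1_comp (is_derive_ppos2 _) H1.
have := is_deriveB (is_derive_cst (1 : R) s (1 : R)) H2.
by congr is_derive; rewrite /dstep; ring.
Qed.

Lemma continuous_max0 : continuous (fun s : R => Num.max s 0).
Proof. by move=> s; apply: continuous_max; [exact: cvg_id|exact: cvg_cst]. Qed.

Lemma continuous_ppos2 : continuous ppos2.
Proof. by move=> s; apply: cvgM; exact: continuous_max0. Qed.

Lemma continuous_dstep : continuous dstep.
Proof.
move=> s; apply: cvgM.
  apply: cvgM; [exact: cvg_cst|exact: continuous_max0].
apply: (@continuous_comp _ _ _ (fun s => 1 - ppos2 s) (fun s : R => Num.max s 0)).
  apply: cvgB; [exact: cvg_cst|exact: continuous_ppos2].
exact: continuous_max0.
Qed.

Lemma continuous_step : continuous step.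
Proof.
move=> s; apply: cvgB; first exact: cvg_cst.
apply: (@continuous_comp _ _ _ (fun s => 1 - ppos2 s) ppos2).
  apply: cvgB; [exact: cvg_cst|exact: continuous_ppos2].
exact: continuous_ppos2.
Qed.

Lemma step_le0 s : s <= 0 -> step s = 0.
Proof.
move=> s0; rewrite /step /ppos2 (max_r s0) expr0n subr0 max_l ?ler01//.
by rewrite expr1n subrr.
Qed.

Lemma step_ge1 s : 1 <= s -> step s = 1.
Proof.
move=> s1; rewrite /step /ppos2 (@max_l _ _ s); last by rewrite (le_trans ler01).
by rewrite max_r ?expr0n ?subr0// subr_le0 exprn_ege1.
Qed.

Lemma step_01 s : 0 <= step s <= 1.
Proof.
rewrite /step gerBl ppos2_ge0 andbT subr_ge0 /ppos2 expr_le1//.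
  by rewrite ge_max ler01 andbT gerBl sqr_ge0.
by rewrite le_max lexx orbT.
Qed.

Lemma dstep_eq0 s : ~~ (0 < s < 1) -> dstep s = 0.
Proof.
rewrite negb_and -!leNgt => /orP[s0|s1].
  by rewrite /dstep (max_r s0) mulr0 mul0r.
rewrite /dstep [X in _ * X]max_r ?mulr0// subr_le0 /ppos2 max_l ?exprn_ege1//.
exact: le_trans ler01 s1.
Qed.

Lemma dstep_le s : `|dstep s| <= 4.
Proof.
have [/andP[s0 s1]|/dstep_eq0->] := boolP (0 < s < 1); last by rewrite normr0.
rewrite /dstep ger0_norm; last by rewrite !mulr_ge0// le_max lexx orbT.
rewrite -[leRHS]mulr1 ler_pM//.
- by rewrite mulr_ge0// le_max lexx orbT.
- by rewrite le_max lexx orbT.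
- by rewrite -[leRHS]mulr1 ler_wpM2l// ge_max ler01 ltW.
- by rewrite ge_max ler01 gerBl ppos2_ge0.
Qed.

End smooth_step.

(** * Integration by parts against test functions *)
Section bounded_support.
Context d (S : measurableType d) (R : realType) (mu : {measure set S -> \bar R}).

Lemma L1_bounded_support (f : S -> R) (A : set S) (M : R) : measurable A ->
  (mu A < +oo)%E -> measurable_fun setT f -> (forall x, A x -> `|f x| <= M) ->
  (forall x, ~ A x -> f x = 0) -> L1 mu setT f.
Proof.
move=> mA fA mf fM f0; have : L1 mu A f.
  apply: measurable_bounded_integrable => //; first exact: measurable_funS mf.
  exists M; split; first exact: num_real.
  by move=> y My x Ax; apply: le_trans (fM x Ax) (ltW My).
move=> /(integrable_mkcond _ mA); apply: eq_integrable => // x _.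
rewrite /patch; case: ifPn => //= /negP xA.
by rewrite f0// => Ax; apply: xA; exact/mem_set.
Qed.

End bounded_support.

Section compact_support.
Context {R : realType}.

Lemma ball0_rV n (x : 'rV[R]_n) r : ball (0 : 'rV[R]_n) r x <-> `|x| < r.
Proof. by rewrite -ball_normE /ball_/= sub0r normrN. Qed.

Lemma compact_cball n (r : R) : compact [set x : 'rV[R]_n | `|x| <= r].
Proof.
apply: bounded_closed_compact.
  exists r; split; first exact: num_real.
  by move=> y ry x /= /le_trans; apply; exact: ltW.
apply: (@closed_comp _ _ (fun x : 'rV[R]_n => `|x|) [set y | y <= r]).
  by move=> x _; exact: norm_continuous.
exact: closed_le.
Qed.

Lemma compact_sub_ball n (K : set 'rV[R]_n) : compact K ->
  exists2 r : R, 0 < r & K `<=` ball 0 r.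
Proof.
move=> /compact_bounded[M [_ HM]]; exists (`|M| + 2).
  by rewrite ltr_wpDl.
move=> x Kx; apply/ball0_rV; apply: (@le_lt_trans _ _ (`|M| + 1)).
  by apply: (HM (`|M| + 1)) => //; rewrite ltr_pwDr// ler_norm.
by rewrite ltrD2l ltr1n.
Qed.

Lemma compact_lty n (K : set 'rV[R]_n) : compact K -> (lebesgue_rV n K < +oo)%E.
Proof.
move=> cK; have [r r0 Kr] := compact_sub_ball cK.
apply: (@le_lt_trans _ _ (lebesgue_rV n (ball 0 r))).
  by apply: le_measure; rewrite ?inE//; [exact: compact_measurable_rV|exact: measurable_ball_rV].
by rewrite lebesgue_ball// ltry.
Qed.

Lemma continuous_compact_bounded n (K : set 'rV[R]_n) (f : 'rV[R]_n -> R) :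
  compact K -> (forall x, K x -> f y @[y --> x] --> f x) ->
  exists M : R, forall x, K x -> `|f x| <= M.
Proof.
move=> cK cf; have [->|/set0P K0] := eqVneq K set0; first by exists 0.
have [] := @EVT_max_rV R n (fun x => `|f x|) K K0 cK.
  apply: continuous_in_subspaceT => x /set_mem Kx.
  by apply: cvg_norm; exact: cf.
by move=> c _ H; exists `|f c| => x Kx; apply: H; exact/mem_set.
Qed.

Lemma continuous_compact_L1 n (K : set 'rV[R]_n) (f : 'rV[R]_n -> R) :
  compact K -> (forall x, f y @[y --> x] --> f x) ->
  (forall x, ~ K x -> f x = 0) -> L1 (lebesgue_rV n) setT f.
Proof.
move=> cK cf f0; have [M fM] := continuous_compact_bounded cK (fun x _ => cf x).
apply: (L1_bounded_support (compact_measurable_rV cK) (compact_lty cK) _ fM f0).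
apply: continuous_measurable_rV; first exact: openT.
by apply: continuous_subspaceT => x; exact: cf.
Qed.

Lemma consrV_line0 n (x : R) (v : 'rV[R]_n) :
  consrV (x, v) = consrV (0, v) + x *: ei ord0.
Proof.
apply/rowP => k; rewrite [RHS]mxE [X in _ = _ + X]mxE eiE.
case: (unliftP ord0 k) => [j|] ->.
  by rewrite !consrVS /= mulr0 addr0.
by rewrite !consrV0/= mulr1 add0r.
Qed.

Lemma consrV_lineS n (x h : R) (v : 'rV[R]_n) (j : 'I_n) :
  consrV (x, v + h *: ei j) = consrV (x, v) + h *: ei (lift ord0 j).
Proof.
apply/rowP => k; rewrite [RHS]mxE [X in _ = _ + X]mxE eiE.
case: (unliftP ord0 k) => [l|] ->; last by rewrite !consrV0/= mulr0 addr0.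
by rewrite !consrVS/= !mxE eqxx (inj_eq lift_inj).
Qed.

Lemma continuous_consrV n (x : R) : continuous (fun v : 'rV[R]_n => consrV (x, v)).
Proof.
move=> v; apply/cvgrPdist_lt => e e0.
apply: filterS (nbhsx_ballx v e e0) => w /ball_rVP[_ H].
suff : ball (consrV (x, v)) e (consrV (x, w)) by rewrite -ball_normE.
apply/ball_rVP; split=> // k; case: (unliftP ord0 k) => [l|] ->.
  by rewrite !consrVS; exact: H.
by rewrite !consrV0/= subrr normr0.
Qed.

Lemma continuous_consrVl n (v : 'rV[R]_n) : continuous (fun x : R => consrV (x, v)).
Proof.
move=> x; apply/cvgrPdist_lt => e e0; apply/nbhs_ballP; exists e => //= y xy.
suff : ball (consrV (x, v)) e (consrV (y, v)) by rewrite -ball_normE.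
apply/ball_rVP; split=> // k; case: (unliftP ord0 k) => [l|] ->.
  by rewrite !consrVS/= subrr normr0.
by rewrite !consrV0/=.
Qed.

Lemma slice_supported n (f : 'rV[R]_n.+1 -> R) (r : R) :
  (forall y, r <= `|y| -> f y = 0) ->
  forall (x : R) (v : 'rV[R]_n), r <= `|x| \/ r <= `|v| -> f (consrV (x, v)) = 0.
Proof.
move=> f0 x v H; apply: f0; case: H => H; apply: (le_trans H).
  by have := coord_le (consrV (x, v)) ord0; rewrite consrV0.
apply: ler_coord => // j; have := coord_le (consrV (x, v)) (lift ord0 j).
by rewrite consrVS.
Qed.

Lemma integral_derive_line (h dh : R -> R) (r : R) : 0 < r ->
  (forall x, is_derive x (1 : R) h (dh x)) -> (forall x, dh y @[y --> x] --> dh x) ->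
  (forall x, r <= `|x| -> h x = 0) ->
  (\int[@lebesgue_measure R]_x (dh x)%:E = 0)%E.
Proof.
move=> r0 Dh cdh h0; have ab : - (r + 1) < r + 1 by lra.
have ch x : h y @[y --> x] --> h x.
  apply: differentiable_continuous; apply/derivable1_diffP; exact: (@ex_derive _ _ _ _ _ _ _ (Dh x)).
have dh0 x : x \in ~` `[- (r + 1), r + 1]%classic -> dh x = 0.
  rewrite inE /= in_itv/= -ler_norml => /negP; rewrite -ltNge => rx.
  have [_ <-] := Dh x.
  have : \forall y \near x, cst (0 : R) y = h y.
    have : `|y| @[y --> x] --> `|x| by exact: norm_continuous.
    move=> /cvgr_gt-/(_ r); have rx' : r < `|x| by lra.
    move=> /(_ rx'); apply: filterS => y ry; by rewrite h0 ?ltW.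
  move=> /near_eq_derive-/(_ 1) <-; exact: derive_cst.
have := @continuous_FTC2 R dh h _ _ ab.
have h1 : h (r + 1) = 0 by apply: h0; rewrite ger0_norm; lra.
have h2 : h (- (r + 1)) = 0 by apply: h0; rewrite normrN ger0_norm; lra.
rewrite h1 h2 subee// => H; rewrite -[RHS]H.
- rewrite [RHS]integral_mkcond; apply: eq_integral => x _.
  by rewrite /patch; case: ifPn => // xn; rewrite dh0// in_setC.
- by apply: continuous_subspaceT => x; exact: cdh.
- split; first by move=> x _; have [] := Dh x.
  + by apply: cvg_at_right_filter; exact: ch.
  + by apply: cvg_at_left_filter; exact: ch.
- by move=> x _; rewrite derive1E; have [] := Dh x.
Qed.

(** One coordinate at a time: the inner integral along [e_i] vanishes by the
    fundamental theorem of calculus. *)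
Lemma integral_pderiv0 n (i : 'I_n) (f : 'rV[R]_n -> R) (r : R) : 0 < r ->
  (forall x, is_pder i f x (pderiv i f x)) ->
  (forall x, pderiv i f y @[y --> x] --> pderiv i f x) ->
  (forall x, r <= `|x| -> f x = 0) ->
  (\int[lebesgue_rV n]_x (pderiv i f x)%:E = 0)%E.
Proof.
move=> r0; elim: n i f => [|n IH] i f Df cdf f0; first by have := ltn_ord i.
have df0 x : ~ [set x : 'rV[R]_n.+1 | `|x| <= r] x -> pderiv i f x = 0.
  move=> /= /negP; rewrite -ltNge => rx.
  have : \forall y \near x, (fun=> (0 : R)) y = f y.
    have /cvgr_gt-/(_ r rx) : `|y| @[y --> x] --> `|x| by exact: norm_continuous.
    by apply: filterS => y ry; rewrite f0 ?ltW.
  move=> /(near_pderiv i) <-; exact: is_pder_val (is_pder_cst _ _ _).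
have Ldf := continuous_compact_L1 (@compact_cball n.+1 r) cdf df0.
have mg : measurable_fun setT (EFin \o pderiv i f).
  by apply/measurable_EFinP; exact: (L1_measurable Ldf).
have [M0 HM0] := continuous_compact_bounded (@compact_cball n.+1 r) (fun x _ => cdf x).
have HM x : `|pderiv i f x| <= `|M0|.
  have [xr|xr] := pselect ([set x : 'rV[R]_n.+1 | `|x| <= r] x).
    exact: le_trans (HM0 x xr) (ler_norm _).
  by rewrite df0// normr0.
set m := (@lebesgue_measure R \x lebesgue_rV n)%E.
have Lc : m.-integrable setT ((EFin \o pderiv i f) \o @consrV R n).
  apply: (@L1_bounded_support _ _ _ m (pderiv i f \o @consrV R n)
    (ball 0 (r + 1) `*` ball 0 (r + 1)) `|M0|).
  - by apply: measurableX; [exact: measurable_ball|exact: measurable_ball_rV].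
  - have r1 : 0 < r + 1 by lra.
    have E := @product_measure1E _ _ _ _ R (@lebesgue_measure R) (lebesgue_rV n)
      _ _ (measurable_ball (0 : R) (r + 1)) (measurable_ball_rV (0 : 'rV[R]_n) (r + 1)).
    have Hlt : (@lebesgue_measure R (ball (0%R : R) (r + 1)%R) *
        lebesgue_rV n (ball (0%R : 'rV[R]_n) (r + 1)%R) < +oo)%E.
      rewrite [X in (_ * X)%E](lebesgue_ball _ r1).
      by rewrite [X in (X * _)%E](lebesgue_measure_ball _ (ltW r1)) -EFinM ltry.
    by rewrite -E in Hlt.
  - apply: measurableT_comp; first exact: (L1_measurable Ldf).
    exact: measurable_consrV.
  - by move=> x _; exact: HM.
  - move=> [x v] H; apply: df0 => /= H'; apply: H.
    have xr : `|x| <= r.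
      by have := coord_le (consrV (x, v)) ord0; rewrite consrV0 => /le_trans; apply.
    have vr : `|v| <= r.
      apply: ler_coord; first exact: ltW.
      move=> j; have := coord_le (consrV (x, v)) (lift ord0 j).
      by rewrite consrVS => /le_trans; apply.
    split=> /=; last by apply/ball0_rV; lra.
    by rewrite /ball/= sub0r normrN; lra.
have -> : (\int[lebesgue_rV n.+1]_x (pderiv i f x)%:E =
    \int[m]_p (pderiv i f (consrV p))%:E)%E.
  refine (@integral_pushforward _ _ _ _ _ _ _ _ setT _ mg Lc measurableT).
  exact: measurable_consrV.
case: (unliftP ord0 i) => [j|] ij.
  rewrite -(integral12_prod_meas1 Lc) -[RHS](integral0 (@lebesgue_measure R) setT).
  apply: eq_integral => x _; rewrite /fubini_F /=.
  have D v : is_pder j (fun v => f (consrV (x, v))) v (pderiv i f (consrV (x, v))).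
    apply/is_pder0; have /is_pder0 := Df (consrV (x, v)); rewrite ij.
    by under [X in _ -> is_derive _ _ X _]eq_fun do rewrite consrV_lineS.
  rewrite -[RHS](IH j (fun v => f (consrV (x, v)))).
  - by apply: eq_integral => v _; rewrite (is_pder_val (D v)).
  - by move=> v; rewrite (is_pder_val (D v)); exact: D.
  - have E : pderiv j (fun v => f (consrV (x, v))) = (fun v => pderiv i f (consrV (x, v))).
      by apply/funext => v; exact: is_pder_val (D v).
    move=> v; rewrite E.
    apply: (@continuous_comp _ _ _ (fun v => consrV (x, v)) (pderiv i f)).
      exact: continuous_consrV.
    exact: cdf.
  - by move=> v rv; apply: (slice_supported f0); right.
rewrite -(integral21_prod_meas1 Lc) -[RHS](integral0 (lebesgue_rV n) setT).
apply: eq_integral => v _; rewrite /fubini_G /=.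
apply: (@integral_derive_line (fun x => f (consrV (x, v)))
  (fun x => pderiv i f (consrV (x, v))) r) => //.
- move=> x; have := Df (consrV (x, v)); rewrite ij {1}consrV_line0.
  move=> /is_pder_line.
  have -> : (fun x : R => f (consrV (x, v))) =
      (fun k : R => f (consrV (0, v) + k *: ei ord0)).
    by apply/funext => y; rewrite -consrV_line0.
  by [].
- move=> x; apply: (@continuous_comp _ _ _ (fun x => consrV (x, v)) (pderiv i f)).
    exact: continuous_consrVl.
  exact: cdf.
- by move=> x rx; apply: (slice_supported f0); left.
Qed.

Definition csupp n (Om : set 'rV[R]_n) (f : 'rV[R]_n -> R) :=
  exists K, [/\ compact K, K `<=` Om & forall x, ~ K x -> f x = 0].

Lemma off_compact_near0 n (K : set 'rV[R]_n) (f : 'rV[R]_n -> R) x : compact K ->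
  (forall x, ~ K x -> f x = 0) -> ~ K x -> \forall y \near x, 0 = f y.
Proof.
move=> cK f0 nKx; have oK : open (~` K) by apply: closed_openC; exact: compact_closed_rV.
by apply: filterS (open_nbhs_nbhs (conj oK nKx)) => y nKy; rewrite f0.
Qed.

Lemma csupp_cont n (Om : set 'rV[R]_n) (f : 'rV[R]_n -> R) :
  (forall x, Om x -> f y @[y --> x] --> f x) -> csupp Om f ->
  forall x, f y @[y --> x] --> f x.
Proof.
move=> cf [K [cK KO f0]] x.
have [Ox|nOx] := pselect (Om x); first exact: cf.
have nKx : ~ K x by move=> /KO.
by apply: cvg_near_eq (off_compact_near0 cK f0 nKx) (cvg_cst _).
Qed.

Lemma csupp_L1 n (Om : set 'rV[R]_n) (f : 'rV[R]_n -> R) : open Om ->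
  (forall x, Om x -> f y @[y --> x] --> f x) -> csupp Om f ->
  L1 (lebesgue_rV n) Om f.
Proof.
move=> oO cf sf; have [K [cK KO f0]] := sf.
apply: integrableS (continuous_compact_L1 cK (csupp_cont cf sf) f0) => //.
exact: open_measurable_rV.
Qed.

Lemma csupp_pderiv n (Om : set 'rV[R]_n) f i : csupp Om f -> csupp Om (pderiv i f).
Proof.
move=> [K [cK KO f0]]; exists K; split=> // x nKx.
rewrite -(near_pderiv i (off_compact_near0 cK f0 nKx)).
exact: is_pder_val (is_pder_cst _ _ _).
Qed.

Lemma csuppMl n (Om : set 'rV[R]_n) f g : csupp Om f -> csupp Om (fun x => f x * g x).
Proof.
by move=> [K [cK KO f0]]; exists K; split=> // x nKx; rewrite f0// mul0r.
Qed.

Lemma test_c1 n (Om : set 'rV[R]_n) chi : test_function Om chi -> c1 setT chi.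
Proof. by move=> [/(c1P _ (openT)) ]. Qed.

Lemma test_csupp n (Om : set 'rV[R]_n) chi : test_function Om chi -> csupp Om chi.
Proof. by case. Qed.

Lemma test_intro n (Om : set 'rV[R]_n) chi : c1 setT chi -> csupp Om chi ->
  test_function Om chi.
Proof. by move=> H ?; split=> //; apply/c1P => //; exact: openT. Qed.

Lemma testM n (Om : set 'rV[R]_n) chi F : open Om -> test_function Om chi ->
  c1 Om F -> test_function Om (fun x => chi x * F x).
Proof.
move=> oO tchi cF; have /csuppMl-/(_ F) supp := test_csupp tchi.
apply: test_intro => //; have [K [cK KO h0]] := supp => x _.
have [Ox|nOx] := pselect (Om x).
  exact: (c1M oO (c1_sub (@subsetT _ Om) (test_c1 tchi)) cF Ox).
have nKx : ~ K x by move=> /KO.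
have oK : open (~` K) by apply: closed_openC; exact: compact_closed_rV.
exact: (c1_near oK (fun y nKy => esym (h0 y nKy)) (c1_cst 0 oK) nKx).
Qed.

Lemma integral_test_pderiv n (Om : set 'rV[R]_n) chi i : open Om ->
  test_function Om chi -> Rintegral (lebesgue_rV n) Om (pderiv i chi) = 0.
Proof.
move=> oO tchi; have cchi := test_c1 tchi.
have [K [cK KO h0]] := csupp_pderiv i (test_csupp tchi).
have [K' [cK' KO' chi0]] := test_csupp tchi.
have [r r0 Kr] := compact_sub_ball cK'.
rewrite /Rintegral integral_mkcond (_ : (_ \_ _) = EFin \o pderiv i chi); last first.
  apply/funext => x; rewrite /patch; case: ifPn => //= /negP xO.
  by rewrite h0// => /KO Ox; apply: xO; exact/mem_set.
rewrite (@integral_pderiv0 n i chi r r0)//.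
- by move=> x; exact: c1_pder cchi _.
- by move=> x; exact: c1_pderiv_cont cchi _.
- by move=> x rx; apply: chi0 => /Kr /ball0_rV; rewrite ltNge rx.
Qed.

Lemma test_L1 n (Om : set 'rV[R]_n) chi (g : 'rV[R]_n -> R) : open Om -> test_function Om chi ->
  (forall x, Om x -> g y @[y --> x] --> g x) ->
  L1 (lebesgue_rV n) Om (fun x => chi x * g x).
Proof.
move=> oO tchi cg; apply: csupp_L1 => //; last exact/csuppMl/test_csupp.
by move=> x Ox; apply: cvgM; [exact: c1_cont (test_c1 tchi) _|exact: cg].
Qed.

Lemma dtest_L1 n (Om : set 'rV[R]_n) chi (g : 'rV[R]_n -> R) i : open Om -> test_function Om chi ->
  (forall x, Om x -> g y @[y --> x] --> g x) ->
  L1 (lebesgue_rV n) Om (fun x => pderiv i chi x * g x).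
Proof.
move=> oO tchi cg; apply: csupp_L1 => //; last exact/csuppMl/csupp_pderiv/test_csupp.
by move=> x Ox; apply: cvgM; [exact: c1_pderiv_cont (test_c1 tchi) _|exact: cg].
Qed.

(** [chi F] is again a test function even though [F] is only of class C^1 in the
    open set, whence no boundary term. *)
Lemma test_by_parts n (Om : set 'rV[R]_n) chi F i : open Om ->
  test_function Om chi -> c1 Om F ->
  Rintegral (lebesgue_rV n) Om (fun x => chi x * pderiv i F x) =
  - Rintegral (lebesgue_rV n) Om (fun x => pderiv i chi x * F x).
Proof.
move=> oO tchi cF; have mO := open_measurable_rV oO.
have La := dtest_L1 i oO tchi (fun x Ox => c1_cont cF Ox).
have Lb := test_L1 oO tchi (fun x Ox => c1_pderiv_cont (i := i) cF Ox).
apply/eqP; rewrite -addr_eq0 addrC -(I_D mO La Lb).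
rewrite -[X in _ == X](integral_test_pderiv i oO (testM oO tchi cF)).
apply/eqP/I_eq => x Ox; apply/esym/is_pder_val.
apply: is_pderM; first exact: c1_pder (test_c1 tchi) _.
exact: c1_pder cF Ox.
Qed.

End compact_support.

Section fundamental_lemma.
Context {R : realType} {n : nat}.
Local Notation mu := (lebesgue_rV n).
Implicit Types (Om : set 'rV[R]_n).

Definition box_step (lo hi : 'rV[R]_n) (k : nat) (x : 'rV[R]_n) : R :=
  \prod_i (step (k%:R * (x ord0 i - lo ord0 i)) * step (k%:R * (hi ord0 i - x ord0 i))).

Lemma box_step_c1 lo hi k : c1 setT (box_step lo hi k).
Proof.
apply: c1_prod => [|i]; first exact: openT.
have cs (f : 'rV[R]_n -> R) : c1 setT f -> c1 setT (fun x => step (f x)).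
  move=> cf; apply: (c1_comp (dg := dstep)) cf; first exact: openT.
  - exact: is_derive_step.
  - exact: continuous_step.
  - exact: continuous_dstep.
by apply: c1M; first exact: openT; apply: cs; apply: c1Z; try exact: openT;
  apply: c1B; try exact: openT; try (exact: (c1_cst _ openT)); exact: (c1_coord _ openT).
Qed.

Lemma box_step_01 lo hi k x : 0 <= box_step lo hi k x <= 1.
Proof.
rewrite /box_step; elim/big_ind: _ => [|a b /andP[a0 a1] /andP[b0 b1]|i _].
- by rewrite ler01 lexx.
- by rewrite mulr_ge0// mulr_ile1.
- have /andP[a0 a1] := step_01 (k%:R * (x ord0 i - lo ord0 i)).
  have /andP[b0 b1] := step_01 (k%:R * (hi ord0 i - x ord0 i)).
  by rewrite mulr_ge0// mulr_ile1.
Qed.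

Lemma box_step_out (lo hi : 'rV[R]_n) k (x : 'rV[R]_n) : ~ (forall i, lo ord0 i < x ord0 i < hi ord0 i) ->
  box_step lo hi k x = 0.
Proof.
move=> /existsNP[i /negP]; rewrite negb_and -!leNgt => H.
rewrite /box_step (bigD1 i)//=; case/orP: H => H.
  by rewrite step_le0 ?mul0r// mulr_ge0_le0// subr_le0.
by rewrite [X in _ * X * _]step_le0 ?mulr0 ?mul0r// mulr_ge0_le0// subr_le0.
Qed.

Lemma cvg_step_infty (a : R) : 0 < a -> step (k%:R * a) @[k --> \oo] --> (1 : R).
Proof.
move=> a0; apply: cvg_near_cst; near=> k; rewrite step_ge1//.
rewrite -ler_pdivrMr// div1r ltW//.
by near: k; apply: nbhs_infty_gtr.
Unshelve. all: by end_near. Qed.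

Lemma cvg_prod1 (T : Type) (r : seq T) (F : T -> nat -> R) :
  (forall i, F i k @[k --> \oo] --> (1 : R)) ->
  \prod_(i <- r) F i k @[k --> \oo] --> (1 : R).
Proof.
move=> H; elim: r => [|i r IH].
  by under eq_fun do rewrite big_nil; exact: cvg_cst.
under eq_fun do rewrite big_cons.
by have X := cvgM (H i) IH; rewrite mulr1 in X; exact: X.
Qed.

Lemma box_step_in (lo hi x : 'rV[R]_n) : (forall i, lo ord0 i < x ord0 i < hi ord0 i) ->
  box_step lo hi k x @[k --> \oo] --> (1 : R).
Proof.
move=> H; apply: cvg_prod1 => i; rewrite -[X in _ --> X]mulr1.
have /andP[a b] := H i.
by apply: cvgM; apply: cvg_step_infty; rewrite subr_gt0.
Qed.

(** The indicator of an open box is the pointwise limit of the test functions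
    [box_step], so dominated convergence passes to it. *)
Lemma integral_box0 Om (h : 'rV[R]_n -> R) (K Q : set 'rV[R]_n) : open Om ->
  compact K -> K `<=` Om -> L1 mu K h -> Q `<=` K -> open_boxes Q ->
  (forall psi, test_function Om psi -> Rintegral mu Om (fun x => h x * psi x) = 0) ->
  (\int[mu]_(x in Q) (h x)%:E = 0)%E.
Proof.
move=> oO cK KO Lh QK bQ H; have mQ := measurable_open_boxes bQ.
have [lo [hi Qdef]] := bQ; have mK := compact_measurable_rV cK.
have tpsi k : test_function Om (box_step lo hi k).
  apply: test_intro; first exact: box_step_c1.
  exists K; split=> // x nKx; apply: box_step_out => xQ; apply: nKx.
  by apply: QK; rewrite Qdef.
have mpsi k : measurable_fun K (box_step lo hi k).
  apply: (@measurable_funS _ _ _ _ setT) => //.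
  apply: continuous_measurable_rV; first exact: openT.
  by apply: continuous_subspaceT => x; exact: c1_cont (@box_step_c1 lo hi k) _.
have mh := L1_measurable Lh.
have [||||LQ] := @I_dominated _ _ _ mu K mK (fun k x => h x * box_step lo hi k x)
  (fun x => h x * \1_Q x) (fun x => `|h x|).
- by move=> k; exact: measurable_funM.
- move=> x _; apply: cvgM; first exact: cvg_cst.
  have [Qx|nQx] := pselect (Q x).
    by rewrite indicE mem_set//; apply: box_step_in; move: Qx; rewrite Qdef.
  rewrite indicE memNset//; apply: cvg_near_cst; apply: nearW => k.
  by rewrite box_step_out//; move: nQx; rewrite Qdef.
- move=> k x _; rewrite normrM -[leRHS]mulr1 ler_wpM2l//.
  by have /andP[? ?] := box_step_01 lo hi k x; rewrite ger0_norm.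
- exact: L1_norm.
have E k : Rintegral mu K (fun x => h x * box_step lo hi k x) = 0.
  rewrite -[RHS](H _ (tpsi k)) [LHS]Rintegral_mkcond [RHS]Rintegral_mkcond.
  congr Rintegral; apply/funext => x; rewrite /patch.
  have [xK|xK] := boolP (x \in K); first by rewrite (mem_set (KO _ (set_mem xK))).
  rewrite (@box_step_out lo hi k x) ?mulr0 ?if_same// => xQ.
  by move/negP: xK; apply; apply/mem_set/QK; rewrite Qdef.
rewrite (_ : (fun k => _) = fun=> 0); last by apply/funext => k; exact: E.
move=> /(cvg_lim (@Rhausdorff R)); rewrite lim_cst// => /esym IQ.
have -> : (\int[mu]_(x in Q) (h x)%:E = \int[mu]_(x in K) (h x * \1_Q x)%:E)%E.
  rewrite -[X in (\int[mu]_(x in X) _)%E](setIidr QK) integral_mkcondr; apply: eq_integral => x _.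
  by rewrite /patch indicE; case: (x \in Q); rewrite /= ?mulr1n ?mulr1 ?mulr0n ?mulr0.
by rewrite -I_EFin// IQ.
Qed.

(** The fundamental lemma of the calculus of variations: the integrals over
    boxes vanish, hence those over all measurable sets by Dynkin's theorem. *)
Lemma ae0_of_test Om (h : 'rV[R]_n -> R) : open Om -> measurable_fun Om h ->
  (forall K, compact K -> K `<=` Om -> L1 mu K h) ->
  (forall psi, test_function Om psi -> Rintegral mu Om (fun x => h x * psi x) = 0) ->
  {ae mu, forall x, Om x -> h x = 0}.
Proof.
move=> oO mh Lh H.
(* Dynkin's theorem needs the integrability of [h] on the whole space: it is
   applied inside closed balls contained in [Om]. *)
have loc (c : 'rV[R]_n) (r : R) : 0 < r -> closed_ball c r `<=` Om ->
    {ae mu, forall x, ball c r x -> h x = 0}.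
  move=> r0 cO; have cK : compact (closed_ball c r).
    apply: bounded_closed_compact; last exact: closed_ball_closed.
    rewrite closed_ballE//; exists (`|c| + r); split; first exact: num_real.
    move=> M HM x; rewrite /closed_ball_/= => xc; apply: le_trans (ltW HM).
    by rewrite -[x](subKr c) (le_trans (ler_normB _ _))// lerD2l.
  have BK : ball c r `<=` closed_ball c r by exact: subset_closed_ball.
  have mB := measurable_ball_rV c r.
  have LK := Lh _ cK cO.
  have LB : L1 mu (ball c r) h.
    by apply: integrableS LK => //; exact: compact_measurable_rV.
  have bB : open_boxes (ball c r).
    exists (\row_i (c ord0 i - r)), (\row_i (c ord0 i + r)).
    apply/seteqP; split=> y.
      by move=> /ball_rVP[_ Hy] i; rewrite !mxE -ltr_distlC.
    move=> Hy; apply/ball_rVP; split=> // i; have := Hy i.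
    by rewrite !mxE -ltr_distlC.
  have P E : measurable E -> (\int[mu]_(x in ball c r `&` E) (h x)%:E = 0)%E.
    rewrite measurable_rVE; apply: (dynkin_induction (G := @open_boxes R n)
      (P := fun E => (\int[mu]_(x in ball c r `&` E) (h x)%:E = 0)%E)).
    - exact: measurable_rVE.
    - exact: open_boxes_setI.
    - by rewrite setIT; exact: (integral_box0 oO cK cO LK BK bB H).
    - move=> Q bQ; apply: (integral_box0 oO cK cO LK _ _ H).
        by move=> x [/BK].
      exact: open_boxes_setI.
    - move=> Q mQ Q0.
      have := integral_box0 oO cK cO LK BK bB H.
      rewrite -[X in (\int[mu]_(x in X) _)%E](setIT (ball c r)) -(setUv Q) setIUr.
      rewrite integral_setU_EFin ?Q0 ?add0e//.
      + exact: measurableI.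
      + by apply: measurableI => //; exact: measurableC.
      + rewrite -setIUr setUv setIT; exact: (L1_measurable LB).
      + by apply/disj_setPS => x [[_ ?] [_ ?]].
    - move=> F mF tF F0; rewrite setI_bigcupr integral_bigcup//.
      + by rewrite eseries0.
      + exact: trivIset_setIl.
      + by move=> k; exact: measurableI.
      + apply: integrableS LB => //.
          by apply: bigcupT_measurable => k; exact: measurableI.
        by move=> x [k _ []].
  have := @integral_ae_eq _ _ _ mu (ball c r) mB (cst 0%E) (EFin \o h) LB.
  move=> /(_ (measurable_cst _)) X; have {}X := X _.
  have : ae_eq mu (ball c r) (EFin \o h) (cst 0%E).
    apply: X => E EB mE; rewrite integral0 -[X in (\int[mu]_(x in X) _)%E](setIidr EB).
    exact: P.
  by apply: filterS => x Hx Bx; case: (Hx Bx).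
(* Countably many balls, with rational centres and radii [1 / k], cover [Om]
   and lie in it together with their closures. *)
pose P (q : 'rV[rat]_n * nat) (x : 'rV[R]_n) :=
  let c : 'rV[R]_n := \row_i ratr (q.1 ord0 i) in
  closed_ball c (q.2.+1%:R^-1 : R) `<=` Om -> ball c (q.2.+1%:R^-1 : R) x -> h x = 0.
have Pae (m : nat) : {ae mu, forall x, if choice.unpickle m is Some q then P q x else True}.
  case: (choice.unpickle m) => [q|]; last exact: aeW.
  have [cO|ncO] := pselect (closed_ball (\row_i ratr (q.1 ord0 i) : 'rV[R]_n)
      (q.2.+1%:R^-1 : R) `<=` Om).
    have k0 : 0 < (q.2.+1%:R^-1 : R) by rewrite invr_gt0.
    by apply: filterS (loc _ _ k0 cO) => x Hx; rewrite /P /= => _; exact: Hx.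
  by apply: aeW => x; rewrite /P /= => cO; case: ncO.
have := ae_foralln Pae; apply: filterS => x Hx Ox.
have /nbhs_ballP[e /= e0 xeO] : nbhs x Om by exact: open_nbhs_nbhs.
have [k ke] : exists k : nat, (k.+1%:R^-1 : R) < e / 3.
  have e3 : 0 < e / 3 by rewrite divr_gt0.
  by have [k _ /(_ k (leqnn k))] := near_infty_natSinv_lt (PosNum e3); exists k.
have k0 : 0 < (k.+1%:R^-1 : R) by rewrite invr_gt0.
have q i : {q : rat | ratr q \in `]x ord0 i - k.+1%:R^-1, x ord0 i + k.+1%:R^-1[}.
  apply/cid; apply: rat_in_itvoo.
  by apply: (@lt_trans _ _ (x ord0 i)); rewrite ?gtrBl ?ltrDl.
pose qq : 'rV[rat]_n * nat := (\row_i sval (q i), k).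
have := Hx (choice.pickle qq); rewrite choice.pickleK /P /=.
set c : 'rV[R]_n := \row_i _.
have cx : ball c (k.+1%:R^-1 : R) x.
  apply/ball_rVP; split=> // i; rewrite /c !mxE.
  by have := svalP (q i); rewrite in_itv/= -ltr_distlC distrC.
apply=> //; rewrite closed_ballE// => y; rewrite /closed_ball_/= => yc.
apply: xeO; rewrite -ball_normE /ball_/=.
rewrite (_ : x - y = (x - c) + (c - y)); last by rewrite addrA subrK.
apply: le_lt_trans (ler_normD _ _) _; move: cx; rewrite -ball_normE /ball_/= distrC.
move: yc ke k0; move: (k.+1%:R^-1 : R) => kk; lra.
Qed.

End fundamental_lemma.

(** * Exhausting test functions *)
Section cutoffs.
Context {R : realType} {n : nat}.
Local Notation mu := (lebesgue_rV n).
Local Notation V := 'rV[R]_n.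
Variable (Om : set V).
Hypothesis oO : open Om.
Let mO : measurable Om := open_measurable_rV oO.
Implicit Types (F : 'I_n -> V -> R) (g : V -> R).

(** The normal direction is given by the gradient of any defining function, and
    the limit is taken from inside, so [F] needs no values on the boundary. *)
Definition no_flux F := forall p g, boundary Om p ->
  local_defining_function Om p g ->
  (\sum_i F i x * pderiv i g x) @[x --> within Om (nbhs p)] --> (0 : R).

(** Functions that become asymptotically invisible to the integrable fields
    without boundary flux. The absolute value inside the integral makes the
    notion stable under products ([cutoffM]), so that cutoffs built in local
    charts and at infinity can be multiplied. *)
Definition cutoff (f : nat -> V -> R) :=
  [/\ forall k, c1 setT (f k), forall k x, 0 <= f k x <= 1,
      forall k i, exists M : R, forall x, `|pderiv i (f k) x| <= M,
      forall x, Om x -> f k x @[k --> \oo] --> (1 : R) &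
      forall F, no_flux F -> (forall i, L1 mu Om (F i)) ->
        Rintegral mu Om (fun x => `|\sum_i F i x * pderiv i (f k) x|)
          @[k --> \oo] --> (0 : R)].

Lemma continuous_measurable_on (h : V -> R) :
  (forall x, h y @[y --> x] --> h x) -> measurable_fun Om h.
Proof.
move=> ch; apply: (@measurable_funS _ _ _ _ setT) => //.
apply: continuous_measurable_rV; first exact: openT.
by apply: continuous_subspaceT => x; exact: ch.
Qed.

Lemma cvg_sumr (T : Type) (G : set_system T) (FG : Filter G) (J : Type)
    (r : seq J) (f : J -> T -> R) (l : J -> R) :
  (forall i, f i t @[t --> G] --> l i) ->
  \sum_(i <- r) f i t @[t --> G] --> \sum_(i <- r) l i.
Proof.
move=> H; elim: r => [|i r IH].
  by under eq_fun do rewrite big_nil; rewrite big_nil; exact: cvg_cst.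
rewrite big_cons; under eq_fun do rewrite big_cons.
exact: (cvgD (H i) IH).
Qed.

Lemma squeeze0 (u v : nat -> R) : (forall k, 0 <= u k <= v k) ->
  v k @[k --> \oo] --> (0 : R) -> u k @[k --> \oo] --> (0 : R).
Proof.
move=> uv /cvgrPdist_le v0; apply/cvgrPdist_le => e /v0.
apply: filterS => k; rewrite !sub0r !normrN; apply: le_trans.
by have /andP[? ?] := uv k; rewrite !ger0_norm// (le_trans _ (_ : u k <= v k)).
Qed.

Lemma cutoff_L1 F (f : V -> R) : c1 setT f ->
  (forall i, exists M : R, forall x, `|pderiv i f x| <= M) ->
  (forall i, L1 mu Om (F i)) -> L1 mu Om (fun x => \sum_i F i x * pderiv i f x).
Proof.
move=> cf bf LF; apply: L1_sum => // i; have [M fM] := bf i.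
apply: (@L1_eq _ _ _ _ _ mO (fun x => pderiv i f x * F i x)).
  by move=> x _; rewrite mulrC.
apply: (L1_bddM mO _ (fun x _ => fM x) (LF i)).
by apply: continuous_measurable_on => x; exact: c1_pderiv_cont cf _.
Qed.

Lemma cutoff1 : cutoff (fun _ => fun=> 1).
Proof.
have d0 i x : pderiv i (fun=> (1 : R)) x = 0 :> R := is_pder_val (@is_pder_cst R n i 1 x).
split=> //.
- by move=> k; exact: (c1_cst 1 openT).
- by move=> k x; rewrite ler01 lexx.
- by move=> k i; exists 0 => x; rewrite d0 normr0.
- by move=> x _; exact: cvg_cst.
- move=> F _ _; rewrite (_ : (fun k => _) = fun=> (0 : R)); first exact: cvg_cst.
  apply/funext => k; rewrite -[RHS](I_0 mu Om); apply: I_eq => x _.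
  by rewrite big1 ?normr0// => i _; rewrite d0 mulr0.
Qed.

(** In the Leibniz rule each gradient is multiplied by a factor bounded by 1. *)
Lemma cutoffM (f g : nat -> V -> R) : cutoff f -> cutoff g -> cutoff (fun k x => f k x * g k x).
Proof.
move=> [cf f01 bf f1 If] [cg g01 bg g1 Ig].
have dM k i x : pderiv i (fun x => f k x * g k x) x =
    pderiv i (f k) x * g k x + f k x * pderiv i (g k) x.
  by apply: is_pder_val; apply: is_pderM; [exact: c1_pder (cf k) _|exact: c1_pder (cg k) _].
have fn k x : `|f k x| <= 1 by have /andP[? ?] := f01 k x; rewrite ger0_norm.
have gn k x : `|g k x| <= 1 by have /andP[? ?] := g01 k x; rewrite ger0_norm.
have cfg k : c1 setT (fun x => f k x * g k x) by apply: c1M => //; exact: openT.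
have bfg k i : exists M : R, forall x, `|pderiv i (fun x => f k x * g k x) x| <= M.
  have [M fM] := bf k i; have [M' gM] := bg k i; exists (M + M') => x.
  rewrite dM (le_trans (ler_normD _ _))// lerD// normrM.
    by rewrite -[leRHS]mulr1 ler_pM.
  by rewrite -[leRHS]mul1r ler_pM.
split; [exact: cfg| |exact: bfg| |].
- move=> k x; have /andP[? ?] := f01 k x; have /andP[? ?] := g01 k x.
  by rewrite mulr_ge0// mulr_ile1.
- move=> x Ox; rewrite -[X in _ --> X]mulr1; apply: cvgM; [exact: f1|exact: g1].
- move=> F nF LF.
  have H0 := cvgD (If F nF LF) (Ig F nF LF); rewrite addr0 in H0.
  have Lf k := cutoff_L1 (cf k) (bf k) LF; have Lg k := cutoff_L1 (cg k) (bg k) LF.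
  apply: (@squeeze0 _ (fun k =>
    Rintegral mu Om (fun x => `|\sum_i F i x * pderiv i (f k) x|) +
    Rintegral mu Om (fun x => `|\sum_i F i x * pderiv i (g k) x|))); last exact: H0.
  move=> k; rewrite I_ge0//=.
  rewrite -(I_D mO (L1_norm (Lf k)) (L1_norm (Lg k))).
  apply: I_le => //.
  + exact/L1_norm/cutoff_L1.
  + by apply: L1D => //; exact: L1_norm.
  + move=> x _; have -> : \sum_i F i x * pderiv i (fun x => f k x * g k x) x =
        g k x * (\sum_i F i x * pderiv i (f k) x) + f k x * \sum_i F i x * pderiv i (g k) x.
      rewrite !mulr_sumr -big_split /=; apply: eq_bigr => i _.
      by rewrite dM; ring.
    apply: le_trans (ler_normD _ _) _; rewrite !normrM lerD//.
      by rewrite -[leRHS]mul1r ler_wpM2r.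
    by rewrite -[leRHS]mul1r ler_wpM2r.
Qed.

Lemma cutoff_prod (T : Type) (r : seq T) (f : T -> nat -> V -> R) :
  (forall t, cutoff (f t)) -> cutoff (fun k x => \prod_(t <- r) f t k x).
Proof.
move=> H; elim: r => [|t r IH].
  rewrite (_ : (fun k x => _) = (fun _ => fun=> 1)); first exact: cutoff1.
  by apply/funext => k; apply/funext => x; rewrite big_nil.
rewrite (_ : (fun k x => _) = (fun k x => f t k x * \prod_(j <- r) f j k x)).
  exact: (cutoffM (H t) IH).
by apply/funext => k; apply/funext => x; rewrite big_cons.
Qed.

(** Squaring the coordinate avoids the singularity of its absolute value: the
    function is 1 where the coordinate is within [r] of the centre and 0 beyond
    [2 r]. *)
Definition sbump (c : V) (r : R) (j : 'I_n) (x : V) : R :=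
  step (2 - ((x ord0 j - c ord0 j) / r) ^+ 2).

Lemma sbump_pder c r j i x : is_pder i (sbump c r j) x
  (dstep (2 - ((x ord0 j - c ord0 j) / r) ^+ 2) *
   (0 - ((i == j)%:R / r * ((x ord0 j - c ord0 j) / r) +
         (x ord0 j - c ord0 j) / r * ((i == j)%:R / r)))).
Proof.
apply: (is_pder_comp (g := step) (is_derive_step _)).
apply: is_pderB; first exact: is_pder_cst.
have H : is_pder i (fun x : V => (x ord0 j - c ord0 j) / r) x ((i == j)%:R / r).
  have := is_pderZ (r^-1) (is_pderB (is_pder_coord i j x) (is_pder_cst i (c ord0 j) x)).
  by rewrite subr0 mulrC; under eq_fun do rewrite mulrC.
exact: (is_pderM H H).
Qed.

Lemma sbump_c1 c r j : c1 setT (sbump c r j).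
Proof.
apply: (c1_comp openT is_derive_step continuous_step continuous_dstep).
apply: (c1B openT (c1_cst 2 openT)).
have H : c1 setT (fun x : V => (x ord0 j - c ord0 j) / r).
  apply: c1M; [exact: openT| |exact: (c1_cst _ openT)].
  apply: c1B; [exact: openT|exact: (c1_coord _ openT)|exact: (c1_cst _ openT)].
exact: (c1M openT H H).
Qed.

Lemma sbump_in (c : V) (r : R) j (x : V) : 0 < r -> `|x ord0 j - c ord0 j| <= r ->
  1 <= 2 - ((x ord0 j - c ord0 j) / r) ^+ 2.
Proof.
move=> r0 xr; rewrite lerBrDr -lerBrDl (_ : 2 - 1 = 1); last by ring.
rewrite -(@real_normK _ (_ / _)) ?num_real// exprn_ile1// normrM normfV.
by rewrite (gtr0_norm r0) ler_pdivrMr// mul1r.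
Qed.

Lemma sbump_out (c : V) (r : R) j (x : V) : 0 < r -> 2 * r <= `|x ord0 j - c ord0 j| ->
  2 - ((x ord0 j - c ord0 j) / r) ^+ 2 <= 0.
Proof.
move=> r0 xr; rewrite subr_le0 -(@real_normK _ (_ / _)) ?num_real// normrM normfV.
rewrite (gtr0_norm r0).
have : 2 <= `|x ord0 j - c ord0 j| / r by rewrite ler_pdivlMr.
move: (_ / r) => y y2; apply: le_trans (_ : 2 <= 2 ^+ 2) _; first by rewrite expr2; lra.
by rewrite lerXn2r ?nnegrE// (le_trans _ y2).
Qed.

Definition bump c r x := \prod_j sbump c r j x.

Lemma bump_c1 c r : c1 setT (bump c r).
Proof. by apply: c1_prod => [|j]; [exact: openT|exact: sbump_c1]. Qed.

Lemma bump_01 c r x : 0 <= bump c r x <= 1.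
Proof.
rewrite /bump; elim/big_ind: _ => [|a b /andP[a0 a1] /andP[b0 b1]|i _].
- by rewrite ler01 lexx.
- by rewrite mulr_ge0// mulr_ile1.
- exact: step_01.
Qed.

Lemma bump_in (c : V) (r : R) (x : V) : 0 < r -> `|x - c| <= r -> bump c r x = 1.
Proof.
move=> r0 xr; rewrite /bump big1// => j _; apply/step_ge1/sbump_in => //.
by apply: le_trans xr; have := coord_le (x - c) j; rewrite !mxE.
Qed.

Lemma bump_out (c : V) (r : R) (x : V) : 0 < r -> ~ `|x - c| <= 2 * r -> bump c r x = 0.
Proof.
move=> r0 xr; have [j jr] : exists j, 2 * r <= `|x ord0 j - c ord0 j|.
  apply: contrapT => /forallNP H; apply: xr; apply: ler_coord; first by rewrite mulr_ge0// ltW.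
  by move=> i; rewrite !mxE ltW// ltNge; exact/negP.
by rewrite /bump (bigD1 j)//= /sbump step_le0 ?mul0r//; exact: sbump_out.
Qed.

(** The gradients are bounded uniformly in [k] and vanish on larger and larger
    slabs, so integrability of the field alone makes their pairing vanish. *)
Lemma radial_cutoff j : cutoff (fun k => sbump 0 k.+1%:R j).
Proof.
(* [16 = 4 * 2 * 2]: slope of the step, derivative of the square, and size of
   the rescaled coordinate where the step is not constant. *)
have bd k i x : `|pderiv i (sbump 0 k.+1%:R j) x| <= 16.
  rewrite (is_pder_val (sbump_pder _ _ _ _ _)) mxE subr0; set K : R := k.+1%:R.
  have K1 : 1 <= K by rewrite ler1n.
  have K0 : 0 < K by lra.
  have [x2|x2] := ltP `|x ord0 j| (2 * K); last first.
    rewrite dstep_eq0 ?mul0r ?normr0//; have := @sbump_out 0 K j x K0.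
    by rewrite mxE subr0 => /(_ x2); rewrite leNgt negb_and => ->.
  rewrite normrM sub0r normrN [X in _ * `|X|](_ : _ = 2 * (i == j)%:R * (x ord0 j / K) / K); last by ring.
  have d4 := dstep_le (2 - (x ord0 j / K) ^+ 2).
  apply: (@le_trans _ _ (4 * (2 * 1 * 2 * 1))); last by lra.
  apply: ler_pM => //; rewrite !normrM; apply: ler_pM => //.
  - apply: ler_pM => //.
      by apply: ler_pM; rewrite ?normr_ge0//; [rewrite ger0_norm|case: (i == j); rewrite ?normr1 ?normr0].
    by rewrite normfV (gtr0_norm K0) ler_pdivrMr// ltW.
  - by rewrite normfV (gtr0_norm K0) invf_le1.
have near_in x : \forall k \near \oo, `|x ord0 j - 0| <= (k.+1%:R : R).
  near=> k; rewrite subr0 (@le_trans _ _ k%:R)// ?ler_nat//.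
  by near: k; exact: nbhs_infty_ger.
split.
- by move=> k; exact: sbump_c1.
- by move=> k x; exact: step_01.
- by move=> k i; exists 16 => x; exact: bd.
- move=> x _; apply: cvg_near_cst; near=> k; apply/step_ge1/sbump_in => //.
  by rewrite mxE; near: k; exact: near_in.
- move=> F _ LF; have LdF k := cutoff_L1 (sbump_c1 0 k.+1%:R j)
    (fun i => ex_intro _ 16 (bd k i)) LF.
  have [||||_] := @I_dominated _ _ _ mu Om mO
    (fun k x => `|\sum_i F i x * pderiv i (sbump 0 k.+1%:R j) x|) (fun=> 0)
    (fun x => \sum_i `|F i x| * 16).
  + move=> k; exact/L1_measurable/L1_norm/LdF.
  + move=> x _; apply: cvg_near_cst; near=> k; rewrite big1 ?normr0// => i _.
    rewrite (is_pder_val (sbump_pder _ _ _ _ _)) dstep_eq0 ?mul0r ?mulr0//.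
    rewrite negb_and -!leNgt; apply/orP; right; apply: sbump_in => //.
    by rewrite mxE; near: k; exact: near_in.
  + move=> k x _; rewrite normr_id (le_trans (ler_norm_sum _ _ _))//.
    by apply: ler_sum => i _; rewrite normrM ler_wpM2l.
  + by apply: L1_sum => // i; apply: (L1_eq mO _ (L1Z mO 16 (L1_norm (LF i)))) => x _; rewrite mulrC.
  by rewrite I_0.
Unshelve. all: by end_near. Qed.

Lemma closureE_boundary : closure Om = Om `|` boundary Om.
Proof.
rewrite /boundary (interior_id _).1//; apply/seteqP; split=> x.
  by move=> cx; have [?|?] := pselect (Om x); [left|right].
by move=> [/subset_closure|[]].
Qed.

Section chart.
Variables (p : V) (g : V -> R) (U : set V) (i0 : 'I_n) (c rho : R).
Hypotheses (oU : open U) (cg : c1 U g).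
Hypothesis (gU : forall x, U x -> (Om x <-> g x < 0) /\ (boundary Om x <-> g x = 0)).
Hypothesis (gradU : forall x, U x -> grad g x != 0).
Hypotheses (c0 : 0 < c) (rho0 : 0 < rho).
Local Notation K := [set x : V | `|x - p| <= 2 * rho].
Hypothesis KU : K `<=` U.
Hypothesis dgc : forall x, K x -> c <= `|pderiv i0 g x|.

Let cK : compact K.
Proof.
apply: bounded_closed_compact.
  exists (`|p| + 2 * rho); split; first exact: num_real.
  move=> M HM x; rewrite /= => xp; apply: le_trans (ltW HM).
  by rewrite -[x](subrK p) addrC (le_trans (ler_normD _ _))// lerD2l.
apply: (@closed_comp _ _ (fun x : V => `|x - p|) [set y | y <= 2 * rho]); last exact: closed_le.
move=> x _; apply: cvg_norm; apply: cvgB; [exact: cvg_id|exact: cvg_cst].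
Qed.

(** [eta k] climbs from 0 to 1 while [g] goes from [- 1 / (k + 1)] down to
    [- 2 / (k + 1)]; [chart_cut k] equals it near [p] and 1 far from [p]. *)
Let eta (k : nat) (x : V) : R := step (- k.+1%:R * g x - 1).
Let chart_cut (k : nat) (x : V) : R := 1 - bump p rho x * (1 - eta k x).

Let bumpK x : ~ K x -> bump p rho x = 0. Proof. exact: bump_out. Qed.

Let eta_c1 k : c1 U (eta k).
Proof.
have H := c1B oU (c1Z (- k.+1%:R) oU cg) (c1_cst 1 oU).
exact: (c1_comp oU is_derive_step continuous_step continuous_dstep H).
Qed.

Let eta_pder k i x : U x -> is_pder i (eta k) x
  (dstep (- k.+1%:R * g x - 1) * (- k.+1%:R * pderiv i g x - 0)).
Proof.
move=> Ux; apply: (is_pder_comp (g := step) (is_derive_step _)).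
by apply: is_pderB; [apply: is_pderZ; exact: c1_pder cg Ux|exact: is_pder_cst].
Qed.

Let oKC : open (~` K).
Proof. by apply: closed_openC; exact: compact_closed_rV. Qed.

Let cut_c1 k : c1 setT (chart_cut k).
Proof.
move=> x _; have [Ux|nUx] := pselect (U x).
  have H : c1 U (chart_cut k); last exact: H Ux.
  have cb : c1 U (bump p rho) := c1_sub (@subsetT _ U) (bump_c1 p rho).
  exact: (c1B oU (c1_cst 1 oU) (c1M oU cb (c1B oU (c1_cst 1 oU) (eta_c1 k)))).
have nKx : ~ K x by move=> /KU.
have H : c1 (~` K) (chart_cut k); last exact: H nKx.
apply: (c1_near oKC _ (c1_cst 1 oKC)) => y nKy.
by rewrite /chart_cut bumpK// mul0r subr0.
Qed.

Let eta_01 k x : 0 <= eta k x <= 1. Proof. exact: step_01. Qed.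

Let cut_01 k x : 0 <= chart_cut k x <= 1.
Proof.
have /andP[b0 b1] := bump_01 p rho x; have /andP[e0 e1] := eta_01 k x.
rewrite /chart_cut subr_ge0 gerBl mulr_ge0 ?subr_ge0// andbT.
by rewrite mulr_ile1 ?subr_ge0// gerBl.
Qed.

Let cut_pderiv k i x : pderiv i (chart_cut k) x =
  - (pderiv i (bump p rho) x * (1 - eta k x)) +
  bump p rho x * dstep (- k.+1%:R * g x - 1) * (- k.+1%:R * pderiv i g x).
Proof.
have [Ux|nUx] := pselect (U x).
  apply: is_pder_val.
  have := is_pderB (is_pder_cst i 1 x) (is_pderM (@c1_pder R n setT (bump p rho) i x (bump_c1 p rho) I)
    (is_pderB (is_pder_cst i 1 x) (eta_pder k i Ux))).
  by congr is_pder; ring.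
have nKx : ~ K x by move=> /KU.
have b0 := off_compact_near0 cK bumpK nKx.
rewrite -(near_pderiv i b0) (is_pder_val (is_pder_cst _ _ _)) bumpK// !mul0r oppr0 addr0.
rewrite -(@near_pderiv R n i (fun=> 1)) ?(is_pder_val (is_pder_cst _ _ _))//.
by apply: filterS b0 => y; rewrite /chart_cut => <-; rewrite mul0r subr0.
Qed.

Let strip (k : nat) : set V :=
  ball p (2 * rho) `&` [set x | U x /\ - 2 / k.+1%:R < g x < - 1 / k.+1%:R].

Let open_strip k : open (strip k).
Proof.
apply: openI; first exact: ball_open.
rewrite openE => x [Ux /andP[g1 g2]]; have cgx := c1_cont cg Ux.
apply: filterI; first exact: open_nbhs_nbhs.
by apply: filterS2 (cvgr_gt _ cgx _ g1) (cvgr_lt _ cgx _ g2) => y -> ->.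
Qed.

Let ballK : ball p (2 * rho) `<=` K.
Proof. by move=> x; rewrite -ball_normE /ball_/= distrC => /ltW. Qed.

(** Along the direction [e_i0] the derivative of [g] is at least [c] in absolute
    value, so by the mean value theorem a line meets the strip in points at
    distance at most [1 / ((k + 1) c)]. *)
Let strip_measure k : (mu (strip k) <=
  (2 * (k.+1%:R^-1 / c) * (2 * (2 * rho)) ^+ n.-1)%:E)%E.
Proof.
have k0 : 0 < (k.+1%:R : R)^-1 by rewrite invr_gt0.
apply: (@lebesgue_thin R n i0 (strip k) p (2 * rho) (k.+1%:R^-1 / c)) => //.
- exact: (open_measurable_rV (@open_strip k)).
- by rewrite mulr_gt0.
- by rewrite divr_ge0// ltW.
- by move=> x [].
move=> x y [Bx [Ux /andP[x1 x2]]] [By [Uy /andP[y1 y2]]] xy.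
have yE : y = x + (y ord0 i0 - x ord0 i0) *: ei i0.
  apply/rowP => j; rewrite !mxE eqxx /=; have [->|ji] := eqVneq j i0.
    by rewrite mulr1 addrC subrK.
  by rewrite mulr0 addr0 xy.
have lineB (h : R) : `|h - (p ord0 i0 - x ord0 i0)| < 2 * rho -> K (x + h *: ei i0).
  move=> hr; apply: ballK; apply/ball_rVP; split; first by rewrite mulr_gt0.
  move=> j; rewrite !mxE eqxx /=; have [->|ji] := eqVneq j i0.
    by rewrite mulr1 distrC (_ : _ - _ = h - (p ord0 i0 - x ord0 i0))//; ring.
  by rewrite mulr0 addr0; move/ball_rVP: Bx => [_].
pose m0 := p ord0 i0 - x ord0 i0.
have H1 h : `|h - m0| < 2 * rho ->
    is_derive h (1 : R) (fun h => g (x + h *: ei i0)) (pderiv i0 g (x + h *: ei i0)).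
  by move=> /lineB/KU Uh; apply/is_pder_line; exact: c1_pder cg Uh.
have H2 : `|0 - m0| < 2 * rho.
  by rewrite sub0r normrN; have /ball_rVP[_ /(_ i0)] := Bx.
have H3 : `|y ord0 i0 - x ord0 i0 - m0| < 2 * rho.
  rewrite (_ : _ - _ = y ord0 i0 - p ord0 i0); last by rewrite /m0; ring.
  by rewrite distrC; have /ball_rVP[_ /(_ i0)] := By.
have [h hB E] := MVT_ball H1 H2 H3.
rewrite -yE scale0r addr0 subr0 in E.
rewrite distrC ler_pdivlMr//.
apply: (@le_trans _ _ `|g y - g x|).
  by rewrite E normrM mulrC ler_wpM2r//; apply/dgc/lineB.
rewrite ler_norml; move: x1 x2 y1 y2; rewrite !mulNr !mul1r.
have -> : 2 / k.+1%:R = 2 * (k.+1%:R^-1 : R) by [].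
by move: (k.+1%:R^-1 : R) k0 => e e0 x1 x2 y1 y2; apply/andP; split; lra.
Qed.

(** By compactness the flux is small uniformly in a neighbourhood of the boundary:
    otherwise a point of the closure of the set where it is large, maximizing
    [g], would lie on the boundary and contradict [no_flux]. *)
Let flux_small F (e : R) : 0 < e -> no_flux F ->
  exists2 d : R, 0 < d & forall x, Om x -> K x -> - d < g x ->
    `|\sum_i F i x * pderiv i g x| <= e.
Proof.
move=> e0 nF; pose A := [set x | Om x /\ K x /\ e < `|\sum_i F i x * pderiv i g x|].
have AK : closure A `<=` K.
  rewrite (closure_id K).1; last exact: compact_closed_rV.
  by apply: closure_subset => x [_ []].
have cA : compact (closure A).
  by apply: subclosed_compact cK AK; exact: closed_closure.
have [A0|/set0P A0] := eqVneq (closure A) set0.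
  exists 1 => // x Ox Kx _; rewrite leNgt; apply/negP => ex.
  suff : (closure A) x by rewrite A0.
  by apply: subset_closure.
have [y /set_mem Ay ymax] := @EVT_max_rV R n g (closure A) A0 cA
  (continuous_in_subspaceT (fun x xA => c1_cont cg (KU (AK x (set_mem xA))))).
have Uy := KU (AK _ Ay); have [gO gB] := gU Uy.
have [Oy|nOy] := pselect (Om y).
  have gy := gO.1 Oy; exists (- g y); first by rewrite oppr_gt0.
  move=> x Ox Kx; rewrite opprK => gx; rewrite leNgt; apply/negP => ex.
  have := ymax x; rewrite leNgt gx => /(_ _)/negP; apply => //.
  by apply/mem_set/subset_closure.
have By : boundary Om y.
  have : closure Om y by apply: (closure_subset _ Ay) => x [].
  by rewrite closureE_boundary => -[].
have ldf : local_defining_function Om y g.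
  exists U; split; last by [].
  by split=> //; exact/(c1P _ oU).
have /cvgrPdist_lt/(_ _ e0) := nF y g By ldf.
move=> Hn0; have Hn : nbhs y (fun t => Om t -> `|0 - \sum_i F i t * pderiv i g t| < e) := Hn0.
have [x [[Ox [_ ex]] /(_ Ox)]] := Ay _ Hn.
by rewrite sub0r normrN ltNge (ltW ex).
Qed.

Let cut_bounded k i : exists M : R, forall x, `|pderiv i (chart_cut k) x| <= M.
Proof.
have [M HM] := continuous_compact_bounded cK
  (fun x (Kx : K x) => c1_pderiv_cont (i := i) (cut_c1 k) I).
exists `|M| => x; have [Kx|nKx] := pselect (K x).
  exact: le_trans (HM x Kx) (ler_norm _).
have b0 := off_compact_near0 cK bumpK nKx.
rewrite -(@near_pderiv R n i (fun=> 1)) ?(is_pder_val (is_pder_cst _ _ _)) ?normr0//.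
by apply: filterS b0 => y; rewrite /chart_cut => <-; rewrite mul0r subr0.
Qed.

Let eta_cvg x : g x < 0 -> eta k x @[k --> \oo] --> (1 : R).
Proof.
move=> gx; apply: cvg_near_cst; near=> k; apply: step_ge1.
rewrite lerBrDr mulNr -mulrN -ler_pdivrMr ?oppr_gt0//.
rewrite (@le_trans _ _ k%:R)// ?ler_nat//.
by near: k; exact: nbhs_infty_ger.
Unshelve. all: by end_near. Qed.

Let dbump_cont k i x : pderiv i (bump p rho) y * (1 - eta k y) @[y --> x] -->
  pderiv i (bump p rho) x * (1 - eta k x).
Proof.
apply: (@csupp_cont _ _ U (fun y => pderiv i (bump p rho) y * (1 - eta k y))).
  move=> y Uy; apply: cvgM; first exact: c1_pderiv_cont (bump_c1 p rho) _.
  by apply: cvgB; [exact: cvg_cst|exact: c1_cont (eta_c1 k) Uy].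
by apply: csuppMl; apply: csupp_pderiv; exists K; split.
Qed.

(** Near the boundary the gradient is of size [k] on a strip of volume
    [O(1/k)], where the normal component of [F] is small. *)
Lemma chart_cutoff_seq : cutoff chart_cut.
Proof.
split; [exact: cut_c1|exact: cut_01|exact: cut_bounded| |].
- move=> x Ox; have [Ux|nUx] := pselect (U x); last first.
    apply: cvg_near_cst; apply: nearW => k.
    by rewrite /chart_cut bumpK ?mul0r ?subr0// => /KU.
  rewrite -[X in _ --> X](_ : 1 - bump p rho x * (1 - 1) = 1); last by ring.
  apply: cvgB; first exact: cvg_cst.
  apply: cvgM; first exact: cvg_cst.
  apply: cvgB; first exact: cvg_cst.
  by apply: eta_cvg; apply/(gU Ux).1.
move=> F nF LF; apply/cvgrPdist_le => e e0.
(* Slope [4 (k + 1)] of the cutoff times the volume of the strip. *)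
pose C := 8 / c * (2 * (2 * rho)) ^+ n.-1.
have C0 : 0 <= C by rewrite mulr_ge0 ?exprn_ge0 ?divr_ge0 ?mulr_ge0// ltW.
have e1 : 0 < e / 2 / (C + 1) by rewrite !divr_gt0// ltr_wpDl.
have [d d0 Hd] := flux_small e1 nF; set e' := e / 2 / (C + 1) in e1 Hd.
(* The part of the gradient that falls on the bump tends to zero pointwise and
   is dominated; only the part that falls on [eta k] concentrates. *)
pose T1 k x := \sum_i F i x * (pderiv i (bump p rho) x * (1 - eta k x)).
have [M HM] : exists M : R, forall i x, `|pderiv i (bump p rho) x| <= M.
  have H i : exists M : R, forall x, K x -> `|pderiv i (bump p rho) x| <= M.
    by apply: continuous_compact_bounded cK _ => x _; exact: c1_pderiv_cont (bump_c1 p rho) _.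
  have /choice[m Hm] := H; exists (\sum_i `|m i|) => i x.
  have [Kx|nKx] := pselect (K x).
    apply: le_trans (Hm i x Kx) _; apply: le_trans (ler_norm _) _.
    by rewrite (bigD1 i)//= lerDl sumr_ge0.
  rewrite -(near_pderiv i (off_compact_near0 cK bumpK nKx)).
  by rewrite (is_pder_val (is_pder_cst _ _ _)) normr0 sumr_ge0.
have T1M k i x : `|pderiv i (bump p rho) x * (1 - eta k x)| <= M.
  have /andP[e00 e11] := eta_01 k x.
  rewrite normrM -[leRHS]mulr1 ler_pM// ger0_norm ?subr_ge0//.
  by rewrite gerBl.
have LT1 k : L1 mu Om (T1 k).
  apply: L1_sum => // i; apply: (@L1_eq _ _ _ _ _ mO (fun x =>
    pderiv i (bump p rho) x * (1 - eta k x) * F i x)).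
    by move=> x _; rewrite mulrC.
  apply: (L1_bddM mO _ (fun x _ => T1M k i x) (LF i)).
  by apply: continuous_measurable_on => x; exact: dbump_cont.
have [||||_ IT1] := @I_dominated _ _ _ mu Om mO (fun k x => `|T1 k x|) (fun=> 0)
    (fun x => \sum_i `|F i x| * M).
- by move=> k; exact/L1_measurable/L1_norm.
- move=> x Ox; rewrite -[X in _ --> X](@normr0 _ R); apply: cvg_norm.
  rewrite -[X in _ --> X](_ : \sum_i F i x * (pderiv i (bump p rho) x * (1 - bump p rho x)) * 0 = 0); last first.
    by rewrite big1// => i _; rewrite mulr0.
  have [Ux|nUx] := pselect (U x); last first.
    apply: cvg_near_cst; apply: nearW => k; apply: eq_bigr => i _.
    have nKx : ~ K x by move=> /KU.
    rewrite -(near_pderiv i (off_compact_near0 cK bumpK nKx)).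
    by rewrite (is_pder_val (is_pder_cst _ _ _)) !mul0r !mulr0.
  apply: cvg_sumr => i; rewrite mulr0 -[X in _ --> X](mulr0 (F i x)).
  apply: cvgM; first exact: cvg_cst.
  rewrite -[X in _ --> X](mulr0 (pderiv i (bump p rho) x)).
  apply: cvgM; first exact: cvg_cst.
  rewrite -[X in _ --> X](subrr 1); apply: cvgB; first exact: cvg_cst.
  by apply: eta_cvg; apply/(gU Ux).1.
- move=> k x _; rewrite normr_id (le_trans (ler_norm_sum _ _ _))//.
  by apply: ler_sum => i _; rewrite normrM ler_wpM2l// T1M.
- by apply: L1_sum => // i; apply: (L1_eq mO _ (L1Z mO M (L1_norm (LF i)))) => x _; rewrite mulrC.
rewrite I_0 in IT1.
have /cvgrPdist_le IT1e := IT1; have e2 : 0 < e / 2 by rewrite divr_gt0.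
near=> k; rewrite sub0r normrN ger0_norm; last by apply: I_ge0 => x _.
have kd : (2 / k.+1%:R : R) < d.
  rewrite ltr_pdivrMr// mulrC -ltr_pdivrMr// (@lt_le_trans _ _ k%:R)// ?ler_nat//.
  by near: k; exact: nbhs_infty_gtr.
have T1e : Rintegral mu Om (fun x => `|T1 k x|) <= e / 2.
  have : `|0 - Rintegral mu Om (fun x => `|T1 k x|)| <= e / 2 by near: k; exact: IT1e.
  by rewrite sub0r normrN => /(le_trans (ler_norm _)).
have mS := open_measurable_rV (@open_strip k).
have fS : (mu (strip k) < +oo)%E by apply: le_lt_trans (strip_measure k) (ltry _).
have LS : L1 mu Om (fun x => 4 * k.+1%:R * e' * \1_(strip k) x).
  apply: L1Z => //; apply: (integrableS measurableT) => //.
  apply: (@L1_bounded_support _ _ _ mu _ (strip k) 1) => //.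
  - by move=> x _; rewrite indicE; case: (_ \in _); rewrite ?normr1 ?normr0.
  - by move=> x xS; rewrite indicE memNset.
have K0 : 0 < (k.+1%:R : R) by [].
apply: (@le_trans _ _ (Rintegral mu Om (fun x => `|T1 k x| + 4 * k.+1%:R * e' * \1_(strip k) x))).
  apply: I_le => //.
  - exact/L1_norm/cutoff_L1.
  - by apply: L1D => //; exact: L1_norm.
  move=> x Ox; have -> : \sum_i F i x * pderiv i (chart_cut k) x =
      - T1 k x + bump p rho x * dstep (- k.+1%:R * g x - 1) *
       (- k.+1%:R * \sum_i F i x * pderiv i g x).
    rewrite /T1 -sumrN !mulr_sumr -big_split /=; apply: eq_bigr => i _.
    by rewrite cut_pderiv; ring.
  apply: le_trans (ler_normD _ _) _; rewrite normrN lerD2l.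
  have [xS|xS] := pselect (strip k x).
    have [Bx [Ux /andP[g1 g2]]] := xS.
    rewrite indicE mem_set// mulr1 normrM [X in _ * X <= _]normrM normrN (gtr0_norm K0).
    rewrite [X in X * _ <= _]normrM.
    have -> : 4 * k.+1%:R * e' = 1 * 4 * (k.+1%:R * e') by ring.
    have /andP[b0 b1] := bump_01 p rho x.
    apply: ler_pM; rewrite ?mulr_ge0//.
      by apply: ler_pM; rewrite ?normr_ge0 ?dstep_le// ger0_norm.
    rewrite ler_wpM2l// Hd//; first exact: ballK.
    by apply: lt_trans g1; rewrite mulNr ltrN2.
  rewrite indicE memNset// mulr0.
  suff -> : bump p rho x * dstep (- k.+1%:R * g x - 1) = 0 by rewrite mul0r normr0.
  have [Kx|nKx] := pselect (K x); last by rewrite bumpK// mul0r.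
  have [Bx|nBx] := pselect (ball p (2 * rho) x); last first.
    suff -> : bump p rho x = 0 by rewrite mul0r.
    have [j jr] : exists j, 2 * rho <= `|x ord0 j - p ord0 j|.
      apply: contrapT => /forallNP H; apply: nBx; apply/ball_rVP; split; first by rewrite mulr_gt0.
      by move=> i; rewrite distrC ltNge; apply/negP.
    by rewrite /bump (bigD1 j)//= /sbump step_le0 ?mul0r//; exact: sbump_out.
  rewrite dstep_eq0 ?mulr0//; apply/negP => /andP[s1 s2]; apply: xS; split=> //.
  split; first exact: KU.
  apply/andP; split.
    by rewrite ltr_pdivrMr//; move: s2; lra.
  by rewrite ltr_pdivlMr//; move: s1; lra.
rewrite I_D//; last exact: L1_norm.
rewrite (splitr e) lerD// I_Z//; last first.
  apply: (integrableS measurableT) => //.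
  apply: (@L1_bounded_support _ _ _ mu _ (strip k) 1) => //.
  - by move=> x _; rewrite indicE; case: (_ \in _); rewrite ?normr1 ?normr0.
  - by move=> x xS; rewrite indicE memNset.
have IS : Rintegral mu Om (fun x => \1_(strip k) x) <=
    2 * (k.+1%:R^-1 / c) * (2 * (2 * rho)) ^+ n.-1.
  rewrite /Rintegral integral_indic// -lee_fin fineK; last first.
    rewrite ge0_fin_numE//; apply: le_lt_trans fS; apply: le_measure; rewrite ?inE//.
    exact: measurableI.
  by apply: le_trans (strip_measure k); apply: le_measure; rewrite ?inE//; exact: measurableI.
have q0 : 0 <= 4 * k.+1%:R * e'.
  by apply: mulr_ge0; [apply: mulr_ge0|exact: ltW].
apply: le_trans (ler_wpM2l q0 IS) _.
have -> : 4 * k.+1%:R * e' * (2 * (k.+1%:R^-1 / c) * (2 * (2 * rho)) ^+ n.-1) = C * e'.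
  by rewrite /C; field; rewrite !gt_eqF.
rewrite /e' mulrCA -[leRHS]mulr1 ler_wpM2l// ?(ltW e2)//.
by rewrite ler_pdivrMr ?ltr_wpDl// mul1r lerDl.
Unshelve. all: by end_near. Qed.

(** Since [g] vanishes at [q], [eta k] is zero on a whole neighbourhood of [q], on
    both sides of the boundary. *)
Lemma chart_cut_boundary k q : boundary Om q -> ball p rho q ->
  \forall x \near q, chart_cut k x = 0.
Proof.
move=> Bq pq; have Kq : K q.
  move: pq; rewrite -ball_normE /ball_/= distrC => /ltW/le_trans; apply.
  by rewrite mulr_natl mulr2n lerDl ltW.
have Uq := KU Kq; have gq : g q = 0 by apply/(gU Uq).2.
have k0 : - (k.+1%:R : R)^-1 < 0 by rewrite oppr_lt0 invr_gt0.
have cgq := c1_cont cg Uq; rewrite -gq in k0.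
have pqn : \forall x \near q, ball p rho x by apply: open_nbhs_nbhs; split=> //; exact: ball_open.
apply: filterS2 (cvgr_gt _ cgq _ k0) pqn => x gx px.
rewrite /chart_cut bump_in//; last first.
  by move: px; rewrite -ball_normE /ball_/= distrC => /ltW.
rewrite mul1r /eta step_le0 ?subr0 ?subrr// mulNr.
move: gx; rewrite ltrNl -(ltr_pM2l (ltr0Sn R k)) mulrN divff//.
by move=> ?; lra.
Qed.

Lemma chart_exists : exists f, cutoff f /\
  forall k q, boundary Om q -> ball p rho q -> \forall x \near q, f k x = 0.
Proof. by exists chart_cut; split; [exact: chart_cutoff_seq|exact: chart_cut_boundary]. Qed.

End chart.

(** Some partial derivative of a defining function is not zero at [p], hence
    bounded away from zero in a neighbourhood. *)
Lemma boundary_chart p : regular_domain Om -> boundary Om p ->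
  exists (f : nat -> V -> R) (rho : R), [/\ 0 < rho, cutoff f &
    forall k q, boundary Om q -> ball p rho q -> \forall x \near q, f k x = 0].
Proof.
move=> [_ _ _ /(_ p) H] Bp; have [g [U [[oU Up /(c1P _ oU) cg gradU] gU]]] := H Bp.
have [i0 di0] : exists i, pderiv i g p != 0.
  apply: contrapT => /forallNP H0; have /eqP := gradU p Up; apply.
  by apply/rowP => i; rewrite !mxE; apply/eqP; have /negP := H0 i; rewrite negbK.
pose c := `|pderiv i0 g p| / 2.
have dp : 0 < `|pderiv i0 g p| by rewrite normr_gt0.
have c0 : 0 < c by rewrite divr_gt0.
have cp : c < `|pderiv i0 g p| by rewrite ltr_pdivrMr// ltr_pMr// ltr1n.
have cn : `|pderiv i0 g y| @[y --> p] --> `|pderiv i0 g p|.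
  by apply: cvg_norm; exact: c1_pderiv_cont cg Up.
have : \forall y \near p, U y /\ c < `|pderiv i0 g y|.
  by apply: filterI; [exact: open_nbhs_nbhs|exact: cvgr_gt cn _ cp].
move=> /nbhs_ballP[r /= r0 Hr].
have KB x : `|x - p| <= 2 * (r / 4) -> U x /\ c < `|pderiv i0 g x|.
  move=> xp; apply: Hr; rewrite -ball_normE /ball_/= distrC.
  by apply: le_lt_trans xp _; lra.
have r4 : 0 < r / 4 by rewrite divr_gt0.
have KU : [set x : V | `|x - p| <= 2 * (r / 4)] `<=` U by move=> x /KB[].
have Kdg x : [set x : V | `|x - p| <= 2 * (r / 4)] x -> c <= `|pderiv i0 g x|.
  by move=> /KB[_ /ltW].
have [f [cf Hf]] := chart_exists oU cg gU gradU c0 r4 KU Kdg.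
by exists f, (r / 4).
Qed.

(** The boundary is compact: finitely many charts cover it. One radial factor per
    coordinate makes the product vanish at infinity. *)
Lemma local_cutoffs : regular_domain Om -> bounded_set (boundary Om) ->
  exists f, cutoff f /\ forall k, (forall q, boundary Om q -> \forall x \near q, f k x = 0)
    /\ exists M : R, forall x, M <= `|x| -> f k x = 0.
Proof.
move=> rO bB; have clB : closed (boundary Om).
  rewrite /boundary setDE; apply: closedI; first exact: closed_closure.
  by apply: open_closedC; exact: open_interior.
have cB := bounded_closed_compact bB clB.
have Hp (p : V) : exists fr : (nat -> V -> R) * R, boundary Om p -> [/\ 0 < fr.2, cutoff fr.1 &
    forall k q, boundary Om q -> ball p fr.2 q -> \forall x \near q, fr.1 k x = 0].
  have [Bp|nBp] := pselect (boundary Om p); last by exists (fun _ => fun=> 0, 1).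
  by have [f [rho H]] := boundary_chart rO Bp; exists (f, rho).
have /choice[fr Hfr] := Hp.
move: cB; rewrite compact_cover => /(_ _ (boundary Om) (fun p => ball p (fr p).2)).
case.
- by move=> p _; exact: ball_open.
- move=> p Bp; exists p => //; have [r0 _ _] := Hfr p Bp; exact: ballxx.
move=> D DB Dcov.
(* The centres of the finite cover are in the boundary; the constant 1 is a
   neutral default elsewhere. *)
pose fD (p : V) : nat -> V -> R :=
  if pselect (boundary Om p) then (fr p).1 else fun _ => fun=> 1.
have cfD p : cutoff (fD p).
  rewrite /fD; case: pselect => [Bp|nBp] /=; last exact: cutoff1.
  by have [] := Hfr p Bp.
pose f k x := (\prod_(p <- enum_fset D) fD p k x) * \prod_(j <- index_enum 'I_n) sbump 0 k.+1%:R j x.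
exists f; split.
  exact: (cutoffM (cutoff_prod _ cfD) (cutoff_prod _ radial_cutoff)).
move=> k; split.
  move=> q Bq; have [p pD pq] := Dcov q Bq.
  have Bp : boundary Om p by apply/set_mem/DB.
  have [_ _ Hf] := Hfr p Bp; have := Hf k q Bq pq; apply: filterS => x fx.
  rewrite /f (bigD1_seq p)//=; by rewrite {1}/fD; case: pselect => //= ?; rewrite fx !mul0r.
exists (2 * k.+1%:R) => x xk.
have [j jx] : exists j, 2 * k.+1%:R <= `|x ord0 j|.
  apply: contrapT => /forallNP H; have : 2 * k.+1%:R < 2 * k.+1%:R :> R; last by rewrite ltxx.
  apply: (le_lt_trans xk); rewrite {1}/Num.Def.normr /= mx_normrE.
  apply/bigmax_ltP; split; first by rewrite mulr_gt0.
  by move=> [i j] _ /=; rewrite ord1 ltNge; apply/negP.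
rewrite /f [X in _ * X](bigD1 j)//= /sbump step_le0 ?mul0r ?mulr0//.
by apply: sbump_out => //; rewrite mxE subr0.
Qed.

(** Vanishing near the boundary and at infinity, the product of the local cutoffs
    stays of class C^1 when it is replaced by zero outside the domain. *)
Lemma exhausting_tests : regular_domain Om -> bounded_set (boundary Om) ->
  exists chi : nat -> V -> R, [/\ forall k, test_function Om (chi k),
    forall k x, 0 <= chi k x <= 1,
    forall x, Om x -> chi k x @[k --> \oo] --> (1 : R) &
    forall F, no_flux F -> (forall i, L1 mu Om (F i)) ->
      Rintegral mu Om (fun x => \sum_i F i x * pderiv i (chi k) x)
        @[k --> \oo] --> (0 : R)].
Proof.
move=> rO bB; have [f [cf f0]] := local_cutoffs rO bB.
have [c1f f01 bf f1 If] := cf.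
pose chi k x := if pselect (Om x) then f k x else 0.
have chiO k x : Om x -> chi k x = f k x by rewrite /chi; case: pselect.
have chiN k x : ~ Om x -> chi k x = 0 by rewrite /chi; case: pselect.
have nchi k x : Om x -> \forall y \near x, f k y = chi k y.
  by move=> Ox; apply: filterS (open_nbhs_nbhs (conj oO Ox)) => y /chiO ->.
have nchi0 k x : ~ Om x -> \forall y \near x, 0 = chi k y.
  move=> nOx; have [cx|ncx] := pselect (closure Om x).
    have Bx : boundary Om x by move: cx; rewrite closureE_boundary => -[].
    apply: filterS ((f0 k).1 x Bx) => y fy.
    by have [Oy|nOy] := pselect (Om y); [rewrite chiO// fy|rewrite chiN].
  have oC : open (~` closure Om) by apply: closed_openC; exact: closed_closure.
  apply: filterS (open_nbhs_nbhs (conj oC ncx)) => y ny; rewrite chiN// => Oy.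
  by apply: ny; exact: subset_closure.
have dchi k i x : Om x -> pderiv i (chi k) x = pderiv i (f k) x.
  by move=> Ox; rewrite -(near_pderiv i (nchi k x Ox)).
exists chi; split.
- move=> k; apply: test_intro.
    move=> x _; have [Ox|nOx] := pselect (Om x).
      have : c1 Om (chi k); last exact.
      by apply: (c1_near oO _ (c1_sub (@subsetT _ Om) (c1f k))) => y /chiO.
    split; first exact: cvg_near_eq (nchi0 k x nOx) (cvg_cst _).
    move=> i; split; first exact: is_pder_ex (is_pder_near (nchi0 k x nOx) (is_pder_cst i 0 x)).
    have : \forall y \near x, 0 = pderiv i (chi k) y.
      apply: filterS (nbhs_interior (nchi0 k x nOx)) => y Hy.
      by rewrite -(near_pderiv i Hy) (is_pder_val (is_pder_cst _ _ _)).
    by move=> /cvg_near_eq; apply; exact: cvg_cst.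
  pose K := closure [set x | Om x /\ f k x != 0]; exists K; split.
  + apply: bounded_closed_compact; last exact: closed_closure.
    have [M HM] := (f0 k).2; exists `|M|; split; first exact: num_real.
    move=> N MN x Kx.
    have [y [[_ fy] xy]] := Kx _ (nbhsx_ballx x (N - `|M|) ltac:(by rewrite subr_gt0)).
    have yM : `|y| < `|M|.
      rewrite ltNge; apply/negP => My; move/eqP: fy; apply; apply: HM.
      exact: le_trans (ler_norm _) My.
    move: xy; rewrite -ball_normE /ball_/= => xy.
    by rewrite -[x](subrK y) (le_trans (ler_normD _ _))//; lra.
  + move=> x Kx; apply: contrapT => nOx.
    have [cx|ncx] := pselect (closure Om x); last first.
      by apply: ncx; apply: (closure_subset _ Kx) => y [].
    have Bx : boundary Om x by move: cx; rewrite closureE_boundary => -[].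
    by have [y [[_ /eqP fy] /fy]] := Kx _ ((f0 k).1 x Bx).
  + move=> x nKx; have [Ox|nOx] := pselect (Om x); last by rewrite chiN.
    rewrite chiO//; apply: contrapT => /eqP fx; apply: nKx.
    by apply: subset_closure.
- move=> k x; have [Ox|nOx] := pselect (Om x); first by rewrite chiO.
  by rewrite chiN// lexx ler01.
- by move=> x Ox; under eq_fun do rewrite chiO//; exact: f1.
- move=> F nF LF; have /cvgrPdist_le IF := If F nF LF.
  apply/cvgrPdist_le => e /IF; apply: filterS => k; rewrite !sub0r !normrN.
  have E : Rintegral mu Om (fun x => \sum_i F i x * pderiv i (chi k) x) =
      Rintegral mu Om (fun x => \sum_i F i x * pderiv i (f k) x).
    by apply: I_eq => x Ox; apply: eq_bigr => i _; rewrite dchi.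
  rewrite E; apply: le_trans; have Lf := cutoff_L1 (c1f k) (bf k) LF.
  by apply: le_trans (I_norm mO Lf) _; rewrite ger0_norm// I_ge0.
Qed.

End cutoffs.

(** * Sobolev and Zhidkov norms of classical functions *)
Section Lnorm_real.
Context d (S : measurableType d) (R : realType) (mu : {measure set S -> \bar R}).
Variable D : set S.
Hypothesis mD : measurable D.
Implicit Types f : S -> R.

Lemma Lnorm2E f : ('N[mu]_2%:E[EFin \o (f \_ D)] =
  (\int[mu]_(x in D) (f x ^+ 2)%:E) `^ 2^-1)%E.
Proof.
rewrite unlock /Lnorm; congr (_ `^ _)%E.
rewrite [RHS]integral_mkcond; apply: eq_integral => x _ /=.
rewrite /patch; case: (x \in D) => /=.
  by rewrite powR_mulrn ?normr_ge0// -normrX ger0_norm ?sqr_ge0.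
by rewrite normr0 powR0.
Qed.

Lemma L2_of_Lnorm f : measurable_fun D f ->
  ('N[mu]_2%:E[EFin \o (f \_ D)] < +oo)%E -> L2 mu D f.
Proof.
move=> mf; rewrite Lnorm2E => H; split=> //.
apply/integrableP; split; first by apply/measurable_EFinP; exact: measurable_funX.
under eq_integral do rewrite /= ger0_norm ?sqr_ge0//.
rewrite ltNge; apply/negP; rewrite leye_eq => /eqP E.
by move: H; rewrite E poweRyr// invr_neq0.
Qed.

Lemma Lnorm2_n2 f : L2 mu D f -> ('N[mu]_2%:E[EFin \o (f \_ D)] = (n2 mu D f)%:E)%E.
Proof.
move=> [mf Lf]; rewrite Lnorm2E -I_EFin// poweR_EFin /n2 powR12_sqrt//.
by apply: I_ge0 => x _; exact: sqr_ge0.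
Qed.

Lemma Lnorm1E f : ('N[mu]_1[EFin \o (f \_ D)] =
  \int[mu]_(x in D) `|f x|%:E)%E.
Proof.
rewrite Lnorm1 [RHS]integral_mkcond; apply: eq_integral => x _ /=.
by rewrite /patch; case: (x \in D) => //=; rewrite normr0.
Qed.

Lemma L1_of_Lnorm f : measurable_fun D f ->
  ('N[mu]_1[EFin \o (f \_ D)] < +oo)%E -> L1 mu D f.
Proof.
by move=> mf; rewrite Lnorm1E => H; apply/integrableP; split=> //; exact/measurable_EFinP.
Qed.

Lemma Lnorm1_I f : L1 mu D f ->
  ('N[mu]_1[EFin \o (f \_ D)] = (Rintegral mu D (fun x => `|f x|%R))%:E)%E.
Proof. by move=> Lf; rewrite Lnorm1E -I_EFin//; exact: L1_norm. Qed.

Lemma Lnormoo_ae f (M : R) : (0 < mu setT)%E ->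
  ('N[mu]_+oo[EFin \o (f \_ D)] <= M%:E)%E ->
  {ae mu, forall x, D x -> `|f x| <= M}.
Proof.
move=> mu0; rewrite unlock /Lnorm mu0 => H.
have := ess_sup_ge mu (abse \o (EFin \o f \_ D)); apply: filterS => x /= Hx Dx.
by have := le_trans Hx H; rewrite /patch mem_set// lee_fin.
Qed.

Lemma L1_extend (K : set S) f : measurable K -> K `<=` D -> L1 mu K f ->
  (forall x, D x -> ~ K x -> f x = 0) -> L1 mu D f.
Proof.
move=> mK KD /(integrable_mkcond _ mK) H f0.
apply: (@eq_integrable _ _ _ _ _ mD ((EFin \o f) \_ K)).
  move=> x /set_mem Dx; rewrite /patch; case: ifPn => //= /negP xK.
  by rewrite f0// => Kx; apply: xK; exact/mem_set.
by apply: integrableS H.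
Qed.

Lemma I_ae_eq f g : measurable_fun D f -> measurable_fun D g ->
  {ae mu, forall x, D x -> f x = g x} -> Rintegral mu D f = Rintegral mu D g.
Proof.
move=> mf mg fg; congr fine; apply: ae_eq_integral => //; try exact/measurable_EFinP.
by apply: filterS fg => x H Dx; rewrite H.
Qed.

Lemma L1_ae_eq f g : measurable_fun D f -> L1 mu D g ->
  {ae mu, forall x, D x -> f x = g x} -> L1 mu D f.
Proof.
move=> mf Lg fg; apply/integrableP; split; first exact/measurable_EFinP.
rewrite (@ae_eq_integral _ _ _ mu D (fun x => `|(g x)%:E|%E))//.
- by have /integrableP[] := Lg.
- by apply: measurableT_comp => //; exact/measurable_EFinP.
- by apply: measurableT_comp => //; apply/measurable_EFinP; exact: L1_measurable Lg.
- by apply: filterS fg => x H Dx /=; rewrite H.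
Qed.

Lemma L2_ae_eq f g : measurable_fun D f -> L2 mu D g ->
  {ae mu, forall x, D x -> f x = g x} -> L2 mu D f /\ n2 mu D f = n2 mu D g.
Proof.
move=> mf [mg Lg] fg.
have fg2 : {ae mu, forall x, D x -> f x ^+ 2 = g x ^+ 2}.
  by apply: filterS fg => x H Dx; rewrite H.
split; last by congr Num.sqrt; apply: I_ae_eq => //; exact: measurable_funX.
by split=> //; apply: L1_ae_eq Lg fg2; exact: measurable_funX.
Qed.

End Lnorm_real.

Section domain.
Context {R : realType} {n : nat}.
Local Notation mu := (lebesgue_rV n).
Local Notation V := 'rV[R]_n.
Variable (Om : set V).
Hypothesis oO : open Om.
Let mO : measurable Om := open_measurable_rV oO.
Implicit Types f g : V -> R.

Lemma lebesgue_gt0 : (0 < mu [set: V])%E.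
Proof.
apply: (@lt_le_trans _ _ (mu (ball (0 : V) 1))).
  by rewrite lebesgue_ball// lte_fin exprn_gt0.
by apply: le_measure; rewrite ?inE//; exact: measurable_ball_rV.
Qed.

Lemma in_Lp2_L2 f : in_Lp Om 2%:E f -> L2 mu Om f.
Proof. by move=> [mf Hf]; exact: L2_of_Lnorm. Qed.

Lemma Lp_norm2 f : L2 mu Om f -> Lp_norm Om 2%:E f = (n2 mu Om f)%:E.
Proof. exact: Lnorm2_n2. Qed.

Lemma Lp_norm_ge0 (O : set V) p f : (0 <= Lp_norm O p f)%E.
Proof. exact: Lnorm_ge0. Qed.

Lemma Lp_normoo_ae f (M : R) : (Lp_norm Om +oo f <= M%:E)%E ->
  {ae mu, forall x, Om x -> `|f x| <= M}.
Proof. by move=> H; exact: (Lnormoo_ae lebesgue_gt0 H). Qed.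

Lemma Lp_normoo_le f (M : R) : (forall x, Om x -> f y @[y --> x] --> f x) ->
  (Lp_norm Om +oo f <= M%:E)%E -> forall x, Om x -> `|f x| <= M.
Proof.
move=> cf /Lp_normoo_ae; apply: ae_le_continuous => //.
by rewrite continuous_open_subspace// => x /set_mem; exact: cf.
Qed.

Lemma cont_measurable f : (forall x, Om x -> f y @[y --> x] --> f x) ->
  measurable_fun Om f.
Proof.
move=> cf; apply: continuous_measurable_rV => //.
by rewrite continuous_open_subspace// => x /set_mem; exact: cf.
Qed.

Lemma L1loc_L1 f K : in_L1loc Om f -> compact K -> K `<=` Om -> L1 mu K f.
Proof.
move=> [mf Hf] cK KO; apply: L1_of_Lnorm; last exact: Hf.
exact: measurable_funS mf.
Qed.

Lemma test_L1loc f psi : in_L1loc Om f -> csupp Om psi ->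
  (forall x, psi y @[y --> x] --> psi x) -> L1 mu Om (fun x => f x * psi x).
Proof.
move=> Hf [K [cK KO psi0]] cpsi; have mK := compact_measurable_rV cK.
have [M HM] := continuous_compact_bounded cK (fun x _ => cpsi x).
apply: (L1_extend mO mK KO); last by move=> x _ /psi0 ->; rewrite mulr0.
apply: (L1_eq mK (f := fun x => psi x * f x)); first by move=> x _; rewrite mulrC.
apply: (L1_bddM mK _ HM); last exact: L1loc_L1.
apply: (@measurable_funS _ _ _ _ setT) => //.
apply: continuous_measurable_rV; first exact: openT.
by apply: continuous_subspaceT => x; exact: cpsi.
Qed.

Lemma weak_I i f g psi : weak_pderiv Om i f g -> test_function Om psi ->
  Rintegral mu Om (fun x => f x * pderiv i psi x) =
  - Rintegral mu Om (fun x => g x * psi x).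
Proof. by move=> [_ _ H] /H E; rewrite /Rintegral E fineN. Qed.

(** The classical derivative is a weak one by [test_by_parts], and the difference
    of two weak derivatives is orthogonal to every test function. *)
Lemma weak_classical i f f' g : c1 Om f -> {ae mu, forall x, Om x -> f' x = f x} ->
  weak_pderiv Om i f' g -> {ae mu, forall x, Om x -> g x = pderiv i f x}.
Proof.
move=> cf ff' W; have [L1f' L1g _] := W.
have cdf x (Ox : Om x) := c1_pderiv_cont (i := i) cf Ox.
have mdf := cont_measurable cdf.
have Lloc (h : V -> R) : (forall x, Om x -> h y @[y --> x] --> h x) ->
    forall K, compact K -> K `<=` Om -> L1 mu K h.
  move=> ch K cK KO; have [M HM] := continuous_compact_bounded cK (fun x Kx => ch x (KO x Kx)).
  apply: measurable_bounded_integrable.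
  - exact: compact_measurable_rV.
  - exact: compact_lty.
  - by apply: (@measurable_funS _ _ _ _ Om) => //; exact: cont_measurable.
  - exists M; split; first exact: num_real.
    by move=> y My x Kx; apply: le_trans (HM x Kx) (ltW My).
suff : {ae mu, forall x, Om x -> g x - pderiv i f x = 0}.
  by apply: filterS => x H Ox; apply/eqP; rewrite -subr_eq0 H.
apply: (ae0_of_test oO).
- by apply: measurable_funB => //; case: L1g.
- move=> K cK KO; apply: L1B; first exact: compact_measurable_rV.
    exact: L1loc_L1.
  exact: Lloc.
move=> psi tpsi; have cpsi x : psi y @[y --> x] --> psi x := c1_cont (test_c1 tpsi) I.
have cdpsi x : pderiv i psi y @[y --> x] --> pderiv i psi x.
  exact: (c1_pderiv_cont (test_c1 tpsi) I).
have Lg := test_L1loc L1g (test_csupp tpsi) cpsi.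
have Ldf := test_L1 oO tpsi cdf.
rewrite (@I_eq _ _ _ _ _ _ (fun x => g x * psi x - psi x * pderiv i f x)); last first.
  by move=> x _; ring.
rewrite (I_B mO Lg Ldf) (test_by_parts i oO tpsi cf) opprK.
have -> : Rintegral mu Om (fun x => g x * psi x) =
    - Rintegral mu Om (fun x => f' x * pderiv i psi x).
  by rewrite (weak_I W tpsi) opprK.
rewrite addrC; apply/eqP; rewrite subr_eq0; apply/eqP.
have mdpsi := cont_measurable (fun x _ => cdpsi x).
apply: I_ae_eq => //.
- apply: measurable_funM => //.
  by apply: cont_measurable => x Ox; exact: c1_cont cf Ox.
- by apply: measurable_funM => //; case: L1f'.
- by apply: filterS ff' => x H Ox; rewrite H// mulrC.
Qed.

Lemma H_norm_ge0 k f : (0 <= H_norm Om k f)%E.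
Proof.
elim: k f => [|k IH] f /=; rewrite adde_ge0 ?Lp_norm_ge0//.
apply: sume_ge0 => i _; apply: le_ereal_inf_tmp => _ [g _ <-]; exact: IH.
Qed.

Lemma inf_H_norm_ge0 k i f :
  (0 <= ereal_inf [set H_norm Om k g | g in weak_pderiv Om i f])%E.
Proof. by apply: le_ereal_inf_tmp => _ [g _ <-]; exact: H_norm_ge0. Qed.

Lemma Lp_le_H_norm k f : (Lp_norm Om 2%:E f <= H_norm Om k f)%E.
Proof.
case: k => [|k] /=; rewrite ?adde0// leeDl// sume_ge0// => i _.
exact: inf_H_norm_ge0.
Qed.

Lemma inf_le_sum (F : 'I_n -> \bar R) i : (forall i, 0 <= F i)%E -> (F i <= \sum_i F i)%E.
Proof. by move=> F0; rewrite (bigD1 i)//= leeDl// sume_ge0. Qed.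

(** The function [f'] may differ from [f] on a null set: second weak derivatives
    are those of an arbitrary representative of the first one. *)
Lemma weak_n2 i f f' g (e : R) : c1 Om f -> {ae mu, forall x, Om x -> f' x = f x} ->
  weak_pderiv Om i f' g -> (Lp_norm Om 2%:E g <= e%:E)%E ->
  L2 mu Om (pderiv i f) /\ n2 mu Om (pderiv i f) <= e.
Proof.
move=> cf ff' W ge; have gf := weak_classical cf ff' W; have [_ [mg _] _] := W.
have Lg : L2 mu Om g by apply: L2_of_Lnorm => //; apply: le_lt_trans ge (ltry _).
have mdf := cont_measurable (fun x (Ox : Om x) => c1_pderiv_cont (i := i) cf Ox).
have fg : {ae mu, forall x, Om x -> pderiv i f x = g x}.
  by apply: filterS gf => x H Ox; rewrite H.
have [Ldf ->] := L2_ae_eq mO mdf Lg fg; split=> //.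
by rewrite -lee_fin -Lp_norm2.
Qed.

Lemma in_X_L2 k f i : c1 Om f -> in_X Om k f -> L2 mu Om (pderiv i f).
Proof.
move=> cf [_ /(_ i)[g W Hg]].
have [mg gfin] : in_Lp Om 2%:E g by case: (k.-1) Hg => [|m] [].
have ge : (Lp_norm Om 2%:E g <= (fine (Lp_norm Om 2%:E g))%:E)%E.
  by rewrite fineK// ge0_fin_numE// Lp_norm_ge0.
by have [] := weak_n2 cf (aeW _ (fun x _ => erefl)) W ge.
Qed.

Lemma X_norm_pderiv k f i (e : R) : c1 Om f -> (X_norm Om k f < e%:E)%E ->
  n2 mu Om (pderiv i f) <= e.
Proof.
move=> cf Xe; have : (ereal_inf [set H_norm Om k.-1 g | g in weak_pderiv Om i f] < e%:E)%E.
  apply: le_lt_trans Xe; apply: le_trans (inf_le_sum i (fun i => inf_H_norm_ge0 k.-1 i f)) _.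
  by rewrite leeDr// Lp_norm_ge0.
move=> /ereal_inf_lt[_ [g W <-] ge].
have [] := weak_n2 (e := e) cf (aeW _ (fun x _ => erefl)) W; last by [].
by apply: ltW; apply: le_lt_trans ge; exact: Lp_le_H_norm.
Qed.

Lemma in_X_L2_2 f i j : c1 Om f -> c1 Om (pderiv i f) -> in_X Om 2 f ->
  L2 mu Om (pderiv j (pderiv i f)).
Proof.
move=> cf cdf [_ /(_ i)[g W [_ /(_ j)[h W' [[mh hfin] _]]]]].
have gf := weak_classical cf (aeW _ (fun x _ => erefl)) W.
have he : (Lp_norm Om 2%:E h <= (fine (Lp_norm Om 2%:E h))%:E)%E.
  by rewrite fineK// ge0_fin_numE// Lp_norm_ge0.
by have [] := weak_n2 cdf gf W' he.
Qed.

Lemma X_norm_pderiv2 f i j (e : R) : c1 Om f -> c1 Om (pderiv i f) ->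
  (X_norm Om 2 f < e%:E)%E -> n2 mu Om (pderiv j (pderiv i f)) <= e.
Proof.
move=> cf cdf Xe; have : (ereal_inf [set H_norm Om 1 g | g in weak_pderiv Om i f] < e%:E)%E.
  apply: le_lt_trans Xe; apply: le_trans (inf_le_sum i (fun i => inf_H_norm_ge0 1 i f)) _.
  by rewrite leeDr// Lp_norm_ge0.
move=> /ereal_inf_lt[_ [g W <-] ge].
have gf := weak_classical cf (aeW _ (fun x _ => erefl)) W.
have : (ereal_inf [set H_norm Om 0 h | h in weak_pderiv Om j g] < e%:E)%E.
  apply: le_lt_trans ge; apply: le_trans (inf_le_sum j (fun j => inf_H_norm_ge0 0 j g)) _.
  by rewrite /= leeDr// Lp_norm_ge0.
move=> /ereal_inf_lt[_ [h W' <-] he].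
have [] := weak_n2 (e := e) cdf gf W'; last by [].
by apply: ltW; apply: le_lt_trans he; exact: Lp_le_H_norm.
Qed.

Section time.
Variable (T : R).
Implicit Types w : R -> V -> R.
Local Notation near_t t := (within `[0, T]%classic (nbhs (t : R))).

Lemma near_within_itv t (P : R -> Prop) : (forall s, 0 <= s <= T -> P s) ->
  \forall s \near near_t t, P s.
Proof.
move=> H; apply: (@filterS _ (near_t t) _ [set s | `[0, T]%classic s]).
  by move=> s; rewrite /= in_itv/=; exact: H.
by rewrite /within/=; apply: nearW.
Qed.

Lemma tc_near E N w t (e : R) : time_continuous T E N w -> 0 <= t <= T -> 0 < e ->
  \forall s \near near_t t, (N (fun x => w s x - w t x)%R < e%:E)%E.
Proof.
move=> H tT e0; have [_ Nt] := H t tT.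
have : nbhs 0%E [set y : \bar R | (y < e%:E)%E].
  by apply: open_nbhs_nbhs; split; [exact: open_ereal_lt_ereal|rewrite /= lte_fin].
by move=> /Nt.
Qed.

Lemma C_L2_conv w : C_L2 T Om w -> forall t, 0 <= t <= T ->
  conv2 mu Om (near_t t) w (w t).
Proof.
move=> H t tT; have Lw s : 0 <= s <= T -> L2 mu Om (w s).
  by move=> /H[/in_Lp2_L2].
split; first exact: Lw.
move=> e e0; apply: filterS2 (near_within_itv t Lw) (tc_near H tT e0) => s Ls.
by rewrite Lp_norm2; [rewrite lte_fin => /ltW|apply: L2B => //; exact: Lw].
Qed.

(** Essential bounds on continuous functions hold everywhere, by
    [ae_le_continuous]. *)
Lemma C_Loo_convoo E N w : time_continuous T E N w ->
  (forall f, E f -> in_Lp Om +oo f) ->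
  (forall f, (Lp_norm Om +oo f <= N f)%E) ->
  (forall t x, 0 <= t <= T -> Om x -> w t y @[y --> x] --> w t x) ->
  forall t, 0 <= t <= T -> convoo Om (near_t t) w (w t).
Proof.
move=> H EL NL cw t tT; split.
- by apply: cont_measurable => x Ox; exact: cw.
- have [/EL[_ fin] _] := H t tT; exists (fine (Lp_norm Om +oo (w t))).
  apply: Lp_normoo_le; first by move=> x Ox; exact: cw.
  by rewrite fineK// ge0_fin_numE// Lp_norm_ge0.
move=> e e0; have cw' s : 0 <= s <= T -> forall x, Om x -> w s y @[y --> x] --> w s x.
  by move=> sT x; exact: cw.
apply: filterS2 (near_within_itv t cw') (tc_near H tT e0) => s cs se.
split; first exact: cont_measurable.
apply: Lp_normoo_le; last exact: le_trans (NL _) (ltW se).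
by move=> x Ox; apply: cvgB; [exact: cs|exact: cw].
Qed.

Lemma C_X_convoo k w : C_X T Om k w ->
  (forall t x, 0 <= t <= T -> Om x -> w t y @[y --> x] --> w t x) ->
  forall t, 0 <= t <= T -> convoo Om (near_t t) w (w t).
Proof.
move=> H; apply: (C_Loo_convoo H); first by move=> f [].
by move=> f; rewrite /X_norm leeDl// sume_ge0// => i _; exact: inf_H_norm_ge0.
Qed.

Lemma C_L2Loo_convoo w : C_L2Loo T Om w ->
  (forall t x, 0 <= t <= T -> Om x -> w t y @[y --> x] --> w t x) ->
  forall t, 0 <= t <= T -> convoo Om (near_t t) w (w t).
Proof.
move=> H; apply: (C_Loo_convoo H); first by move=> f [].
by move=> f; rewrite /L2Loo_norm leeDr// Lp_norm_ge0.
Qed.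

Lemma C_L2Loo_L2 w : C_L2Loo T Om w -> C_L2 T Om w.
Proof.
move=> H t tT; have [[L2t _] Nt] := H t tT; split=> //.
apply: (squeeze_cvge _ (cvg_cst 0%E) Nt); apply: nearW => s.
by rewrite Lp_norm_ge0/= /L2Loo_norm leeDl// Lp_norm_ge0.
Qed.

Lemma C_X_pderiv k w i : C_X T Om k w -> (forall t, 0 <= t <= T -> c1 Om (w t)) ->
  forall t, 0 <= t <= T -> conv2 mu Om (near_t t) (fun s => pderiv i (w s)) (pderiv i (w t)).
Proof.
move=> H cw t tT; have Lw s : 0 <= s <= T -> L2 mu Om (pderiv i (w s)).
  by move=> sT; apply: in_X_L2 (cw s sT) _; exact: (H s sT).1.
split; first exact: Lw.
have Hs s : 0 <= s <= T -> 0 <= s <= T by [].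
move=> e e0; apply: filterS2 (near_within_itv t Hs) (tc_near H tT e0) => s sT se.
split; first exact: Lw.
have := X_norm_pderiv i (c1B oO (cw s sT) (cw t tT)) se; apply: le_trans.
rewrite le_eqVlt; apply/orP; left; apply/eqP; apply: n2_eq => x Ox; apply/esym/is_pder_val.
by apply: is_pderB; [exact: c1_pder (cw s sT) Ox|exact: c1_pder (cw t tT) Ox].
Qed.

Lemma C_X_pderiv2 w i j : C_X T Om 2 w -> (forall t, 0 <= t <= T -> c1 Om (w t)) ->
  (forall t, 0 <= t <= T -> c1 Om (pderiv i (w t))) ->
  forall t, 0 <= t <= T ->
  conv2 mu Om (near_t t) (fun s => pderiv j (pderiv i (w s))) (pderiv j (pderiv i (w t))).
Proof.
move=> H cw cdw t tT; have Lw s : 0 <= s <= T -> L2 mu Om (pderiv j (pderiv i (w s))).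
  by move=> sT; apply: in_X_L2_2 (cw s sT) (cdw s sT) _; exact: (H s sT).1.
split; first exact: Lw.
have Hs s : 0 <= s <= T -> 0 <= s <= T by [].
move=> e e0; apply: filterS2 (near_within_itv t Hs) (tc_near H tT e0) => s sT se.
split; first exact: Lw.
have dE x : Om x -> pderiv i (fun x => w s x - w t x) x = pderiv i (w s) x - pderiv i (w t) x.
  move=> Ox; apply: is_pder_val; apply: is_pderB.
    exact: c1_pder (cw s sT) Ox.
  exact: c1_pder (cw t tT) Ox.
have cd : c1 Om (pderiv i (fun x => w s x - w t x)).
  by apply: (c1_near oO _ (c1B oO (cdw s sT) (cdw t tT))) => x /dE.
have := X_norm_pderiv2 j (c1B oO (cw s sT) (cw t tT)) cd se; apply: le_trans.
rewrite le_eqVlt; apply/orP; left; apply/eqP; apply: n2_eq => x Ox.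
have nE : \forall y \near x, pderiv i (w s) y - pderiv i (w t) y =
    pderiv i (fun x => w s x - w t x) y.
  by apply: filterS (open_nbhs_nbhs (conj oO Ox)) => y /dE.
rewrite -(near_pderiv j nE); apply/esym/is_pder_val.
by apply: is_pderB; [exact: c1_pder (cdw s sT) Ox|exact: c1_pder (cdw t tT) Ox].
Qed.

(** Stated for a predicate monotone in the bound, so as to serve for suprema,
    [L^2] norms and essential suprema alike. *)
Lemma segment_bounded (P : R -> R -> Prop) :
  (forall t M M', M <= M' -> P t M -> P t M') ->
  (forall t, 0 <= t <= T -> exists M, \forall s \near near_t t, P s M) ->
  exists M, forall t, 0 <= t <= T -> P t M.
Proof.
move=> Pm HP; have HP' t : exists M, 0 <= t <= T -> \forall s \near near_t t, P s M.
  have [tT|ntT] := pselect (0 <= t <= T); last by exists 0.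
  by have [M HM] := HP t tT; exists M.
have /choice[M HM] := HP'.
have := @segment_compact R 0 T; rewrite compact_cover.
move=> /(_ _ `[0, T]%classic (fun t => [set s | `[0, T]%classic s -> P s (M t)]^°)).
case.
- by move=> t _; exact: open_interior.
- move=> t tT; exists t => //; move: tT; rewrite /= in_itv/= => tT.
  exact: (HM t tT).
move=> D DT Dcov; exists (\sum_(t <- enum_fset D) `|M t|) => t tT.
have tI : `[0, T]%classic t by rewrite /= in_itv.
have [r rD /interior_subset/(_ tI)] := Dcov t tI.
apply: Pm; apply: le_trans (ler_norm _) _.
by rewrite (bigD1_seq r)//= lerDl sumr_ge0.
Qed.

Lemma convoo_bounded w : (forall t, 0 <= t <= T -> convoo Om (near_t t) w (w t)) ->
  exists M : R, forall t x, 0 <= t <= T -> Om x -> `|w t x| <= M.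
Proof.
move=> H; have [||M HM] := @segment_bounded (fun t M => forall x, Om x -> `|w t x| <= M).
- by move=> t M M' MM' HM x Ox; apply: le_trans (HM x Ox) MM'.
- move=> t tT; have [_ [M HM] /(_ 1 ltr01) Hn] := H t tT; exists (M + 1).
  apply: filterS Hn => s [_ Hs] x Ox; rewrite -[w s x](subrK (w t x)) addrC.
  by rewrite (le_trans (ler_normD _ _))// lerD ?HM ?Hs.
- by exists M => t x tT; exact: HM.
Qed.

Lemma conv2_bounded w : (forall t, 0 <= t <= T -> conv2 mu Om (near_t t) w (w t)) ->
  exists M : R, forall t, 0 <= t <= T -> n2 mu Om (w t) <= M.
Proof.
move=> H; apply: segment_bounded; first by move=> t M M' MM' HM; exact: le_trans MM'.
move=> t tT; have [Lt /(_ 1 ltr01) Hn] := H t tT; exists (1 + n2 mu Om (w t)).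
apply: filterS Hn => s [Ls Hs].
rewrite (@n2_eq _ _ _ _ _ _ (fun x => (w s x - w t x) + w t x)); last by move=> x _; rewrite subrK.
by apply: le_trans (n2D mO (L2B mO Ls Lt) Lt) _; rewrite lerD2r.
Qed.

Lemma C_L2Loo_ae_bounded w : C_L2Loo T Om w ->
  exists M : R, forall t, 0 <= t <= T -> {ae mu, forall x, Om x -> `|w t x| <= M}.
Proof.
move=> H; apply: segment_bounded.
  by move=> t M M' MM'; apply: filterS => x HM Ox; apply: le_trans (HM Ox) MM'.
move=> t tT; have [[_ [_ fin]] _] := H t tT.
have tM : {ae mu, forall x, Om x -> `|w t x| <= fine (Lp_norm Om +oo (w t))}.
  by apply: Lp_normoo_ae; rewrite fineK// ge0_fin_numE// Lp_norm_ge0.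
exists (1 + fine (Lp_norm Om +oo (w t))); have := tc_near H tT ltr01.
apply: filterS => s /ltW se.
have sM : {ae mu, forall x, Om x -> `|w s x - w t x| <= 1}.
  apply: Lp_normoo_ae; apply: le_trans se.
  by rewrite /L2Loo_norm leeDr// Lp_norm_ge0.
apply: filterS2 sM tM => x sx tx Ox; rewrite -[w s x](subrK (w t x)).
by rewrite (le_trans (ler_normD _ _))// lerD ?sx ?tx.
Qed.

End time.
End domain.

(** * Difference quotients in time *)
Section difference_quotients.
Context {R : realType} {n : nat}.
Local Notation mu := (lebesgue_rV n).
Local Notation V := 'rV[R]_n.
Variables (Om : set V) (chi : nat -> V -> R) (T : R).
Hypothesis oO : open Om.
Hypothesis tchi : forall k, test_function Om (chi k).
Hypothesis chi01 : forall k x, 0 <= chi k x <= 1.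
Hypothesis chi1 : forall x, Om x -> chi k x @[k --> \oo] --> (1 : R).
Let mO : measurable Om := open_measurable_rV oO.

Lemma itvoo_open : open (`]0, T[%classic : set R).
Proof. exact: interval_open. Qed.

Lemma near_itvoo t : 0 < t < T -> \forall s \near t, 0 < s < T.
Proof.
move=> tT; have : nbhs t (`]0, T[%classic : set R).
  by apply: open_nbhs_nbhs; split; [exact: itvoo_open|rewrite /= in_itv].
by apply: filterS => s; rewrite /= in_itv.
Qed.

Lemma jointly_continuous_local (w : R -> V -> R) t x (e : R) :
  jointly_continuous `]0, T[%classic Om w -> 0 < t < T -> Om x -> 0 < e ->
  exists A B, [/\ nbhs t A, nbhs x B &
    forall s y, A s -> B y -> `|w t x - w s y| <= e].
Proof.
have oIO : open (`]0, T[%classic `*` Om).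
  rewrite openE => -[s y] [/= sI Oy]; exists (`]0, T[%classic, Om); last by [].
  by split; apply: open_nbhs_nbhs; split=> //; exact: itvoo_open.
rewrite /jointly_continuous continuous_open_subspace// => jw tT Ox e0.
have tx : (t, x) \in `]0, T[%classic `*` Om.
  by apply/mem_set; split=> //; rewrite /= in_itv.
have /cvgrPdist_le/(_ _ e0) [[A B] /= [nA nB] AB] := jw _ tx.
by exists A, B; split=> // s y As By; exact: (AB (s, y)).
Qed.

(** The tube lemma over the compact set [K]. *)
Lemma jointly_continuous_tube (w : R -> V -> R) (K : set V) (t e : R) :
  jointly_continuous `]0, T[%classic Om w -> compact K -> K `<=` Om ->
  0 < t < T -> 0 < e ->
  \forall s \near t, forall x, K x -> `|w s x - w t x| <= e.
Proof.
move=> jw /compact_near_coveringP cK KO tT e0.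
apply: (cK R (nbhs t) (fun s x => `|w s x - w t x| <= e)) => x Kx.
have e2 : 0 < e / 2 by rewrite divr_gt0.
have [A [B [nA nB AB]]] := jointly_continuous_local jw tT (KO _ Kx) e2.
exists (B, A); first by [].
move=> [y s] /= [By As].
have tA : A t by exact: nbhs_singleton.
rewrite (_ : w s y - w t y = (w t x - w t y) - (w t x - w s y)); last by ring.
by rewrite (splitr e) (le_trans (ler_normB _ _))// lerD// AB.
Qed.

(** Differentiation under the integral sign on a compact support, where joint
    continuity controls the quotients uniformly in space. *)
Lemma integral_is_derive (w wt : R -> V -> R) (psi : V -> R) (t : R) :
  (forall s x, 0 < s < T -> Om x -> is_derive s (1 : R) (w^~ x) (wt s x)) ->
  jointly_continuous `]0, T[%classic Om wt ->
  (forall s x, 0 < s < T -> Om x -> w s y @[y --> x] --> w s x) ->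
  (forall s x, 0 < s < T -> Om x -> wt s y @[y --> x] --> wt s x) ->
  csupp Om psi -> (forall x, Om x -> psi y @[y --> x] --> psi x) -> 0 < t < T ->
  is_derive t (1 : R) (fun s => Rintegral mu Om (fun x => w s x * psi x))
    (Rintegral mu Om (fun x => wt t x * psi x)).
Proof.
move=> Dw cwt cw cwtx spsi cpsi tT.
have Lpsi := csupp_L1 oO cpsi spsi.
have LM g : (forall x, Om x -> g y @[y --> x] --> (g x : R)) ->
    L1 mu Om (fun x => g x * psi x).
  move=> cg; apply: csupp_L1 => //; first by move=> x Ox; apply: cvgM; [exact: cg|exact: cpsi].
  have [K [cK KO psi0]] := spsi; exists K; split=> // x nKx; by rewrite psi0// mulr0.
have Lw s : 0 < s < T -> L1 mu Om (fun x => w s x * psi x).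
  by move=> sT; apply: LM => x Ox; exact: cw.
have Lwt s : 0 < s < T -> L1 mu Om (fun x => wt s x * psi x).
  by move=> sT; apply: LM => x Ox; exact: cwtx.
have [K [cK KO psi0]] := spsi.
set C := Rintegral mu Om (fun x => `|psi x|).
have C0 : 0 <= C by apply: I_ge0.
apply/is_derive_epsP => e e0.
have e1 : 0 < e / (C + 1) by rewrite divr_gt0// ltr_wpDl.
have /nbhs_ballP[r /= r0 Hr] : \forall s \near t,
    0 < s < T /\ forall x, K x -> `|wt s x - wt t x| <= e / (C + 1).
  by apply: filterI; [exact: near_itvoo|exact: jointly_continuous_tube].
have Hr' s : `|s - t| < r -> 0 < s < T /\
    forall x, K x -> `|wt s x - wt t x| <= e / (C + 1).
  by move=> sr; apply: Hr; rewrite /ball/= distrC.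
exists r => // s /andP[s0 sr]; have [sT _] := Hr' s sr.
have sn : s - t != 0 by rewrite -normr_gt0.
rewrite -(I_B mO (Lw s sT) (Lw t tT)) mulrC.
have Ld := L1B mO (Lw s sT) (Lw t tT).
rewrite -(I_Z mO _ Ld) -(I_B mO (L1Z mO (s - t)^-1 Ld) (Lwt t tT)).
have LL := L1B mO (L1Z mO (s - t)^-1 Ld) (Lwt t tT).
apply: le_trans (I_norm mO LL) _.
apply: (@le_trans _ _ (Rintegral mu Om (fun x => e / (C + 1) * `|psi x|))).
  apply: I_le => //; [exact: L1_norm|exact/L1Z/L1_norm|].
  move=> x Ox; have [Kx|nKx] := pselect (K x); last first.
    by rewrite psi0// !mulr0 !subr0 mulr0 normr0 mulr0.
  rewrite (_ : _ - _ = ((w s x - w t x) / (s - t) - wt t x) * psi x); last by ring.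
  rewrite normrM ler_wpM2r//.
  have D1 c : `|c - t| < r -> is_derive c (1 : R) (w^~ x) (wt c x).
    by move=> /Hr'[cT _]; exact: Dw.
  have tr : `|t - t| < r by rewrite subrr normr0.
  have [c cr ->] := MVT_ball D1 tr sr.
  by rewrite mulfK//; have [_] := Hr' c cr; apply.
rewrite (I_Z mO _ (L1_norm Lpsi)) -/C mulrAC ler_pdivrMr ?ltr_wpDl//.
by rewrite ler_wpM2l ?(ltW e0)// lerDl.
Qed.

(** The quotients converge pointwise, but no domination is available. Instead,
    the defect [q] of the quotient is tested against its own truncation
    [chi k q], frozen in time: by the mean value theorem the quotient of the
    integrals is the integral of [wt c] for a nearby time [c], and [wt] is
    continuous in [L^2]. *)
Lemma quotient_conv2 (w wt : R -> V -> R) (t : R) :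
  (forall s x, 0 < s < T -> Om x -> is_derive s (1 : R) (w^~ x) (wt s x)) ->
  jointly_continuous `]0, T[%classic Om wt ->
  (forall s x, 0 < s < T -> Om x -> w s y @[y --> x] --> w s x) ->
  (forall s x, 0 < s < T -> Om x -> wt s y @[y --> x] --> wt s x) ->
  0 < t < T -> conv2 mu Om (nbhs t) wt (wt t) ->
  conv2 mu Om t^' (fun s x => (s - t)^-1 * (w s x - w t x)) (wt t).
Proof.
move=> Dw cwt cw cwtx tT [Lwtt Hwt]; split=> // e e0.
have /nbhs_ballP[r /= r0 Hr] : \forall s \near t,
    0 < s < T /\ (L2 mu Om (wt s) /\ n2 mu Om (fun x => wt s x - wt t x) <= e).
  by apply: filterI; [exact: near_itvoo|exact: Hwt].
have {}Hr s : `|s - t| < r -> 0 < s < T /\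
    (L2 mu Om (wt s) /\ n2 mu Om (fun x => wt s x - wt t x) <= e).
  by move=> sr; apply: Hr; rewrite /ball/= distrC.
apply/nbhs_ballP; exists r => // s; rewrite /ball/= distrC => sr st.
have sn : s - t != 0 by rewrite subr_eq0.
have [sT _] := Hr s sr.
pose q x := (s - t)^-1 * (w s x - w t x) - wt t x.
have cq x : Om x -> q y @[y --> x] --> q x.
  move=> Ox; apply: cvgB; last exact: cwtx.
  apply: cvgM; first exact: cvg_cst.
  by apply: cvgB; exact: cw.
have Q k : L1 mu Om (fun x => chi k x * q x ^+ 2) /\
    Rintegral mu Om (fun x => chi k x * q x ^+ 2) <= e ^+ 2.
  pose psi x := chi k x * q x.
  have cpsi x : Om x -> psi y @[y --> x] --> psi x.
    move=> Ox; apply: cvgM; last exact: cq.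
    exact: (c1_cont (test_c1 (tchi k)) I).
  have spsi : csupp Om psi by apply: csuppMl; exact: test_csupp (tchi k).
  have LM g : (forall x, Om x -> g y @[y --> x] --> (g x : R)) ->
      L1 mu Om (fun x => g x * psi x).
    move=> cg; apply: csupp_L1 => //; first by move=> x Ox; apply: cvgM; [exact: cg|exact: cpsi].
    have [K [cK KO psi0]] := spsi; exists K; split=> // x nKx; by rewrite psi0// mulr0.
  have Lq : L1 mu Om (fun x => chi k x * q x ^+ 2).
    by apply: (L1_eq mO _ (LM _ cq)) => x _; rewrite /psi; ring.
  split=> //.
  have L2psi : L2 mu Om psi.
    split; first exact: cont_measurable.
    by apply: (L1_eq mO _ (LM _ cpsi)) => x _; rewrite expr2.
  have D1 c : `|c - t| < r -> is_derive c (1 : R)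
      (fun s => Rintegral mu Om (fun x => w s x * psi x))
      (Rintegral mu Om (fun x => wt c x * psi x)).
    by move=> /Hr[cT _]; exact: integral_is_derive.
  have tr : `|t - t| < r by rewrite subrr normr0.
  have [c cr E] := MVT_ball D1 tr sr; have [cT [Lc nc]] := Hr c cr.
  have Lw u : 0 < u < T -> L1 mu Om (fun x => w u x * psi x).
    by move=> uT; apply: LM => x Ox; exact: cw.
  have Lwt u : 0 < u < T -> L1 mu Om (fun x => wt u x * psi x).
    by move=> uT; apply: LM => x Ox; exact: cwtx.
  have IQ : Rintegral mu Om (fun x => chi k x * q x ^+ 2) =
      Rintegral mu Om (fun x => (wt c x - wt t x) * psi x).
    have -> : Rintegral mu Om (fun x => chi k x * q x ^+ 2) =
        Rintegral mu Om (fun x => (s - t)^-1 * (w s x * psi x - w t x * psi x) - wt t x * psi x).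
      by apply: I_eq => x _; rewrite /psi /q; ring.
    have Ld := L1B mO (Lw s sT) (Lw t tT).
    rewrite (I_B mO (L1Z mO _ Ld) (Lwt t tT)) (I_Z mO _ Ld) (I_B mO (Lw s sT) (Lw t tT)).
    rewrite E mulrC mulfK// -(I_B mO (Lwt c cT) (Lwt t tT)).
    by apply: I_eq => x _; ring.
  set J := Rintegral _ _ _ in IQ *.
  have J0 : 0 <= J.
    apply: I_ge0 => x _; rewrite mulr_ge0 ?sqr_ge0//.
    by have /andP[] := chi01 k x.
  have J1 : J <= e * n2 mu Om psi.
    rewrite IQ; apply: le_trans (ler_norm _) _.
    have CS := Cauchy_Schwarz_L2 mO (L2B mO Lc Lwtt) L2psi.
    apply: (le_trans CS).
    by rewrite ler_wpM2r// n2_ge0.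
  (* As [chi ^+ 2 <= chi], the norm of the test function is controlled by the
     integral [J] itself, which can then be absorbed. *)
  have J2 : n2 mu Om psi ^+ 2 <= J.
    rewrite n2_sqr; apply: I_le => //; first exact: L2psi.2.
    move=> x _; have /andP[c0 c1'] := chi01 k x.
    rewrite /psi exprMn ler_wpM2r ?sqr_ge0// expr2 -[leRHS]mulr1.
    by rewrite ler_wpM2l.
  have N0 := n2_ge0 mu Om psi; move: (n2 mu Om psi) N0 J1 J2 => N N0 J1 J2.
  have [N00|Nn] := eqVneq N 0.
    by apply: le_trans J1 _; rewrite N00 mulr0 sqr_ge0.
  have Ne : N <= e.
    rewrite -(@ler_pM2r _ N) ?lt_neqAle ?N0 1?eq_sym ?Nn//.
    by rewrite -expr2; exact: le_trans J2 J1.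
  by apply: le_trans J1 _; rewrite expr2 ler_wpM2l// ltW.
have mchi k : measurable_fun Om (chi k).
  by apply: cont_measurable => // x _; exact: (c1_cont (test_c1 (tchi k)) I).
have chi0 k x : Om x -> 0 <= chi k x by move=> _; have /andP[] := chi01 k x.
have [L2q Iq] := L2_truncated mO (cont_measurable oO cq) mchi chi0 chi1
  (fun k => (Q k).1) (fun k => (Q k).2).
split.
  by apply: (L2_eq mO _ (L2D mO L2q Lwtt)) => x _; rewrite /q subrK.
by rewrite -(@ler_sqr _ (n2 _ _ _)) ?nnegrE ?n2_ge0 ?(ltW e0)// n2_sqr.
Qed.

End difference_quotients.

(** * Fields without boundary flux *)
Section divergence_theorem.
Context {R : realType} {n : nat}.
Local Notation mu := (lebesgue_rV n).
Local Notation V := 'rV[R]_n.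
Variables (Om : set V) (chi : nat -> V -> R).
Hypothesis oO : open Om.
Hypothesis tchi : forall k, test_function Om (chi k).
Hypothesis chi01 : forall k x, 0 <= chi k x <= 1.
Hypothesis chi1 : forall x, Om x -> chi k x @[k --> \oo] --> (1 : R).
Hypothesis chiF : forall F, no_flux Om F -> (forall i, L1 mu Om (F i)) ->
  Rintegral mu Om (fun x => \sum_i F i x * pderiv i (chi k) x) @[k --> \oo] --> (0 : R).
Let mO : measurable Om := open_measurable_rV oO.
Implicit Types (F G : 'I_n -> V -> R) (f g w : V -> R).

Lemma cvg_ext (S : Type) (G : set_system S) (u v : S -> R) (l : R) :
  (forall s, u s = v s) -> u s @[s --> G] --> l -> v s @[s --> G] --> l.
Proof. by move=> /funext ->. Qed.

(** The coefficients by which a field may be multiplied without creating flux.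
    Local boundedness suits gradients that extend continuously to the boundary
    of an unbounded domain. *)
Definition bounded_near_boundary w := forall p, boundary Om p ->
  exists M : R, \forall x \near within Om (nbhs p), `|w x| <= M.

Lemma bounded_bdry w (M : R) : (forall x, Om x -> `|w x| <= M) ->
  bounded_near_boundary w.
Proof.
move=> wM p _; exists M; have : nbhs p [set: V] by exact: filterT.
by apply: filterS => x _ Ox; exact: wM.
Qed.

Lemma bdryD f g : bounded_near_boundary f -> bounded_near_boundary g ->
  bounded_near_boundary (fun x => f x + g x).
Proof.
move=> Hf Hg p bp; have [M HM] := Hf p bp; have [K HK] := Hg p bp.
exists (M + K); apply: filterS2 HM HK => x a b.
by rewrite (le_trans (ler_normD _ _))// lerD.
Qed.

Lemma bdryM f g : bounded_near_boundary f -> bounded_near_boundary g ->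
  bounded_near_boundary (fun x => f x * g x).
Proof.
move=> Hf Hg p bp; have [M HM] := Hf p bp; have [K HK] := Hg p bp.
by exists (M * K); apply: filterS2 HM HK => x a b; rewrite normrM ler_pM.
Qed.

Lemma bdryZ (c : R) f : bounded_near_boundary f ->
  bounded_near_boundary (fun x => c * f x).
Proof. by apply: bdryM; apply: (@bounded_bdry _ `|c|). Qed.

Lemma bdryB f g : bounded_near_boundary f -> bounded_near_boundary g ->
  bounded_near_boundary (fun x => f x - g x).
Proof.
move=> Hf /(bdryZ (-1)) Hg p bp; have [M HM] := bdryD Hf Hg bp.
by exists M; apply: filterS HM => x; rewrite mulN1r.
Qed.

Lemma bdry_sum (J : Type) (r : seq J) (f : J -> V -> R) :
  (forall j, bounded_near_boundary (f j)) ->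
  bounded_near_boundary (fun x => \sum_(j <- r) f j x).
Proof.
move=> H; elim: r => [|j r IH].
  by under eq_fun do rewrite big_nil; apply: (@bounded_bdry _ 0) => x _; rewrite normr0.
by under eq_fun do rewrite big_cons; exact: bdryD.
Qed.

Lemma no_fluxD F G : no_flux Om F -> no_flux Om G ->
  no_flux Om (fun i x => F i x + G i x).
Proof.
move=> HF HG p g bp dg; have H : (\sum_i F i x * pderiv i g x) + (\sum_i G i x * pderiv i g x)
    @[x --> within Om (nbhs p)] --> (0 + 0 : R).
  by apply: cvgD; [exact: HF|exact: HG].
rewrite addr0 in H; apply: cvg_ext H => x.
by rewrite -big_split/=; apply: eq_bigr => i _; rewrite mulrDl.
Qed.

Lemma no_fluxM w F : bounded_near_boundary w -> no_flux Om F ->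
  no_flux Om (fun i x => w x * F i x).
Proof.
move=> Hw HF p g bp dg; have [M HM] := Hw p bp.
have M0 : 0 < `|M| + 1 by rewrite ltr_wpDl.
apply/cvgrPdist_le => e e0.
have eM : 0 < e / (`|M| + 1) by rewrite divr_gt0.
have /cvgrPdist_le/(_ _ eM) := HF p g bp dg; apply: filterS2 HM => x wM.
rewrite !sub0r !normrN => h.
rewrite (_ : \sum_i _ = w x * \sum_i F i x * pderiv i g x); last first.
  by rewrite mulr_sumr; apply: eq_bigr => i _; rewrite mulrA.
rewrite normrM (le_trans (ler_pM _ _ (_ : _ <= `|M| + 1) h))//.
  by rewrite (le_trans wM)// (le_trans (ler_norm _))// lerDl.
by rewrite mulrC divfK// gt_eqF.
Qed.

Lemma no_fluxB F G : no_flux Om F -> no_flux Om G ->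
  no_flux Om (fun i x => F i x - G i x).
Proof.
move=> HF HG; have HN := @no_fluxM (fun=> -1) _ (@bounded_bdry (fun=> -1) `|-1| (fun _ _ => lexx _)) HG.
have := no_fluxD HF HN; rewrite (_ : (fun i x => F i x + -1 * G i x) = (fun i x => F i x - G i x))//.
by apply/funext => i; apply/funext => x; rewrite mulN1r.
Qed.

Lemma no_fluxZ (c : R) F : no_flux Om F -> no_flux Om (fun i x => c * F i x).
Proof. by apply: no_fluxM; apply: (@bounded_bdry _ `|c|). Qed.

Lemma cvg_chi (h : V -> R) : L1 mu Om h ->
  Rintegral mu Om (fun x => chi k x * h x) @[k --> \oo] --> Rintegral mu Om h.
Proof.
move=> Lh; apply: (I_dominated mO _ _ _ (L1_norm Lh)).2.
- move=> k; have mh := L1_measurable Lh; apply: measurable_funM => //.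
  by apply: cont_measurable => // x _; exact: (c1_cont (test_c1 (tchi k)) I).
- move=> x Ox; have H := cvgM (chi1 Ox) (cvg_cst (h x)).
  by rewrite mul1r in H; exact: H.
- move=> k x _; have /andP[c0 c1] := chi01 k x.
  by rewrite normrM -[leRHS]mul1r ler_wpM2r// ger0_norm.
Qed.

(** The limit of [\int chi_k div F = - \int F . grad chi_k]. *)
Lemma no_flux_divergence F : (forall i, c1 Om (F i)) -> no_flux Om F ->
  (forall i, L1 mu Om (F i)) -> L1 mu Om (fun x => \sum_i pderiv i (F i) x) ->
  Rintegral mu Om (fun x => \sum_i pderiv i (F i) x) = 0.
Proof.
move=> cF nF LF LD; have H := cvg_chi LD.
have E k : Rintegral mu Om (fun x => chi k x * \sum_i pderiv i (F i) x) =
    - Rintegral mu Om (fun x => \sum_i F i x * pderiv i (chi k) x).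
  transitivity (Rintegral mu Om (fun x => \sum_i chi k x * pderiv i (F i) x)).
    by apply: I_eq => x _; rewrite mulr_sumr.
  have -> : Rintegral mu Om (fun x => \sum_i F i x * pderiv i (chi k) x) =
      Rintegral mu Om (fun x => \sum_i pderiv i (chi k) x * F i x).
    by apply: I_eq => x _; apply: eq_bigr => i _; rewrite mulrC.
  rewrite !I_sum//.
  - by rewrite -sumrN; apply: eq_bigr => i _; exact: test_by_parts.
  - by move=> i; apply: dtest_L1 => // x Ox; exact: c1_cont (cF i) Ox.
  - by move=> i; apply: test_L1 => // x Ox; exact: c1_pderiv_cont (cF i) Ox.
have H0 : Rintegral mu Om (fun x => chi k x * \sum_i pderiv i (F i) x) @[k --> \oo] --> (0 : R).
  have H0 : - Rintegral mu Om (fun x => \sum_i F i x * pderiv i (chi k) x)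
      @[k --> \oo] --> (- 0 : R) by apply: cvgN; exact: chiF.
  rewrite oppr0 in H0; apply: cvg_ext H0 => k.
  by rewrite E.
exact: (cvg_unique (@Rhausdorff R) H H0).
Qed.

(** The scalar factor, a finite sum, only has weak derivatives [w]: it is tested
    against [chi_k F], a test function although [F] is C^1 in [Om] only. *)
Lemma weak_no_flux_divergence (J : Type) (r : seq J) (f : J -> V -> R) (w : 'I_n -> J -> V -> R) F :
  (forall i, c1 Om (F i)) -> (forall i j, weak_pderiv Om i (f j) (w i j)) ->
  no_flux Om (fun i x => (\sum_(j <- r) f j x) * F i x) ->
  (forall j x, Om x -> f j y @[y --> x] --> f j x) ->
  (forall i, L1 mu Om (fun x => (\sum_(j <- r) f j x) * F i x)) ->
  L1 mu Om (fun x => (\sum_(j <- r) f j x) * \sum_i pderiv i (F i) x) ->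
  L1 mu Om (fun x => \sum_i (\sum_(j <- r) w i j x) * F i x) ->
  Rintegral mu Om (fun x => (\sum_(j <- r) f j x) * \sum_i pderiv i (F i) x) =
  - Rintegral mu Om (fun x => \sum_i (\sum_(j <- r) w i j x) * F i x).
Proof.
move=> cF W nF cf LF LD LW.
have tt k i := testM oO (tchi k) (cF i).
have Lf i k j : L1 mu Om (fun x => f j x * pderiv i (fun x => chi k x * F i x) x).
  have H := dtest_L1 i oO (tt k i) (cf j).
  by apply: (L1_eq mO _ H) => x _; rewrite mulrC.
have Lw i k j : L1 mu Om (fun x => w i j x * (chi k x * F i x)).
  have [_ lw _] := W i j; apply: (test_L1loc oO lw (test_csupp (tt k i))).
  by move=> x; exact: (c1_cont (test_c1 (tt k i)) I).
have dM i k x : Om x -> pderiv i (fun x => chi k x * F i x) x =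
    pderiv i (chi k) x * F i x + chi k x * pderiv i (F i) x.
  move=> Ox; apply: is_pder_val; apply: is_pderM; last exact: c1_pder (cF i) Ox.
  exact: pderivableP (((test_c1 (tchi k)) x I).2 i).1.
set fs := fun x => \sum_(j <- r) f j x in nF LF LD *.
have cfs x : Om x -> fs y @[y --> x] --> fs x.
  by move=> Ox; apply: cvg_sumr => j; exact: cf.
have LD0 k : L1 mu Om (fun x => chi k x * (fs x * \sum_i pderiv i (F i) x)).
  apply: (L1_bddM mO _ (M := 1) _ LD).
    by apply: cont_measurable => // x _; exact: (c1_cont (test_c1 (tchi k)) I).
  by move=> x _; have /andP[c0 c1] := chi01 k x; rewrite ger0_norm.
have LF0 k : L1 mu Om (fun x => \sum_i fs x * F i x * pderiv i (chi k) x).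
  apply: (L1_sum mO) => i.
  have cfF x : Om x -> fs y * F i y @[y --> x] --> fs x * F i x.
    by move=> Ox; apply: cvgM; [exact: cfs|exact: c1_cont (cF i) Ox].
  have H := dtest_L1 i oO (tchi k) cfF.
  by apply: (L1_eq mO _ H) => x _; rewrite mulrC.
have E k : Rintegral mu Om (fun x => chi k x * (fs x * \sum_i pderiv i (F i) x)) =
    - Rintegral mu Om (fun x => chi k x * \sum_i (\sum_(j <- r) w i j x) * F i x)
    - Rintegral mu Om (fun x => \sum_i fs x * F i x * pderiv i (chi k) x).
  have -> : Rintegral mu Om (fun x => chi k x * \sum_i (\sum_(j <- r) w i j x) * F i x) =
      Rintegral mu Om (fun x => \sum_i \sum_(j <- r) w i j x * (chi k x * F i x)).
    apply: I_eq => x _; rewrite mulr_sumr; apply: eq_bigr => i _.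
    by rewrite mulr_suml mulr_sumr; apply: eq_bigr => j _; ring.
  have L2' i : L1 mu Om (fun x => \sum_(j <- r) w i j x * (chi k x * F i x)).
    by apply: (L1_sum mO) => j; exact: Lw.
  rewrite (I_sum mO _ _ L2') -sumrN.
  have -> : \sum_i - Rintegral mu Om (fun x => \sum_(j <- r) w i j x * (chi k x * F i x)) =
      \sum_i Rintegral mu Om (fun x => \sum_(j <- r) f j x * pderiv i (fun x => chi k x * F i x) x).
    apply: eq_bigr => i _; rewrite (I_sum mO _ _ (Lw i k)) (I_sum mO _ _ (Lf i k)) -sumrN.
    by apply: eq_bigr => j _; rewrite (weak_I (W i j) (tt k i)).
  have L3 i : L1 mu Om (fun x => \sum_(j <- r) f j x * pderiv i (fun x => chi k x * F i x) x).
    by apply: (L1_sum mO) => j; exact: Lf.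
  rewrite -(I_sum mO _ _ L3) -(I_B mO (L1_sum mO _ _ L3) (LF0 k)).
  apply: I_eq => x Ox; rewrite /fs !mulr_sumr -sumrB; apply: eq_bigr => i _.
  by rewrite -!mulr_suml dM//; ring.
have H1 := cvg_chi LD.
have H2 : - Rintegral mu Om (fun x => chi k x * \sum_i (\sum_(j <- r) w i j x) * F i x)
    - Rintegral mu Om (fun x => \sum_i fs x * F i x * pderiv i (chi k) x) @[k --> \oo]
    --> (- Rintegral mu Om (fun x => \sum_i (\sum_(j <- r) w i j x) * F i x) - 0 : R).
  by apply: cvgB; [apply: cvgN; exact: cvg_chi|exact: chiF].
rewrite subr0 in H2.
have H3 : Rintegral mu Om (fun x => chi k x * (fs x * \sum_i pderiv i (F i) x)) @[k --> \oo] -->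
    - Rintegral mu Om (fun x => \sum_i (\sum_(j <- r) w i j x) * F i x).
  by apply: cvg_ext H2 => k; rewrite E.
exact: (cvg_unique (@Rhausdorff R) H1 H3).
Qed.

End divergence_theorem.

(** * The pointwise energy identity *)
Section energy_identity.
Variables (R : numFieldType) (n : nat).
Implicit Types (X Y y v : 'I_n -> R) (M : 'I_n -> 'I_n -> R).

Lemma symmetric_form M X Y : (forall i k, M k i = M i k) ->
  \sum_i X i * \sum_k M k i * Y k = \sum_i Y i * \sum_k X k * M k i.
Proof.
move=> sM; under eq_bigr do rewrite mulr_sumr; rewrite exchange_big/=.
by apply: eq_bigr => i _; rewrite mulr_sumr; apply: eq_bigr => k _; rewrite (sM k i); ring.
Qed.

(** The left-hand side pairs [X] and [v] with the antisymmetric part of the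
    Jacobian matrix [M + y v], so the symmetric [M] drops out. *)
Lemma curl_form M X y v : (forall i k, M k i = M i k) ->
  \sum_i X i * (\sum_k (M k i + y i * v k) * v k) -
  \sum_i (\sum_k X k * (M k i + y i * v k)) * v i =
  (\sum_i X i * y i) * (\sum_k v k * v k) - (\sum_i y i * v i) * (\sum_k X k * v k).
Proof.
move=> sM.
have -> : \sum_i X i * (\sum_k (M k i + y i * v k) * v k) =
    \sum_i X i * (\sum_k M k i * v k) + (\sum_i X i * y i) * (\sum_k v k * v k).
  rewrite mulr_suml -big_split; apply: eq_bigr => i _ /=.
  by rewrite -mulrA -mulrDr [y i * _]mulr_sumr -big_split; congr *%R; apply: eq_bigr => k _ /=; ring.
have -> : \sum_i (\sum_k X k * (M k i + y i * v k)) * v i =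
    \sum_i v i * (\sum_k X k * M k i) + (\sum_i y i * v i) * (\sum_k X k * v k).
  rewrite mulr_suml -big_split; apply: eq_bigr => i _ /=.
  rewrite mulrC -mulrA (mulrCA (y i)) -mulrDr [y i * _]mulr_sumr -big_split.
  by congr *%R; apply: eq_bigr => k _ /=; ring.
by rewrite (symmetric_form _ _ sM); ring.
Qed.

Variables (e a b rho at_ bt : R).
Variables (da db v drho : 'I_n -> R) (dda ddb dv : 'I_n -> 'I_n -> R).
Hypothesis e0 : e != 0.
Hypothesis sdda : forall i k, dda k i = dda i k.
Hypothesis sddb : forall i k, ddb k i = ddb i k.
Hypothesis sdv : forall i k, dv k i = dv i k.
Let m := a ^+ 2 + b ^+ 2.
Let N := m - rho.
Hypothesis eqa : - e * bt + e ^+ 2 / 2 * \sum_i dda i i = (m - 1) * a.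
Hypothesis eqb : e * at_ + e ^+ 2 / 2 * \sum_i ddb i i = (m - 1) * b.
Let A i := e * da i + b * v i.
Let B i := e * db i - a * v i.
Let dA k i := e * dda k i + (db i * v k + b * dv k i).
Let dB k i := e * ddb k i - (da i * v k + a * dv k i).
Let phit := 1 - rho - (\sum_k v k ^+ 2) / 2.
Let vt i := - drho i - \sum_k v k * dv k i.
Let rhot := - \sum_i (drho i * v i + rho * dv i i).
Let dN i := 2 * (a * da i + b * db i) - drho i.
(** The derivative along [i] of the [i]-th component of the current
    [a B - b A]; [dQ i] is that of the energy flux. *)
Let dP i := (da i * B i + a * dB i i) - (db i * A i + b * dA i i).
Let dQ i := - (vt i * (a * B i - b * A i) + phit * dP i)
  + (dA i i * (\sum_k A k * v k) + A i * \sum_k (dA k i * v k + A k * dv k i))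
  + (dB i i * (\sum_k B k * v k) + B i * \sum_k (dB k i * v k + B k * dv k i))
  - ((\sum_k (A k * dA k i + B k * dB k i) + N * dN i) * v i
     + (\sum_k (A k ^+ 2 + B k ^+ 2) + N ^+ 2) / 2 * dv i i).

Let Av := \sum_i A i * v i.
Let Bv := \sum_i B i * v i.
Let vv := \sum_i v i * v i.
Let D := \sum_i dv i i.
Let s1 := \sum_i da i * v i.
Let s2 := \sum_i db i * v i.
Let dr := \sum_i drho i * v i.
Let X := \sum_i A i * db i - \sum_i B i * da i.
Let E := \sum_i (A i ^+ 2 + B i ^+ 2).
Let F := \sum_i \sum_k (A i * A k + B i * B k) * dv i k.
Let Aa := \sum_i vt i * A i.
Let Bb := \sum_i vt i * B i.

Let divA : \sum_i dA i i = e * (\sum_i dda i i) + s2 + b * D.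
Proof. by rewrite !mulr_sumr -!big_split; apply: eq_bigr => i _ /=; rewrite /dA addrA. Qed.

Let divB : \sum_i dB i i = e * (\sum_i ddb i i) - s1 - a * D.
Proof.
by rewrite !mulr_sumr -!sumrN -!big_split; apply: eq_bigr => i _ /=; rewrite /dB; ring.
Qed.

Let divP : \sum_i dP i = a * (\sum_i dB i i) - b * (\sum_i dA i i) - X.
Proof.
rewrite /X opprB !mulr_sumr -!sumrN -!big_split; apply: eq_bigr => i _ /=.
by rewrite /dP; ring.
Qed.

Let curlA : \sum_i A i * (\sum_k dA k i * v k) - \sum_i (\sum_k A k * dA k i) * v i =
  (\sum_i A i * db i) * vv - s2 * Av.
Proof.
rewrite -(@curl_form (fun k i => e * dda k i + b * dv k i)); last by move=> i k; rewrite sdda sdv.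
congr (_ - _); apply: eq_bigr => i _.
  by congr *%R; apply: eq_bigr => k _; rewrite /dA; ring.
by congr *%R; apply: eq_bigr => k _; rewrite /dA; ring.
Qed.

Let curlB : \sum_i B i * (\sum_k dB k i * v k) - \sum_i (\sum_k B k * dB k i) * v i =
  - (\sum_i B i * da i) * vv + s1 * Bv.
Proof.
have -> : - (\sum_i B i * da i) * vv + s1 * Bv =
    (\sum_i B i * (- da i)) * vv - (\sum_i - da i * v i) * Bv.
  congr (_ * _ + _); first by rewrite -sumrN; apply: eq_bigr => i _; rewrite mulrN.
  by rewrite -mulNr -sumrN; congr (_ * _); apply: eq_bigr => i _; rewrite mulNr opprK.
rewrite -(@curl_form (fun k i => e * ddb k i - a * dv k i)); last by move=> i k; rewrite sddb sdv.
congr (_ - _); apply: eq_bigr => i _.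
  by congr *%R; apply: eq_bigr => k _; rewrite /dB; ring.
by congr *%R; apply: eq_bigr => k _; rewrite /dB; ring.
Qed.

Let divQ : \sum_i dQ i = - (a * Bb - b * Aa) - phit * (\sum_i dP i)
  + (\sum_i dA i i) * Av + (\sum_i dB i i) * Bv + F + X * vv - s2 * Av + s1 * Bv
  - N * (2 * (a * s1 + b * s2) - dr) - (E + N ^+ 2) / 2 * D.
Proof.
have split_dQ i : dQ i = - (vt i * (a * B i - b * A i)) - phit * dP i
  + dA i i * Av + dB i i * Bv + \sum_k (A i * A k + B i * B k) * dv i k
  + (A i * (\sum_k dA k i * v k) - (\sum_k A k * dA k i) * v i)
  + (B i * (\sum_k dB k i * v k) - (\sum_k B k * dB k i) * v i)
  - N * (2 * (a * (da i * v i) + b * (db i * v i)) - drho i * v i)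
  - (E + N ^+ 2) / 2 * dv i i.
  have F1 : \sum_k (dA k i * v k + A k * dv k i) =
      \sum_k dA k i * v k + \sum_k A k * dv i k.
    by rewrite -big_split; apply: eq_bigr => k _ /=; rewrite (sdv i k).
  have F2 : \sum_k (dB k i * v k + B k * dv k i) =
      \sum_k dB k i * v k + \sum_k B k * dv i k.
    by rewrite -big_split; apply: eq_bigr => k _ /=; rewrite (sdv i k).
  have F3 : \sum_k (A i * A k + B i * B k) * dv i k =
      A i * (\sum_k A k * dv i k) + B i * (\sum_k B k * dv i k).
    by rewrite !mulr_sumr -big_split; apply: eq_bigr => k _ /=; ring.
  have F4 : \sum_k (A k * dA k i + B k * dB k i) =
      \sum_k A k * dA k i + \sum_k B k * dB k i.
    by rewrite -big_split.
  rewrite /dQ F1 F2 F3 F4 /dN -/Av -/Bv -/E; ring.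
rewrite (eq_bigr _ (fun i _ => split_dQ i)) !big_split /= !sumrN.
rewrite -!mulr_suml -!mulr_sumr !big_split /= !sumrN curlA curlB.
rewrite !big_split /= -!mulr_sumr !big_split /= -!mulr_sumr.
have -> : \sum_i vt i * (a * B i - b * A i) = a * Bb - b * Aa.
  by rewrite !mulr_sumr -sumrB; apply: eq_bigr => i _; ring.
rewrite !sumrN !big_split /= -!mulr_sumr -/F -/D -/s1 -/s2 -/dr /X; ring.
Qed.

(** All values are taken at one point, so the identity is algebraic: the field
    derivatives are independent unknowns tied by the two wave equations and by
    the symmetry of the second derivatives. After summation both sides are
    rational expressions in a few scalar products. *)
Lemma energy_density_identity :
  - e * at_ * (\sum_i dA i i) + \sum_i A i * (bt * v i) + \sum_i A i * (b * vt i)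
  - e * bt * (\sum_i dB i i) - \sum_i B i * (at_ * v i) - \sum_i B i * (a * vt i)
  + N * (2 * a * at_ + 2 * b * bt - rhot) =
  - F - N ^+ 2 / 2 * D
  + e ^+ 2 / 4 * (D * \sum_i (2 * (da i ^+ 2 + db i ^+ 2 + a * dda i i + b * ddb i i)))
  + \sum_i dQ i.
Proof.
have r1 : \sum_i A i * (bt * v i) = bt * Av.
  by rewrite mulr_sumr; apply: eq_bigr => i _; rewrite mulrCA.
have r2 : \sum_i B i * (at_ * v i) = at_ * Bv.
  by rewrite mulr_sumr; apply: eq_bigr => i _; rewrite mulrCA.
have r3 : \sum_i A i * (b * vt i) = b * Aa.
  by rewrite mulr_sumr; apply: eq_bigr => i _; ring.
have r4 : \sum_i B i * (a * vt i) = a * Bb.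
  by rewrite mulr_sumr; apply: eq_bigr => i _; ring.
have r5 : rhot = - (dr + rho * D) by rewrite /rhot big_split mulr_sumr.
(* The gradients of [a] and [b] are eliminated in favour of [A], [B] and [v]. *)
have r6 : e * s1 = Av - b * vv.
  by rewrite !mulr_sumr -sumrB; apply: eq_bigr => i _; rewrite /A; ring.
have r7 : e * s2 = Bv + a * vv.
  by rewrite !mulr_sumr -big_split; apply: eq_bigr => i _ /=; rewrite /B; ring.
have r8 : e * X = a * Av + b * Bv.
  by rewrite mulrBr !mulr_sumr -sumrB -big_split; apply: eq_bigr => i _ /=; rewrite /A /B; ring.
have r9 : e ^+ 2 * \sum_i (2 * (da i ^+ 2 + db i ^+ 2 + a * dda i i + b * ddb i i)) =
   2 * (E - 2 * b * Av + 2 * a * Bv + m * vv + e ^+ 2 * a * (\sum_i dda i i)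
        + e ^+ 2 * b * (\sum_i ddb i i)).
  rewrite !mulr_sumr -!sumrN -!big_split !mulr_sumr; apply: eq_bigr => i _ /=.
  by rewrite /A /B /m; ring.
have r10 : phit = 1 - rho - vv / 2.
  by congr (_ - _ / _); apply: eq_bigr => k _; rewrite expr2.
rewrite divQ divP divA divB r1 r2 r3 r4 r5 r10.
have Ee : e ^+ 2 != 0 by rewrite expf_neq0.
have La : \sum_i dda i i = 2 / e ^+ 2 * ((m - 1) * a + e * bt).
  by rewrite -eqa; field; rewrite e0 ?pnatr_eq0.
have Lb : \sum_i ddb i i = 2 / e ^+ 2 * ((m - 1) * b - e * at_).
  by rewrite -eqb; field; rewrite e0 ?pnatr_eq0.
have e4 : e ^+ 2 / 4 * (D * \sum_i (2 * (da i ^+ 2 + db i ^+ 2 + a * dda i i + b * ddb i i))) =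
  D / 4 * (2 * (E - 2 * b * Av + 2 * a * Bv + m * vv + e ^+ 2 * a * (\sum_i dda i i)
        + e ^+ 2 * b * (\sum_i ddb i i))) by rewrite -r9; ring.
rewrite e4 La Lb.
have -> : s1 = (Av - b * vv) / e by rewrite -r6 mulrAC mulfV ?mul1r.
have -> : s2 = (Bv + a * vv) / e by rewrite -r7 mulrAC mulfV ?mul1r.
have -> : X = (a * Av + b * Bv) / e by rewrite -r8 mulrAC mulfV ?mul1r.
rewrite /N /m.
generalize Av Bv vv D dr E F Aa Bb => Av' Bv' vv' D' dr' E' F' Aa' Bb'.
by field; rewrite e0 ?pnatr_eq0.
Qed.

End energy_identity.

(** * Derivatives of the half energies *)
Section energy_derivative.
Context {R : realType} {n : nat}.
Local Notation mu := (lebesgue_rV n).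
Local Notation V := 'rV[R]_n.
Local Notation near_t T t := (within `[0, T]%classic (nbhs (t : R))).
Implicit Types (Om : set V) (T : R).

Record exhausting Om (chi : nat -> V -> R) : Prop := Exhausting {
  ex_test : forall k, test_function Om (chi k);
  ex_01 : forall k x, 0 <= chi k x <= 1;
  ex_1 : forall x, Om x -> chi k x @[k --> \oo] --> (1 : R);
  ex_flux : forall F, no_flux Om F -> (forall i, L1 mu Om (F i)) ->
    Rintegral mu Om (fun x => \sum_i F i x * pderiv i (chi k) x) @[k --> \oo] --> (0 : R) }.

(** The regularity that the real and the imaginary part of the wave share, with
    the time continuity of the norms unfolded into convergences. *)
Record component Om T (f ft : R -> V -> R) : Prop := Component {
  cp_c1 : forall t, 0 <= t <= T -> c1 Om (f t);
  cp_c1d : forall i t, 0 <= t <= T -> c1 Om (pderiv i (f t));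
  cp_oo : forall t, 0 <= t <= T -> convoo Om (near_t T t) f (f t);
  cp_d : forall i t, 0 <= t <= T ->
    conv2 mu Om (near_t T t) (fun s => pderiv i (f s)) (pderiv i (f t));
  cp_dd : forall i t, 0 <= t <= T ->
    conv2 mu Om (near_t T t) (fun s => pderiv i (pderiv i (f s))) (pderiv i (pderiv i (f t)));
  cp_nf : forall t, 0 <= t <= T -> no_flux Om (fun i => pderiv i (f t));
  cp_bn : forall i t, 0 <= t <= T -> bounded_near_boundary Om (pderiv i (f t));
  cp_t : forall t x, 0 < t < T -> Om x -> is_derive t (1 : R) (f^~ x) (ft t x);
  cp_jt : jointly_continuous `]0, T[%classic Om ft }.

(** The time derivatives of the density and of the velocity that the continuity
    equation and the gradient of the Bernoulli equation prescribe. *)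
Definition rhot (rho : R -> V -> R) (v : 'I_n -> R -> V -> R) (t : R) (x : V) :=
  - \sum_i (pderiv i (rho t) x * v i t x + rho t x * pderiv i (v i t) x).
Definition vt (rho : R -> V -> R) (v : 'I_n -> R -> V -> R) (i : 'I_n) (t : R) (x : V) :=
  - pderiv i (rho t) x - \sum_k v k t x * pderiv i (v k t) x.

(** The velocity is abstracted from its potential: only the symmetry of its
    Jacobian matrix remains. *)
Record limit_flow Om T (rho : R -> V -> R) (v : 'I_n -> R -> V -> R) : Prop := LimitFlow {
  lf_rho : forall t, 0 <= t <= T -> c1 Om (rho t);
  lf_rhooo : forall t, 0 <= t <= T -> convoo Om (near_t T t) rho (rho t);
  lf_drho : forall i t, 0 <= t <= T ->
    conv2 mu Om (near_t T t) (fun s => pderiv i (rho s)) (pderiv i (rho t));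
  lf_rho1 : forall t, 0 <= t <= T ->
    conv2 mu Om (near_t T t) (fun s x => rho s x - 1) (fun x => rho t x - 1);
  lf_c1 : forall i t, 0 <= t <= T -> c1 Om (v i t);
  lf_sym : forall i j t x, 0 <= t <= T -> Om x -> pderiv j (v i t) x = pderiv i (v j t) x;
  lf_oo : forall i t, 0 <= t <= T -> convoo Om (near_t T t) (v i) (v i t);
  lf_doo : forall i j t, 0 <= t <= T ->
    convoo Om (near_t T t) (fun s => pderiv j (v i s)) (pderiv j (v i t));
  lf_2 : forall i t, 0 <= t <= T -> conv2 mu Om (near_t T t) (v i) (v i t);
  lf_d2 : forall i j t, 0 <= t <= T ->
    conv2 mu Om (near_t T t) (fun s => pderiv j (v i s)) (pderiv j (v i t));
  lf_nf : forall t, 0 <= t <= T -> no_flux Om (fun i => v i t);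
  lf_rhot : forall t x, 0 < t < T -> Om x -> is_derive t (1 : R) (rho^~ x) (rhot rho v t x);
  lf_vt : forall i t x, 0 < t < T -> Om x -> is_derive t (1 : R) ((v i)^~ x) (vt rho v i t x);
  lf_jrhot : jointly_continuous `]0, T[%classic Om (rhot rho v);
  lf_jvt : forall i, jointly_continuous `]0, T[%classic Om (vt rho v i) }.

Variables (Om : set V) (chi : nat -> V -> R) (T : R).
Hypothesis oO : open Om.
Hypothesis ex : exhausting Om chi.
Let mO : measurable Om := open_measurable_rV oO.

Lemma near_t_interior t (P : set R) : 0 < t < T -> near_t T t P -> nbhs t P.
Proof.
move=> tT H; apply: filterS2 (near_itvoo tT) H => s /andP[s0 sT]; apply.
by rewrite /= in_itv/= !ltW.
Qed.

Lemma ltW_itv t : 0 < t < T -> 0 <= t <= T.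
Proof. by move=> /andP[t0 tT]; rewrite !ltW. Qed.

Lemma near_t_dnbhs t (P : set R) : 0 < t < T -> near_t T t P -> t^' P.
Proof. by move=> tT /(near_t_interior tT); exact: nbhs_dnbhs. Qed.

Lemma conv2_sub (F G : set_system R) (p : R -> V -> R) f : (forall P, F P -> G P) ->
  conv2 mu Om F p f -> conv2 mu Om G p f.
Proof. by move=> FG [Lf H]; split=> // e /H/FG. Qed.

Lemma convoo_sub (F G : set_system R) (p : R -> V -> R) f : (forall P, F P -> G P) ->
  convoo Om F p f -> convoo Om G p f.
Proof. by move=> FG [mf bf H]; split=> // e /H/FG. Qed.

Lemma convoo_at (F : set_system R) (FF : Filter F) (p : R -> V -> R) f :
  convoo Om F p f -> convoo Om F (fun=> f) f.
Proof. by move=> [mf [M fM] _]; exact: convoo_cst mf fM. Qed.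

Lemma conv2Ml (F : set_system R) (FF : Filter F) (p q : R -> V -> R) f g :
  convoo Om F p f -> conv2 mu Om F q g ->
  conv2 mu Om F (fun s x => p s x * q s x) (fun x => f x * g x).
Proof.
move=> Hp Hq; apply: (conv2_eq mO _ _ (conv2M mO Hq Hp)).
  by apply: nearW => s x _; rewrite mulrC.
by move=> x _; rewrite mulrC.
Qed.

Lemma quotient_conv (w wt : R -> V -> R) t :
  (forall s x, 0 < s < T -> Om x -> is_derive s (1 : R) (w^~ x) (wt s x)) ->
  jointly_continuous `]0, T[%classic Om wt ->
  (forall s, 0 <= s <= T -> c1 Om (w s)) -> 0 < t < T ->
  conv2 mu Om (near_t T t) wt (wt t) ->
  conv2 mu Om t^' (fun s x => (s - t)^-1 * (w s x - w t x)) (wt t).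
Proof.
move=> dw jw cw tT lw.
apply: (@quotient_conv2 _ _ Om chi T oO (ex_test ex) (ex_01 ex) (ex_1 ex)) => //.
- by move=> s x sT Ox; exact: c1_cont (cw s (ltW_itv sT)) Ox.
- move=> s x sT Ox; apply/cvgrPdist_le => e e0.
  have [A [B [nA nB AB]]] := jointly_continuous_local oO jw sT Ox e0.
  by apply: filterS nB => y; apply: AB; exact: nbhs_singleton.
- by apply: conv2_sub lw => P; exact: near_t_interior.
Qed.

Lemma green (q : V -> R) (P : 'I_n -> V -> R) (M : R) :
  c1 Om q -> (forall i, c1 Om (P i)) -> (forall x, Om x -> `|q x| <= M) ->
  no_flux Om P -> L2 mu Om q -> (forall i, L2 mu Om (pderiv i q)) ->
  (forall i, L2 mu Om (P i)) -> L2 mu Om (fun x => \sum_i pderiv i (P i) x) ->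
  Rintegral mu Om (fun x => \sum_i P i x * pderiv i q x) =
  - Rintegral mu Om (fun x => q x * \sum_i pderiv i (P i) x).
Proof.
move=> cq cP qM nP Lq Ldq LP LdP.
have La : L1 mu Om (fun x => \sum_i P i x * pderiv i q x).
  by apply: (L1_sum mO) => i; exact: (L2M mO (LP i) (Ldq i)).
have Lb := L2M mO Lq LdP.
have dF x : Om x -> \sum_i pderiv i (fun y => q y * P i y) x =
    \sum_i P i x * pderiv i q x + q x * \sum_i pderiv i (P i) x.
  move=> Ox; rewrite mulr_sumr -big_split; apply: eq_bigr => i _ /=.
  rewrite (is_pder_val (is_pderM (c1_pder _ cq Ox) (c1_pder _ (cP i) Ox))).
  by rewrite [P i x * _]mulrC.
have LD : L1 mu Om (fun x => \sum_i pderiv i (fun y => q y * P i y) x).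
  by apply: (L1_eq mO _ (L1D mO La Lb)) => x Ox; rewrite dF.
have cF i : c1 Om (fun x => q x * P i x) by exact: (c1M oO cq (cP i)).
have nF := no_fluxM (bounded_bdry qM) nP.
have LF i := L2M mO Lq (LP i).
have Z := no_flux_divergence oO (ex_test ex) (ex_01 ex) (ex_1 ex) (@ex_flux _ _ ex) cF nF LF LD.
apply/eqP; rewrite -subr_eq0 opprK -(I_D mO La Lb); apply/eqP; rewrite -[RHS]Z.
by apply: I_eq => x Ox; rewrite dF.
Qed.

Section half_energy.
Variables (eps c : R) (rho : R -> V -> R) (v : 'I_n -> R -> V -> R) (f ft g gt : R -> V -> R).
Hypothesis lf : limit_flow Om T rho v.
Hypotheses (cf : component Om T f ft) (cg : component Om T g gt).

(** The sign [c] is 1 for the real part ([f = a], [g = b]) and -1 for the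
    imaginary part ([f = b], [g = a]) of the modulated gradient. *)
Definition modulated (i : 'I_n) (t : R) (x : V) :=
  eps * pderiv i (f t) x + c * (g t x * v i t x).
Definition dmodulated (i j : 'I_n) (t : R) (x : V) :=
  eps * pderiv j (pderiv i (f t)) x +
  c * (pderiv j (g t) x * v i t x + g t x * pderiv j (v i t) x).
Local Notation P := modulated.
Local Notation dP := dmodulated.

Lemma modulated_c1 i t : 0 <= t <= T -> c1 Om (P i t).
Proof.
move=> tT; apply: (c1D oO (c1Z eps oO (cp_c1d cf i tT))).
exact: (c1Z c oO (c1M oO (cp_c1 cg tT) (lf_c1 lf i tT))).
Qed.

Lemma modulated_pder i j t x : 0 <= t <= T -> Om x -> pderiv j (P i t) x = dP i j t x.
Proof.
move=> tT Ox; apply: is_pder_val.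
apply: (is_pderD (is_pderZ eps (c1_pder _ (cp_c1d cf i tT) Ox))).
exact: (is_pderZ c (is_pderM (c1_pder _ (cp_c1 cg tT) Ox) (c1_pder _ (lf_c1 lf i tT) Ox))).
Qed.

Lemma modulated_conv i t : 0 <= t <= T -> conv2 mu Om (near_t T t) (P i) (P i t).
Proof.
move=> tT; apply: (conv2D mO (conv2Z mO eps (cp_d cf i tT))).
exact: (conv2Z mO c (conv2Ml _ (cp_oo cg tT) (lf_2 lf i tT))).
Qed.

Lemma dmodulated_conv i t : 0 <= t <= T -> conv2 mu Om (near_t T t) (dP i i) (dP i i t).
Proof.
move=> tT; apply: (conv2D mO (conv2Z mO eps (cp_dd cf i tT))).
apply: (conv2Z mO c).
apply: (conv2D mO (conv2M mO (cp_d cg i tT) (lf_oo lf i tT))).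
exact: (conv2Ml _ (cp_oo cg tT) (lf_d2 lf i i tT)).
Qed.

Lemma convoo_bound t w : convoo Om (near_t T t) w (w t) ->
  exists M : R, forall x, Om x -> `|w t x| <= M.
Proof. by case. Qed.

Lemma modulated_no_flux t : 0 <= t <= T -> no_flux Om (fun i => P i t).
Proof.
move=> tT; apply: no_fluxD; first exact: no_fluxZ (cp_nf cf tT).
apply: no_fluxZ; apply: no_fluxM; last exact: (lf_nf lf tT).
have [M HM] := convoo_bound (cp_oo cg tT); exact: bounded_bdry HM.
Qed.

Definition half_energy (t : R) := Rintegral mu Om (fun x => \sum_i P i t x ^+ 2) / 2.

(** A difference of squares is twice the midpoint times the increment. The part
    [eps grad (f s - f t)] of the increment has no limit quotient; Green's formula
    moves its gradient to the midpoint, which has no boundary flux. *)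
Lemma half_energy_quotient (s t : R) : 0 <= s <= T -> 0 <= t <= T -> s != t ->
  L2 mu Om (fun x => (s - t)^-1 * (f s x - f t x)) ->
  L2 mu Om (fun x => (s - t)^-1 * (g s x - g t x)) ->
  (s - t)^-1 * (half_energy s - half_energy t) =
  - eps * Rintegral mu Om (fun x => (s - t)^-1 * (f s x - f t x) *
            \sum_i (dP i i s x + dP i i t x) / 2)
  + \sum_i Rintegral mu Om (fun x => (P i s x + P i t x) / 2 *
      (c * ((s - t)^-1 * (g s x - g t x) * v i t x +
            g s x * ((s - t)^-1 * (v i s x - v i t x))))).
Proof.
move=> sT tT st Lqf Lqg; set k := (s - t)^-1 in Lqf Lqg *.
have LP i u : 0 <= u <= T -> L2 mu Om (P i u).
  by move=> uT; exact: conv2_L2 (modulated_conv i uT).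
have LPm i : L2 mu Om (fun x => (P i s x + P i t x) / 2).
  by apply: (L2_eq mO _ (L2Z mO 2^-1 (L2D mO (LP i s sT) (LP i t tT)))) => x _; rewrite mulrC.
have Ldf i u : 0 <= u <= T -> L2 mu Om (pderiv i (f u)).
  by move=> uT; exact: conv2_L2 (cp_d cf i uT).
have Ldq i := L2Z mO k (L2B mO (Ldf i s sT) (Ldf i t tT)).
have [Mv HMv] : exists M : R, forall i x, Om x -> `|v i t x| <= M.
  have /choice[M HM] : forall i, exists M : R, forall x, Om x -> `|v i t x| <= M.
    by move=> i; exact: convoo_bound (lf_oo lf i tT).
  exists (\sum_i `|M i|) => i x Ox; rewrite (le_trans (HM i x Ox))//.
  by rewrite (le_trans (ler_norm _))// (bigD1 i)//= lerDl sumr_ge0.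
have mv i : measurable_fun Om (v i t) by have [] := lf_oo lf i tT.
have [Mg HMg] := convoo_bound (cp_oo cg sT).
have mg : measurable_fun Om (g s) by have [] := cp_oo cg sT.
have Lqgv i : L2 mu Om (fun x => k * (g s x - g t x) * v i t x).
  by apply: (L2_eq mO _ (L2_bddM mO (mv i) (HMv i) Lqg)) => x _; rewrite mulrC.
have Lv i u : 0 <= u <= T -> L2 mu Om (v i u).
  by move=> uT; exact: conv2_L2 (lf_2 lf i uT).
have Lgqv i := L2_bddM mO mg HMg (L2Z mO k (L2B mO (Lv i s sT) (Lv i t tT))).
have LR i := L2Z mO c (L2D mO (Lqgv i) (Lgqv i)).
have LE u : 0 <= u <= T -> L1 mu Om (fun x => \sum_i P i u x ^+ 2).
  by move=> uT; apply: (L1_sum mO) => i; exact: (LP i u uT).2.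
have cq : c1 Om (fun x => k * (f s x - f t x)).
  exact: (c1Z k oO (c1B oO (cp_c1 cf sT) (cp_c1 cf tT))).
have dq i x : Om x -> pderiv i (fun x => k * (f s x - f t x)) x =
    k * (pderiv i (f s) x - pderiv i (f t) x).
  move=> Ox; apply: is_pder_val; apply: is_pderZ.
  exact: (is_pderB (c1_pder _ (cp_c1 cf sT) Ox) (c1_pder _ (cp_c1 cf tT) Ox)).
have cPm i : c1 Om (fun x => (P i s x + P i t x) / 2).
  have := c1Z 2^-1 oO (c1D oO (modulated_c1 i sT) (modulated_c1 i tT)).
  by apply: (c1_near oO) => x _; rewrite mulrC.
have dPm i x : Om x -> pderiv i (fun x => (P i s x + P i t x) / 2) x =
    (dP i i s x + dP i i t x) / 2.
  move=> Ox; rewrite [RHS]mulrC -(modulated_pder i i sT Ox) -(modulated_pder i i tT Ox).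
  rewrite (_ : (fun x => (P i s x + P i t x) / 2) = (fun x => 2^-1 * (P i s x + P i t x))); last first.
    by apply/funext => y; rewrite mulrC.
  apply: is_pder_val; apply: is_pderZ.
  exact: (is_pderD (c1_pder _ (modulated_c1 i sT) Ox) (c1_pder _ (modulated_c1 i tT) Ox)).
have nPm : no_flux Om (fun i x => (P i s x + P i t x) / 2).
  have := no_fluxZ 2^-1 (no_fluxD (modulated_no_flux sT) (modulated_no_flux tT)).
  rewrite (_ : (fun i x => 2^-1 * _) = (fun i x => (P i s x + P i t x) / 2))//.
  by apply/funext => i; apply/funext => y; rewrite mulrC.
have [Mq HMq] : exists M : R, forall x, Om x -> `|k * (f s x - f t x)| <= M.
  have [M1 H1] := convoo_bound (cp_oo cf sT); have [M2 H2] := convoo_bound (cp_oo cf tT).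
  exists (`|k| * (M1 + M2)) => x Ox; rewrite normrM ler_wpM2l// (le_trans (ler_normB _ _))//.
  by rewrite lerD ?H1 ?H2.
have Ldq' i : L2 mu Om (pderiv i (fun x => k * (f s x - f t x))).
  by apply: (L2_eq mO _ (Ldq i)) => x Ox; rewrite dq.
have LdPm : L2 mu Om (fun x => \sum_i pderiv i (fun x => (P i s x + P i t x) / 2) x).
  have Ld i u : 0 <= u <= T -> L2 mu Om (dP i i u).
    by move=> uT; exact: conv2_L2 (dmodulated_conv i uT).
  have := L2_sum mO (index_enum 'I_n) xpredT (fun i => L2Z mO 2^-1 (L2D mO (Ld i s sT) (Ld i t tT))).
  by apply: (L2_eq mO) => x Ox; apply: eq_bigr => i _; rewrite dPm// mulrC.
have G := green cq cPm HMq nPm Lqf Ldq' LPm LdPm.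
have -> : Rintegral mu Om (fun x => k * (f s x - f t x) * \sum_i (dP i i s x + dP i i t x) / 2) =
    Rintegral mu Om (fun x => k * (f s x - f t x) * \sum_i pderiv i (fun x => (P i s x + P i t x) / 2) x).
  by apply: I_eq => x Ox; congr *%R; apply: eq_bigr => i _; rewrite dPm.
rewrite mulNr -mulrN -G.
have LL1 : L1 mu Om (fun x => \sum_i (P i s x + P i t x) / 2 * pderiv i (fun x => k * (f s x - f t x)) x).
  by apply: (L1_sum mO) => i; exact: (L2M mO (LPm i) (Ldq' i)).
have LL2 i := L2M mO (LPm i) (LR i).
rewrite -(I_Z mO _ LL1) -(I_sum mO _ _ LL2) -(I_D mO (L1Z mO eps LL1) (L1_sum mO _ _ LL2)).
rewrite /half_energy -mulrBl -(I_B mO (LE s sT) (LE t tT)) mulrA mulrAC.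
rewrite -(I_Z mO _ (L1B mO (LE s sT) (LE t tT))).
apply: I_eq => x Ox; rewrite -sumrB !mulr_sumr -big_split; apply: eq_bigr => i _ /=.
by rewrite dq// /modulated; field.
Qed.

Lemma half_energy_limit t : 0 < t < T ->
  conv2 mu Om t^' (fun s x => (s - t)^-1 * (f s x - f t x)) (ft t) ->
  conv2 mu Om t^' (fun s x => (s - t)^-1 * (g s x - g t x)) (gt t) ->
  (forall i, conv2 mu Om t^' (fun s x => (s - t)^-1 * (v i s x - v i t x)) (vt rho v i t)) ->
  (s - t)^-1 * (half_energy s - half_energy t) @[s --> t^'] -->
  - eps * Rintegral mu Om (fun x => ft t x * \sum_i dP i i t x)
  + \sum_i Rintegral mu Om (fun x => P i t x *
      (c * (gt t x * v i t x + g t x * vt rho v i t x))).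
Proof.
move=> tT qf qg qv; have tT' := ltW_itv tT.
have sub : forall Q, near_t T t Q -> t^' Q by move=> Q; exact: near_t_dnbhs.
have E : \forall s \near t^', - eps * Rintegral mu Om (fun x => (s - t)^-1 * (f s x - f t x) *
            \sum_i (dP i i s x + dP i i t x) / 2)
  + \sum_i Rintegral mu Om (fun x => (P i s x + P i t x) / 2 *
      (c * ((s - t)^-1 * (g s x - g t x) * v i t x +
            g s x * ((s - t)^-1 * (v i s x - v i t x))))) =
  (s - t)^-1 * (half_energy s - half_energy t).
  have N1 : \forall s \near t^', 0 <= s <= T by apply: sub; exact: near_within_itv.
  have N2 : \forall s \near t^', s != t by exact: nbhs_dnbhs_neq.
  apply: filterS2 (filterI N1 N2) (filterI (conv2_near qf) (conv2_near qg)).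
  by move=> s [sT st] [Lf Lg]; rewrite half_energy_quotient.
apply: cvg_trans (near_eq_cvg E) _.
have mid (p : R -> V -> R) : conv2 mu Om (near_t T t) p (p t) ->
    conv2 mu Om t^' (fun s x => (p s x + p t x) / 2) (p t).
  move=> Hp; have Lp : conv2 mu Om t^' (fun=> p t) (p t) by apply: conv2_cst; exact: conv2_L2 Hp.
  apply: (conv2_eq mO _ _ (conv2Z mO 2^-1 (conv2D mO (conv2_sub sub Hp) Lp))).
    by apply: nearW => s x _; rewrite mulrC.
  by move=> x _; field.
have mdP : conv2 mu Om t^' (fun s x => \sum_i (dP i i s x + dP i i t x) / 2)
    (fun x => \sum_i dP i i t x).
  by apply: (conv2_sum mO) => i; exact: mid (dmodulated_conv i tT').
apply: cvgD.
  by apply: cvgM; [exact: cvg_cst|exact: (cvg_I mO qf mdP)].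
apply: cvg_sumr => i; apply: (cvg_I mO (mid _ (modulated_conv i tT'))).
apply: (conv2Z mO); apply: (conv2D mO).
  exact: (conv2M mO qg (convoo_at _ (convoo_sub sub (lf_oo lf i tT')))).
exact: (conv2Ml _ (convoo_sub sub (cp_oo cg tT')) (qv i)).
Qed.

End half_energy.
End energy_derivative.

(** * The modulated energy *)
Section modulated_energy.
Context {R : realType} {n : nat}.
Local Notation mu := (lebesgue_rV n).
Local Notation V := 'rV[R]_n.
Local Notation near_t T t := (within `[0, T]%classic (nbhs (t : R))).
Implicit Types (Om : set V) (T : R).

(** The Gross-Pitaevskii equation in real form. *)
Record wave Om T (eps : R) (a b at_ bt : R -> V -> R) : Prop := Wave {
  wv_a : component Om T a at_;
  wv_b : component Om T b bt;
  wv_m : forall t, 0 <= t <= T ->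
    conv2 mu Om (near_t T t) (fun s x => a s x ^+ 2 + b s x ^+ 2 - 1)
      (fun x => a t x ^+ 2 + b t x ^+ 2 - 1);
  wv_eqa : forall t x, 0 < t < T -> Om x ->
    - eps * bt t x + eps ^+ 2 / 2 * (\sum_i pderiv i (pderiv i (a t)) x) =
    (a t x ^+ 2 + b t x ^+ 2 - 1) * a t x;
  wv_eqb : forall t x, 0 < t < T -> Om x ->
    eps * at_ t x + eps ^+ 2 / 2 * (\sum_i pderiv i (pderiv i (b t)) x) =
    (a t x ^+ 2 + b t x ^+ 2 - 1) * b t x }.

Variables (Om : set V) (chi : nat -> V -> R) (T eps : R).
Hypothesis oO : open Om.
Hypothesis ex : exhausting Om chi.
Hypothesis eps0 : 0 < eps.
Variables (a b at_ bt rho : R -> V -> R) (v : 'I_n -> R -> V -> R).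
Hypothesis wv : wave Om T eps a b at_ bt.
Hypothesis lf : limit_flow Om T rho v.
Let mO : measurable Om := open_measurable_rV oO.
Let ca := wv_a wv.
Let cb := wv_b wv.

Definition mod_re (i : 'I_n) t x := eps * pderiv i (a t) x + b t x * v i t x.
Definition mod_im (i : 'I_n) t x := eps * pderiv i (b t) x - a t x * v i t x.
Definition density_gap t x := a t x ^+ 2 + b t x ^+ 2 - rho t x.
Local Notation A := mod_re.
Local Notation B := mod_im.
Local Notation N := density_gap.
Definition dmod_re (k i : 'I_n) t x := eps * pderiv i (pderiv k (a t)) x +
  (pderiv i (b t) x * v k t x + b t x * pderiv i (v k t) x).
Definition dmod_im (k i : 'I_n) t x := eps * pderiv i (pderiv k (b t)) x -
  (pderiv i (a t) x * v k t x + a t x * pderiv i (v k t) x).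
Local Notation dA := dmod_re.
Local Notation dB := dmod_im.
Definition energy_density t x := (\sum_i (A i t x ^+ 2 + B i t x ^+ 2) + N t x ^+ 2) / 2.
Definition energy t := Rintegral mu Om (energy_density t).

Lemma mod_reE : modulated eps 1 v a b = A.
Proof. by apply/funext => i; apply/funext => t; apply/funext => x; rewrite /modulated mul1r. Qed.

Lemma mod_imE : modulated eps (-1) v b a = B.
Proof. by apply/funext => i; apply/funext => t; apply/funext => x; rewrite /modulated mulN1r. Qed.

Lemma dmod_reE : dmodulated eps 1 v a b = dA.
Proof.
apply/funext => i; apply/funext => j; apply/funext => t; apply/funext => x.
by rewrite /dmodulated mul1r.
Qed.

Lemma dmod_imE : dmodulated eps (-1) v b a = dB.
Proof.
apply/funext => i; apply/funext => j; apply/funext => t; apply/funext => x.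
by rewrite /dmodulated mulN1r.
Qed.

Lemma mod_re_conv i t : 0 <= t <= T -> conv2 mu Om (near_t T t) (A i) (A i t).
Proof. by rewrite -mod_reE; exact: (modulated_conv oO eps 1 lf ca cb). Qed.

Lemma mod_im_conv i t : 0 <= t <= T -> conv2 mu Om (near_t T t) (B i) (B i t).
Proof. by rewrite -mod_imE; exact: (modulated_conv oO eps (-1) lf cb ca). Qed.

Lemma dmod_re_L2 i t : 0 <= t <= T -> L2 mu Om (dA i i t).
Proof. by rewrite -dmod_reE => tT; apply: (conv2_L2 (dmodulated_conv oO eps 1 lf ca cb i tT)). Qed.

Lemma dmod_im_L2 i t : 0 <= t <= T -> L2 mu Om (dB i i t).
Proof. by rewrite -dmod_imE => tT; apply: (conv2_L2 (dmodulated_conv oO eps (-1) lf cb ca i tT)). Qed.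

Lemma mod_re_c1 i t : 0 <= t <= T -> c1 Om (A i t).
Proof. by rewrite -mod_reE; exact: (modulated_c1 oO eps 1 lf ca cb). Qed.

Lemma mod_im_c1 i t : 0 <= t <= T -> c1 Om (B i t).
Proof. by rewrite -mod_imE; exact: (modulated_c1 oO eps (-1) lf cb ca). Qed.

Lemma mod_re_pder i j t x : 0 <= t <= T -> Om x -> is_pder j (A i t) x (dA i j t x).
Proof.
move=> tT Ox; have := c1_pder j (mod_re_c1 i tT) Ox.
by rewrite -mod_reE (modulated_pder eps 1 lf ca cb i j tT Ox) dmod_reE.
Qed.

Lemma mod_im_pder i j t x : 0 <= t <= T -> Om x -> is_pder j (B i t) x (dB i j t x).
Proof.
move=> tT Ox; have := c1_pder j (mod_im_c1 i tT) Ox.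
by rewrite -mod_imE (modulated_pder eps (-1) lf cb ca i j tT Ox) dmod_imE.
Qed.

Lemma mod_re_no_flux t : 0 <= t <= T -> no_flux Om (fun i => A i t).
Proof. by rewrite -mod_reE; exact: (modulated_no_flux eps 1 lf ca cb). Qed.

Lemma mod_im_no_flux t : 0 <= t <= T -> no_flux Om (fun i => B i t).
Proof. by rewrite -mod_imE; exact: (modulated_no_flux eps (-1) lf cb ca). Qed.

Lemma gap_conv t : 0 <= t <= T -> conv2 mu Om (near_t T t) N (N t).
Proof.
move=> tT; apply: (conv2_eq mO _ _ (conv2B mO (wv_m wv tT) (lf_rho1 lf tT))).
  by apply: nearW => s x _; rewrite /density_gap; ring.
by move=> x _; rewrite /density_gap; ring.
Qed.

Lemma gap_c1 t : 0 <= t <= T -> c1 Om (N t).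
Proof.
move=> tT; have c2 f : c1 Om f -> c1 Om (fun x => f x ^+ 2) by move=> cf; exact: (c1M oO cf cf).
apply: (c1B oO _ (lf_rho lf tT)).
exact: (c1D oO (c2 _ (cp_c1 ca tT)) (c2 _ (cp_c1 cb tT))).
Qed.

Lemma energy_density_L1 t : 0 <= t <= T -> L1 mu Om (energy_density t).
Proof.
move=> tT; have L : L1 mu Om (fun x => \sum_i (A i t x ^+ 2 + B i t x ^+ 2) + N t x ^+ 2).
  apply: (L1D mO); last exact: (conv2_L2 (gap_conv tT)).2.
  apply: (L1_sum mO) => i; apply: (L1D mO).
    exact: (conv2_L2 (mod_re_conv i tT)).2.
  exact: (conv2_L2 (mod_im_conv i tT)).2.
by apply: (L1_eq mO _ (L1Z mO 2^-1 L)) => x _; rewrite mulrC.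
Qed.

Lemma energyE t : 0 <= t <= T -> energy t =
  half_energy Om eps 1 v a b t + half_energy Om eps (-1) v b a t +
  Rintegral mu Om (fun x => N t x * N t x) / 2.
Proof.
move=> tT; rewrite /half_energy mod_reE mod_imE.
have LA : L1 mu Om (fun x => \sum_i A i t x ^+ 2).
  by apply: (L1_sum mO) => i; exact: (conv2_L2 (mod_re_conv i tT)).2.
have LB : L1 mu Om (fun x => \sum_i B i t x ^+ 2).
  by apply: (L1_sum mO) => i; exact: (conv2_L2 (mod_im_conv i tT)).2.
have LN := conv2_L2 (gap_conv tT); have LNN := L2M mO LN LN.
rewrite -!mulrDl -(I_D mO LA LB) -(I_D mO (L1D mO LA LB) LNN) mulrC.
rewrite -(I_Z mO _ (L1D mO (L1D mO LA LB) LNN)); apply: I_eq => x _.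
by rewrite /energy_density big_split mulrC expr2.
Qed.

Lemma half_energyE (c : R) f ft g gt t : 0 <= t <= T ->
  component Om T f ft -> component Om T g gt ->
  half_energy Om eps c v f g t =
  (\sum_i Rintegral mu Om (fun x => modulated eps c v f g i t x * modulated eps c v f g i t x)) / 2.
Proof.
move=> tT cf cg; have LP i := conv2_L2 (modulated_conv oO eps c lf cf cg i tT).
by congr (_ / _); rewrite -(I_sum mO _ _ (fun i => L2M mO (LP i) (LP i))).
Qed.

Lemma energy_continuous t : 0 <= t <= T -> energy s @[s --> near_t T t] --> energy t.
Proof.
move=> tT; rewrite energyE// (half_energyE _ tT ca cb) (half_energyE _ tT cb ca).
have E : \forall s \near near_t T t,
    (\sum_i Rintegral mu Om (fun x => modulated eps 1 v a b i s x * modulated eps 1 v a b i s x)) / 2 +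
    (\sum_i Rintegral mu Om (fun x => modulated eps (-1) v b a i s x * modulated eps (-1) v b a i s x)) / 2 +
    Rintegral mu Om (fun x => N s x * N s x) / 2 = energy s.
  apply: near_within_itv => s sT.
  by rewrite energyE// (half_energyE _ sT ca cb) (half_energyE _ sT cb ca).
apply: cvg_trans (near_eq_cvg E) _.
apply: cvgD; [apply: cvgD|]; apply: cvgM; try exact: cvg_cst.
- apply: cvg_sumr => i; have H := modulated_conv oO eps 1 lf ca cb i tT; exact: (cvg_I mO H H).
- apply: cvg_sumr => i; have H := modulated_conv oO eps (-1) lf cb ca i tT; exact: (cvg_I mO H H).
- exact: (cvg_I mO (gap_conv tT) (gap_conv tT)).
Qed.

Lemma near_t_of_nbhs t (P : set R) : nbhs t P -> near_t T t P.
Proof. by apply: filterS => s Ps _. Qed.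

(** The wave equation expresses the time derivative through functions that are
    continuous in time with values in [L^2]; likewise for the imaginary part. *)
Lemma re_t_conv t : 0 < t < T -> conv2 mu Om (near_t T t) at_ (at_ t).
Proof.
move=> tT; have tT' := ltW_itv tT; have e0 : eps != 0 by rewrite gt_eqF.
have F s x : 0 < s < T -> Om x -> eps^-1 * ((a s x ^+ 2 + b s x ^+ 2 - 1) * b s x -
    eps ^+ 2 / 2 * \sum_i pderiv i (pderiv i (b s)) x) = at_ s x.
  by move=> sT Ox; rewrite -(wv_eqb wv sT Ox) addrK mulKf.
pose proof (conv2Z mO eps^-1 (conv2B mO (conv2M mO (wv_m wv tT') (cp_oo cb tT'))
  (conv2Z mO (eps ^+ 2 / 2) (conv2_sum mO (index_enum 'I_n) xpredT (fun i => cp_dd cb i tT'))))) as C.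
apply: (conv2_eq mO _ _ C); last by move=> x Ox; exact: F.
by apply: near_t_of_nbhs; apply: filterS (near_itvoo tT) => s sT x Ox; exact: F.
Qed.

Lemma im_t_conv t : 0 < t < T -> conv2 mu Om (near_t T t) bt (bt t).
Proof.
move=> tT; have tT' := ltW_itv tT; have e0 : eps != 0 by rewrite gt_eqF.
have F s x : 0 < s < T -> Om x -> eps^-1 * (eps ^+ 2 / 2 * (\sum_i pderiv i (pderiv i (a s)) x) -
    (a s x ^+ 2 + b s x ^+ 2 - 1) * a s x) = bt s x.
  by move=> sT Ox; rewrite -(wv_eqa wv sT Ox) opprD addrC mulNr opprK addrNK mulKf.
pose proof (conv2Z mO eps^-1 (conv2B mO (conv2Z mO (eps ^+ 2 / 2)
    (conv2_sum mO (index_enum 'I_n) xpredT (fun i => cp_dd ca i tT')))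
  (conv2M mO (wv_m wv tT') (cp_oo ca tT')))) as C.
apply: (conv2_eq mO _ _ C); last by move=> x Ox; exact: F.
by apply: near_t_of_nbhs; apply: filterS (near_itvoo tT) => s sT x Ox; exact: F.
Qed.

Lemma rhot_conv t : 0 <= t <= T -> conv2 mu Om (near_t T t) (rhot rho v) (rhot rho v t).
Proof.
move=> tT; apply: (conv2N mO); apply: (conv2_sum mO) => i; apply: (conv2D mO).
  exact: (conv2M mO (lf_drho lf i tT) (lf_oo lf i tT)).
exact: (conv2Ml oO _ (lf_rhooo lf tT) (lf_d2 lf i i tT)).
Qed.

Lemma vt_conv i t : 0 <= t <= T -> conv2 mu Om (near_t T t) (vt rho v i) (vt rho v i t).
Proof.
move=> tT; apply: (conv2B mO (conv2N mO (lf_drho lf i tT))).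
by apply: (conv2_sum mO) => k; exact: (conv2Ml oO _ (lf_oo lf k tT) (lf_d2 lf k i tT)).
Qed.

Lemma is_derive_of_quotient (h : R -> R) (t l : R) :
  (s - t)^-1 * (h s - h t) @[s --> t^'] --> l -> is_derive t (1 : R) h l.
Proof.
move=> /cvgrPdist_le H; apply/is_derive_epsP => e /H.
rewrite /dnbhs/= => /nbhs_ballP[r /= r0 Hr]; exists r => // s /andP[s0 sr].
rewrite distrC mulrC; apply: Hr; first by rewrite /ball/= distrC.
by rewrite -subr_eq0 -normr_gt0.
Qed.

(** The derivative of the energy density after integration by parts of the terms
    that contain the gradients of the time derivatives; only its integral is the
    derivative of the energy. *)
Definition energy_rate t x :=
  - eps * at_ t x * (\sum_i dA i i t x) + \sum_i A i t x * (bt t x * v i t x)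
  + \sum_i A i t x * (b t x * vt rho v i t x)
  - eps * bt t x * (\sum_i dB i i t x) - \sum_i B i t x * (at_ t x * v i t x)
  - \sum_i B i t x * (a t x * vt rho v i t x)
  + N t x * (2 * a t x * at_ t x + 2 * b t x * bt t x - rhot rho v t x).

Lemma gap_quotient_limit t : 0 < t < T ->
  (s - t)^-1 * (Rintegral mu Om (fun x => N s x * N s x) / 2 -
     Rintegral mu Om (fun x => N t x * N t x) / 2) @[s --> t^'] -->
  Rintegral mu Om (fun x => N t x *
    (at_ t x * (a t x + a t x) + bt t x * (b t x + b t x) - rhot rho v t x)).
Proof.
move=> tT; have tT' := ltW_itv tT.
have sub : forall Q, near_t T t Q -> t^' Q by move=> Q; exact: near_t_dnbhs.
have qa := quotient_conv oO ex (cp_t ca) (cp_jt ca) (cp_c1 ca) tT (re_t_conv tT).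
have qb := quotient_conv oO ex (cp_t cb) (cp_jt cb) (cp_c1 cb) tT (im_t_conv tT).
have qr := quotient_conv oO ex (lf_rhot lf) (lf_jrhot lf) (lf_rho lf) tT (rhot_conv tT').
pose proof (convooD (convoo_sub sub (cp_oo ca tT')) (convoo_at _ (convoo_sub sub (cp_oo ca tT')))) as oa.
pose proof (convooD (convoo_sub sub (cp_oo cb tT')) (convoo_at _ (convoo_sub sub (cp_oo cb tT')))) as ob.
pose proof (conv2B mO (conv2D mO (conv2M mO qa oa) (conv2M mO qb ob)) qr) as qN.
have mN : conv2 mu Om t^' (fun s x => (N s x + N t x) / 2) (N t).
  have HN := conv2_sub sub (gap_conv tT').
  have LN : conv2 mu Om t^' (fun=> N t) (N t) by apply: conv2_cst; exact: conv2_L2 HN.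
  apply: (conv2_eq mO _ _ (conv2Z mO 2^-1 (conv2D mO HN LN))).
    by apply: nearW => s x _; rewrite mulrC.
  by move=> x _; field.
apply: cvg_trans (near_eq_cvg _) (cvg_I mO mN qN).
have H : \forall s \near t^', 0 <= s <= T by apply: sub; exact: near_within_itv.
apply: filterS H => s sT.
have Ls := conv2_L2 (gap_conv sT); have Lt := conv2_L2 (gap_conv tT').
rewrite -mulrBl -(I_B mO (L2M mO Ls Ls) (L2M mO Lt Lt)) mulrA mulrAC.
rewrite -(I_Z mO _ (L1B mO (L2M mO Ls Ls) (L2M mO Lt Lt))).
by apply: I_eq => x _; rewrite /density_gap; move: (_ - t)^-1 => k; field.
Qed.

Lemma convoo_L2 w (F : set_system R) (p : R -> V -> R) g :
  convoo Om F p w -> L2 mu Om g -> L2 mu Om (fun x => w x * g x).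
Proof. by move=> [mw [M HM] _] Lg; exact: (L2_bddM mO mw HM Lg). Qed.

Lemma convoo_L1 w (F : set_system R) (p : R -> V -> R) g :
  convoo Om F p w -> L1 mu Om g -> L1 mu Om (fun x => w x * g x).
Proof. by move=> [mw [M HM] _] Lg; exact: (L1_bddM mO mw HM Lg). Qed.

Lemma energy_is_derive t : 0 < t < T ->
  L1 mu Om (energy_rate t) /\
  is_derive t (1 : R) energy (Rintegral mu Om (energy_rate t)).
Proof.
move=> tT; have tT' := ltW_itv tT.
have qa := quotient_conv oO ex (cp_t ca) (cp_jt ca) (cp_c1 ca) tT (re_t_conv tT).
have qb := quotient_conv oO ex (cp_t cb) (cp_jt cb) (cp_c1 cb) tT (im_t_conv tT).
have qv i := quotient_conv oO ex (@lf_vt _ _ _ _ _ _ lf i) (@lf_jvt _ _ _ _ _ _ lf i)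
  (@lf_c1 _ _ _ _ _ _ lf i) tT (vt_conv i tT').
have HA := half_energy_limit oO ex (eps := eps) (c := 1) lf ca cb tT qa qb qv.
have HB := half_energy_limit oO ex (eps := eps) (c := -1) lf cb ca tT qb qa qv.
have HN := gap_quotient_limit tT.
rewrite mod_reE dmod_reE in HA; rewrite mod_imE dmod_imE in HB.
have LA i := conv2_L2 (mod_re_conv i tT'); have LB i := conv2_L2 (mod_im_conv i tT').
have Lat := conv2_L2 (re_t_conv tT); have Lbt := conv2_L2 (im_t_conv tT).
have Lvt i := conv2_L2 (vt_conv i tT'); have Lrt := conv2_L2 (rhot_conv tT').
have LN := conv2_L2 (gap_conv tT').
have LdA := L2_sum mO (index_enum 'I_n) xpredT (fun i => dmod_re_L2 i tT').
have LdB := L2_sum mO (index_enum 'I_n) xpredT (fun i => dmod_im_L2 i tT').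
have oa := cp_oo ca tT'; have ob := cp_oo cb tT'; have ov i := lf_oo lf i tT'.
have L1' := L2M mO Lat LdA; have L2' := L2M mO Lbt LdB.
have L3 i : L2 mu Om (fun x => 1 * (bt t x * v i t x + b t x * vt rho v i t x)).
  apply: (L2Z mO); apply: (L2D mO); last exact: convoo_L2 ob (Lvt i).
  by apply: (L2_eq mO _ (convoo_L2 (ov i) Lbt)) => x _; rewrite mulrC.
have L4 i : L2 mu Om (fun x => -1 * (at_ t x * v i t x + a t x * vt rho v i t x)).
  apply: (L2Z mO); apply: (L2D mO); last exact: convoo_L2 oa (Lvt i).
  by apply: (L2_eq mO _ (convoo_L2 (ov i) Lat)) => x _; rewrite mulrC.
have L5 i := L2M mO (LA i) (L3 i); have L6 i := L2M mO (LB i) (L4 i).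
have L7 : L1 mu Om (fun x => N t x *
    (at_ t x * (a t x + a t x) + bt t x * (b t x + b t x) - rhot rho v t x)).
  apply: (L2M mO LN); apply: (L2B mO _ Lrt); apply: (L2D mO).
    apply: (L2_eq mO _ (L2Z mO 2 (convoo_L2 oa Lat))) => x _; ring.
  apply: (L2_eq mO _ (L2Z mO 2 (convoo_L2 ob Lbt))) => x _; ring.
have S5 := L1_sum mO (index_enum 'I_n) xpredT L5.
have S6 := L1_sum mO (index_enum 'I_n) xpredT L6.
have LG1 := L1D mO (L1Z mO (- eps) L1') S5; have LG2 := L1D mO (L1Z mO (- eps) L2') S6.
have LG12 := L1D mO LG1 LG2; have LG := L1D mO LG12 L7.
have GE x (_ : Om x) : - eps * (at_ t x * \sum_i dA i i t x)
    + \sum_i A i t x * (1 * (bt t x * v i t x + b t x * vt rho v i t x))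
    + (- eps * (bt t x * \sum_i dB i i t x)
       + \sum_i B i t x * (-1 * (at_ t x * v i t x + a t x * vt rho v i t x)))
    + N t x * (at_ t x * (a t x + a t x) + bt t x * (b t x + b t x) - rhot rho v t x)
    = energy_rate t x.
  have E1 : \sum_i A i t x * (1 * (bt t x * v i t x + b t x * vt rho v i t x)) =
      \sum_i A i t x * (bt t x * v i t x) + \sum_i A i t x * (b t x * vt rho v i t x).
    by rewrite -big_split; apply: eq_bigr => i _; rewrite mul1r mulrDr.
  have E2 : \sum_i B i t x * (-1 * (at_ t x * v i t x + a t x * vt rho v i t x)) =
      - (\sum_i B i t x * (at_ t x * v i t x)) - \sum_i B i t x * (a t x * vt rho v i t x).
    rewrite -opprD -big_split -sumrN; apply: eq_bigr => i _ /=; ring.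
  by rewrite E1 E2 /energy_rate; ring.
split; first exact: (L1_eq mO GE LG).
apply: is_derive_of_quotient.
have -> : Rintegral mu Om (energy_rate t) =
    (- eps * Rintegral mu Om (fun x => at_ t x * \sum_i dA i i t x)
     + \sum_i Rintegral mu Om (fun x => A i t x * (1 * (bt t x * v i t x + b t x * vt rho v i t x))))
    + (- eps * Rintegral mu Om (fun x => bt t x * \sum_i dB i i t x)
     + \sum_i Rintegral mu Om (fun x => B i t x * (-1 * (at_ t x * v i t x + a t x * vt rho v i t x))))
    + Rintegral mu Om (fun x => N t x *
       (at_ t x * (a t x + a t x) + bt t x * (b t x + b t x) - rhot rho v t x)).
  rewrite -(I_eq mu GE) (I_D mO LG12 L7) (I_D mO LG1 LG2).
  rewrite (I_D mO (L1Z mO (- eps) L1') S5) (I_D mO (L1Z mO (- eps) L2') S6).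
  by rewrite (I_Z mO _ L1') (I_Z mO _ L2') (I_sum mO _ _ L5) (I_sum mO _ _ L6).
pose proof (cvgD (cvgD HA HB) HN) as H.
apply: cvg_trans (near_eq_cvg _) H.
have Hs : \forall s \near t^', 0 <= s <= T.
  by apply: (near_t_dnbhs tT); exact: near_within_itv.
apply: filterS Hs => s sT; rewrite !fctE /= (energyE sT) (energyE tT').
by rewrite -!mulrDr; congr *%R; ring.
Qed.

End modulated_energy.

(** * The energy estimate *)
Lemma pairing_bound (R : realType) (x y z w : R) :
  `|x * y + z * w| <= (x ^+ 2 + z ^+ 2 + (y ^+ 2 + w ^+ 2)) / 2.
Proof.
have := sqr_ge0 (x - y); have := sqr_ge0 (x + y); have := sqr_ge0 (z - w); have := sqr_ge0 (z + w).
by rewrite ler_norml => ? ? ? ?; apply/andP; split; nra.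
Qed.

(** Young's inequality produces [e ^+ 2 W0 ^+ 2 (a0 ^+ 2 + b0 ^+ 2)], where the mass is
    split into the bounded [r0] and the small [N0]; the bounded weight
    [e ^+ 2 W0 ^+ 2] is multiplied by [M] against [r0], and squared against [N0] by a
    second use of Young's inequality. *)
Lemma dispersive_bound (R : realType) (W0 a0 b0 A0 B0 N0 r0 M e : R) : 0 < e <= 1 ->
  `|W0| <= M -> `|r0| <= M -> N0 = a0 ^+ 2 + b0 ^+ 2 - r0 ->
  - (e / 2) * (W0 * (a0 * A0 + b0 * B0)) <=
  (A0 ^+ 2 + B0 ^+ 2) / 2 + N0 ^+ 2 / 2 + (M ^+ 2 + M) * (e ^+ 2 * W0 ^+ 2).
Proof.
move=> /andP[e0 e1] WM rM NE; set y := e ^+ 2 * W0 ^+ 2.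
have M0 : 0 <= M by exact: le_trans (normr_ge0 W0) WM.
have y0 : 0 <= y by rewrite /y mulr_ge0 ?sqr_ge0.
have yM : y <= M ^+ 2.
  have WM2 : W0 ^+ 2 <= M ^+ 2 by rewrite -(real_normK (num_real W0)) lerXn2r ?nnegrE.
  have ee : e ^+ 2 <= 1 by have := ler_pM (ltW e0) (ltW e0) e1 e1; rewrite mul1r expr2.
  by rewrite /y -[leRHS]mul1r ler_pM ?sqr_ge0.
have mE : a0 ^+ 2 + b0 ^+ 2 = N0 + r0 by rewrite NE; ring.
have h1 : - (e / 2) * (W0 * (a0 * A0 + b0 * B0)) <= (y * (N0 + r0) + A0 ^+ 2 + B0 ^+ 2) / 4.
  rewrite -mE /y; have := sqr_ge0 (e * W0 * a0 + A0); have := sqr_ge0 (e * W0 * b0 + B0); nra.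
have rM' : r0 <= M by exact: le_trans (ler_norm _) rM.
have h2 : y * r0 <= y * M by rewrite ler_wpM2l.
have h3 : y * y <= M ^+ 2 * y by rewrite ler_wpM2r.
have h4 : 2 * (y * N0) <= y * y + N0 ^+ 2 by have := sqr_ge0 (y - N0); nra.
have h5 := sqr_ge0 N0; have h6 := sqr_ge0 A0; have h7 := sqr_ge0 B0.
have h8 : 0 <= M ^+ 2 * y by rewrite mulr_ge0 ?sqr_ge0.
have h9 : 0 <= y * M by rewrite mulr_ge0.
have -> : (M ^+ 2 + M) * y = M ^+ 2 * y + y * M by ring.
rewrite [y * (_ + _)]mulrDr in h1; apply: (le_trans h1).
move: (M ^+ 2 * y) (y * M) (y * y) (y * r0) (y * N0) (N0 ^+ 2) (A0 ^+ 2) (B0 ^+ 2) h2 h3 h4 h5 h6 h7 h8 h9.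
by move=> *; lra.
Qed.

Section energy_estimate.
Context {R : realType} {n : nat}.
Local Notation mu := (lebesgue_rV n).
Local Notation V := 'rV[R]_n.
Local Notation near_t T t := (within `[0, T]%classic (nbhs (t : R))).
Variables (Om : set V) (chi : nat -> V -> R) (T eps : R).
Hypothesis oO : open Om.
Hypothesis ex : exhausting Om chi.
Hypothesis eps0 : 0 < eps.
Variables (a b at_ bt rho : R -> V -> R) (v : 'I_n -> R -> V -> R).
Hypothesis wv : wave Om T eps a b at_ bt.
Hypothesis lf : limit_flow Om T rho v.
Let mO : measurable Om := open_measurable_rV oO.
Let ca := wv_a wv.
Let cb := wv_b wv.
Local Notation A := (mod_re eps a b v).
Local Notation B := (mod_im eps a b v).
Local Notation N := (density_gap a b rho).
Local Notation dA := (dmod_re eps a b v).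
Local Notation dB := (dmod_im eps a b v).
Local Notation energy := (energy Om eps a b rho v).
Local Notation energy_density := (energy_density eps a b rho v).
Local Notation energy_rate := (energy_rate eps a b at_ bt rho v).

Lemma is_pder_eq i (f : V -> R) x (l l' : R) : is_pder i f x l -> l = l' -> is_pder i f x l'.
Proof. by move=> H <-. Qed.

Lemma is_pder_sqr i (f : V -> R) x (l : R) : is_pder i f x l ->
  is_pder i (fun y => f y ^+ 2) x (2 * f x * l).
Proof. by move=> H; apply: (is_pder_eq (is_pderM H H)); ring. Qed.

Lemma is_pder_bernoulli (r : V -> R) (u : 'I_n -> V -> R) i x :
  is_pder i r x (pderiv i r x) -> (forall k, is_pder i (u k) x (pderiv i (u k) x)) ->
  is_pder i (fun y => 1 - r y - (\sum_k u k y ^+ 2) / 2) x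
    (- pderiv i r x - \sum_k u k x * pderiv i (u k) x).
Proof.
move=> pr pu; have Hr := is_pderB (is_pder_cst i 1 x) pr.
have Hv := is_pder_sum (index_enum 'I_n) xpredT (fun k => is_pder_sqr (pu k)).
have H := is_pderB Hr (is_pderM Hv (is_pder_cst i 2^-1 x)).
apply: (is_pder_eq H); rewrite mulr0 addr0 sub0r mulr_suml; congr (_ - _).
by apply: eq_bigr => k _; field.
Qed.

(** The quadratic form of the Jacobian matrix of the velocity, evaluated at the
    modulated gradient. *)
Definition strain t x := \sum_i \sum_k
  (A i t x * A k t x + B i t x * B k t x) * pderiv k (v i t) x.
Definition div_v t x := \sum_i pderiv i (v i t) x.
Definition dmass (k : 'I_n) t x := 2 * (a t x * pderiv k (a t) x + b t x * pderiv k (b t) x).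
(** The Laplacian of [|u|^2], expanded. *)
Definition lap_mass t x := \sum_i (2 * (pderiv i (a t) x ^+ 2 + pderiv i (b t) x ^+ 2 +
  a t x * pderiv i (pderiv i (a t)) x + b t x * pderiv i (pderiv i (b t)) x)).
(** The time derivative of the potential, by the Bernoulli equation. *)
Definition bernoulli t x := 1 - rho t x - (\sum_k v k t x ^+ 2) / 2.
(** The flux that collects every divergence left by the time derivative of the
    energy density. *)
Definition energy_flux (i : 'I_n) t x :=
  - (bernoulli t x * (a t x * B i t x - b t x * A i t x))
  + A i t x * (\sum_k A k t x * v k t x)
  + B i t x * (\sum_k B k t x * v k t x)
  - energy_density t x * v i t x.

Section fixed_time.
Variable t : R.
Hypothesis tT : 0 < t < T.
Let tT' := ltW_itv tT.

Let pa i x (Ox : Om x) := c1_pder i (cp_c1 ca tT') Ox.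
Let pb i x (Ox : Om x) := c1_pder i (cp_c1 cb tT') Ox.
Let pdb i j x (Ox : Om x) := c1_pder j (@cp_c1d _ _ _ _ _ _ cb i t tT') Ox.
Let pv i k x (Ox : Om x) := c1_pder i (@lf_c1 _ _ _ _ _ _ lf k t tT') Ox.

Lemma gap_pder i x : Om x -> is_pder i (N t) x
  (2 * (a t x * pderiv i (a t) x + b t x * pderiv i (b t) x) - pderiv i (rho t) x).
Proof.
move=> Ox; have Ha := is_pder_sqr (pa i Ox); have Hb := is_pder_sqr (pb i Ox).
have Hr := c1_pder i (lf_rho lf tT') Ox.
by apply: (is_pder_eq (is_pderB (is_pderD Ha Hb) Hr)); ring.
Qed.

Lemma bernoulli_pder i x : Om x -> is_pder i (bernoulli t) x (vt rho v i t x).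
Proof.
move=> Ox; apply: is_pder_bernoulli; first exact: (c1_pder i (lf_rho lf tT') Ox).
by move=> k; exact: pv.
Qed.

Lemma energy_density_pder i x : Om x -> is_pder i (energy_density t) x
  (\sum_k (A k t x * dA k i t x + B k t x * dB k i t x) +
   N t x * (2 * (a t x * pderiv i (a t) x + b t x * pderiv i (b t) x) - pderiv i (rho t) x)).
Proof.
move=> Ox.
have HA k := is_pder_sqr (mod_re_pder oO wv lf k i tT' Ox).
have HB k := is_pder_sqr (mod_im_pder oO wv lf k i tT' Ox).
have HS := is_pder_sum (index_enum 'I_n) xpredT (fun k => is_pderD (HA k) (HB k)).
have H := is_pderM (is_pderD HS (is_pder_sqr (gap_pder i Ox))) (is_pder_cst i 2^-1 x).
apply: (is_pder_eq H); rewrite mulr0 addr0 mulrDl mulr_suml; congr (_ + _); last by field.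
by apply: eq_bigr => k _; field.
Qed.

Definition denergy_flux (i : 'I_n) x :=
  - (vt rho v i t x * (a t x * B i t x - b t x * A i t x) + bernoulli t x *
     ((pderiv i (a t) x * B i t x + a t x * dB i i t x) -
      (pderiv i (b t) x * A i t x + b t x * dA i i t x)))
  + (dA i i t x * (\sum_k A k t x * v k t x) +
     A i t x * \sum_k (dA k i t x * v k t x + A k t x * pderiv i (v k t) x))
  + (dB i i t x * (\sum_k B k t x * v k t x) +
     B i t x * \sum_k (dB k i t x * v k t x + B k t x * pderiv i (v k t) x))
  - ((\sum_k (A k t x * dA k i t x + B k t x * dB k i t x) +
      N t x * (2 * (a t x * pderiv i (a t) x + b t x * pderiv i (b t) x) - pderiv i (rho t) x))
       * v i t x
     + (\sum_k (A k t x ^+ 2 + B k t x ^+ 2) + N t x ^+ 2) / 2 * pderiv i (v i t) x).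

Lemma energy_flux_pder i x : Om x -> is_pder i (energy_flux i t) x (denergy_flux i x).
Proof.
move=> Ox; have HA k := mod_re_pder oO wv lf k i tT' Ox.
have HB k := mod_im_pder oO wv lf k i tT' Ox.
have HJ := is_pderM (bernoulli_pder i Ox)
  (is_pderB (is_pderM (pa i Ox) (HB i)) (is_pderM (pb i Ox) (HA i))).
have HAv := is_pderM (HA i) (is_pder_sum (index_enum 'I_n) xpredT (fun k => is_pderM (HA k) (pv i k Ox))).
have HBv := is_pderM (HB i) (is_pder_sum (index_enum 'I_n) xpredT (fun k => is_pderM (HB k) (pv i k Ox))).
have HE := is_pderM (energy_density_pder i Ox) (pv i i Ox).
exact: (is_pderB (is_pderD (is_pderD (is_pderN HJ) HAv) HBv) HE).
Qed.

Lemma energy_rate_identity x : Om x -> energy_rate t x =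
  - strain t x - N t x ^+ 2 / 2 * div_v t x
  + eps ^+ 2 / 4 * (div_v t x * lap_mass t x) + \sum_i denergy_flux i x.
Proof.
move=> Ox; have e0 : eps != 0 by rewrite gt_eqF.
have sda i k : pderiv i (pderiv k (a t)) x = pderiv k (pderiv i (a t)) x.
  exact: (pderiv_sym _ _ oO (cp_c1 ca tT') (fun j => @cp_c1d _ _ _ _ _ _ ca j t tT') Ox).
have sdb i k : pderiv i (pderiv k (b t)) x = pderiv k (pderiv i (b t)) x.
  exact: (pderiv_sym _ _ oO (cp_c1 cb tT') (fun j => @cp_c1d _ _ _ _ _ _ cb j t tT') Ox).
have sv i k : pderiv i (v k t) x = pderiv k (v i t) x.
  exact: (lf_sym lf _ _ tT' Ox).
exact: (energy_density_identity (rho t x) (fun i => pderiv i (a t) x)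
  (fun i => pderiv i (b t) x) (fun i => v i t x) (fun i => pderiv i (rho t) x) e0 sda sdb sv
  (wv_eqa wv tT Ox) (wv_eqb wv tT Ox)).
Qed.

Let oa := cp_oo ca tT'.
Let ob := cp_oo cb tT'.
Let ov k := @lf_oo _ _ _ _ _ _ lf k t tT'.
Let LA i := conv2_L2 (mod_re_conv oO wv lf i tT').
Let LB i := conv2_L2 (mod_im_conv oO wv lf i tT').
Let LN := conv2_L2 (gap_conv oO wv lf tT').
Let Lv i := conv2_L2 (@lf_2 _ _ _ _ _ _ lf i t tT').

Lemma no_flux_ext (F G : 'I_n -> V -> R) : (forall i x, F i x = G i x) ->
  no_flux Om F -> no_flux Om G.
Proof.
by move=> FG; rewrite (_ : F = G)//; apply/funext => i; apply/funext => x.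
Qed.

Lemma convoo_bdry (w : R -> V -> R) : convoo Om (near_t T t) w (w t) ->
  bounded_near_boundary Om (w t).
Proof. by move=> [_ [M HM] _]; exact: bounded_bdry HM. Qed.

Lemma mod_re_bdry i : bounded_near_boundary Om (A i t).
Proof.
apply: bdryD; first exact: (bdryZ eps (@cp_bn _ _ _ _ _ _ ca i t tT')).
by apply: bdryM; apply: convoo_bdry; [exact: ob|exact: ov].
Qed.

Lemma mod_im_bdry i : bounded_near_boundary Om (B i t).
Proof.
apply: bdryB; first exact: (bdryZ eps (@cp_bn _ _ _ _ _ _ cb i t tT')).
by apply: bdryM; apply: convoo_bdry; [exact: oa|exact: ov].
Qed.

Lemma bernoulli_bdry : bounded_near_boundary Om (bernoulli t).
Proof.
apply: bdryB.
  apply: bdryB; last exact: convoo_bdry (lf_rhooo lf tT').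
  by apply: (@bounded_bdry _ _ _ (fun=> 1) `|1|).
apply: bdryM; last by apply: (@bounded_bdry _ _ _ (fun=> 2^-1) `|2^-1|).
by apply: bdry_sum => k; apply: bdryM; apply: convoo_bdry; exact: ov.
Qed.

Lemma energy_density_bdry : bounded_near_boundary Om (energy_density t).
Proof.
apply: bdryM; last by apply: (@bounded_bdry _ _ _ (fun=> 2^-1) `|2^-1|).
apply: bdryD.
  apply: bdry_sum => i; apply: bdryD.
    exact: (bdryM (mod_re_bdry i) (mod_re_bdry i)).
  exact: (bdryM (mod_im_bdry i) (mod_im_bdry i)).
have bN : bounded_near_boundary Om (N t).
  apply: bdryB; last exact: convoo_bdry (lf_rhooo lf tT').
  by apply: bdryD; apply: bdryM; apply: convoo_bdry; (exact: oa || exact: ob).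
exact: bdryM.
Qed.

(** Each term is [A], [B] or [v], free of flux, times a factor bounded near the
    boundary. *)
Lemma energy_flux_no_flux : no_flux Om (fun i => energy_flux i t).
Proof.
have nA := mod_re_no_flux wv lf tT'; have nB := mod_im_no_flux wv lf tT'.
have nJ := no_fluxM bernoulli_bdry (no_fluxB (no_fluxM (convoo_bdry oa) nB) (no_fluxM (convoo_bdry ob) nA)).
have bS (P : 'I_n -> V -> R) : (forall i, bounded_near_boundary Om (P i)) ->
    bounded_near_boundary Om (fun x => \sum_k P k x * v k t x).
  by move=> bP; apply: bdry_sum => k; apply: bdryM; [exact: bP|apply: convoo_bdry; exact: ov].
have nAA := no_fluxM (bS _ mod_re_bdry) nA; have nBB := no_fluxM (bS _ mod_im_bdry) nB.
have nE := no_fluxM energy_density_bdry (lf_nf lf tT').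
apply: no_flux_ext (no_fluxB (no_fluxD (no_fluxD (no_fluxZ (-1) nJ) nAA) nBB) nE) => i x.
by rewrite /energy_flux mulN1r [A i t x * _]mulrC [B i t x * _]mulrC.
Qed.

Lemma bernoulli_c1 : c1 Om (bernoulli t).
Proof.
have cv k := @lf_c1 _ _ _ _ _ _ lf k t tT'.
apply: (c1B oO (c1B oO (c1_cst 1 oO) (lf_rho lf tT'))).
by apply: (c1M oO _ (c1_cst 2^-1 oO)); apply: (c1_sum _ _ oO) => k; exact: (c1M oO (cv k) (cv k)).
Qed.

Lemma energy_flux_c1 i : c1 Om (energy_flux i t).
Proof.
have cA k := mod_re_c1 oO wv lf k tT'; have cB k := mod_im_c1 oO wv lf k tT'.
have cv k := @lf_c1 _ _ _ _ _ _ lf k t tT'; have cN := gap_c1 oO wv lf tT'.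
have c1J := c1M oO bernoulli_c1 (c1B oO (c1M oO (cp_c1 ca tT') (cB i)) (c1M oO (cp_c1 cb tT') (cA i))).
have c1S (P : 'I_n -> V -> R) : (forall i, c1 Om (P i)) -> c1 Om (fun x => \sum_k P k x * v k t x).
  by move=> cP; apply: (c1_sum _ _ oO) => k; exact: (c1M oO (cP k) (cv k)).
have c1E : c1 Om (energy_density t).
  apply: (c1M oO _ (c1_cst 2^-1 oO)); apply: (c1D oO _ (c1M oO cN cN)).
  by apply: (c1_sum _ _ oO) => k; exact: (c1D oO (c1M oO (cA k) (cA k)) (c1M oO (cB k) (cB k))).
exact: (c1B oO (c1D oO (c1D oO (c1N oO c1J) (c1M oO (cA i) (c1S _ cA)))
  (c1M oO (cB i) (c1S _ cB))) (c1M oO c1E (cv i))).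
Qed.

Lemma bernoulli_L2 : L2 mu Om (bernoulli t).
Proof.
have L1' := L2N mO (conv2_L2 (lf_rho1 lf tT')).
have L2' := L2Z mO 2^-1 (L2_sum mO (index_enum 'I_n) xpredT (fun k => convoo_L2 oO (ov k) (Lv k))).
apply: (L2_eq mO _ (L2B mO L1' L2')) => x _.
by rewrite /bernoulli opprB mulrC.
Qed.

Lemma energy_flux_L1 i : L1 mu Om (energy_flux i t).
Proof.
have LJ := L2M mO bernoulli_L2 (L2B mO (convoo_L2 oO oa (LB i)) (convoo_L2 oO ob (LA i))).
have LS (P : 'I_n -> V -> R) : (forall i, L2 mu Om (P i)) -> L2 mu Om (fun x => \sum_k P k x * v k t x).
  move=> LP; apply: (L2_sum mO) => k.
  by apply: (L2_eq mO _ (convoo_L2 oO (ov k) (LP k))) => x _; rewrite mulrC.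
have LE := convoo_L1 oO (ov i) (energy_density_L1 oO wv lf tT').
apply: (L1_eq mO _ (L1B mO (L1D mO (L1D mO (L1N mO LJ) (L2M mO (LA i) (LS _ LA)))
  (L2M mO (LB i) (LS _ LB))) LE)) => x _.
by rewrite /energy_flux [v i t x * _]mulrC.
Qed.

Lemma div_v_L1 g : L1 mu Om g -> L1 mu Om (fun x => div_v t x * g x).
Proof.
move=> Lg; have L := L1_sum mO (index_enum 'I_n) xpredT
  (fun j => convoo_L1 oO (@lf_doo _ _ _ _ _ _ lf j j t tT') Lg).
by apply: (L1_eq mO _ L) => x _; rewrite /div_v mulr_suml.
Qed.

Lemma div_v_L2 : L2 mu Om (div_v t).
Proof. by apply: (L2_sum mO) => i; exact: conv2_L2 (@lf_d2 _ _ _ _ _ _ lf i i t tT'). Qed.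

Lemma strain_L1 : L1 mu Om (fun x => - strain t x - N t x ^+ 2 / 2 * div_v t x).
Proof.
apply: (L1B mO).
  apply: (L1N mO); apply: (L1_sum mO) => i; apply: (L1_sum mO) => k.
  have L := convoo_L1 oO (@lf_doo _ _ _ _ _ _ lf i k t tT')
    (L1D mO (L2M mO (LA i) (LA k)) (L2M mO (LB i) (LB k))).
  by apply: (L1_eq mO _ L) => x _; rewrite mulrC.
by apply: (L1_eq mO _ (div_v_L1 (L1Z mO 2^-1 LN.2))) => x _; rewrite mulrC [_ / 2]mulrC.
Qed.

Let Lda i := conv2_L2 (@cp_d _ _ _ _ _ _ ca i t tT').
Let Ldb i := conv2_L2 (@cp_d _ _ _ _ _ _ cb i t tT').
Let Ldda i := conv2_L2 (@cp_dd _ _ _ _ _ _ ca i t tT').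
Let Lddb i := conv2_L2 (@cp_dd _ _ _ _ _ _ cb i t tT').

Lemma dmass_L2 k : L2 mu Om (dmass k t).
Proof.
by apply: (L2Z mO); apply: (L2D mO); [exact: (convoo_L2 oO oa (Lda k))|exact: (convoo_L2 oO ob (Ldb k))].
Qed.

Lemma lap_mass_L1 : L1 mu Om (fun x => div_v t x * lap_mass t x).
Proof.
have La : L1 mu Om (fun x => \sum_i 2 * (pderiv i (a t) x ^+ 2 + pderiv i (b t) x ^+ 2)).
  by apply: (L1_sum mO) => i; exact: (L1Z mO 2 (L1D mO (Lda i).2 (Ldb i).2)).
have Lb : L2 mu Om (fun x => \sum_i 2 * (a t x * pderiv i (pderiv i (a t)) x +
     b t x * pderiv i (pderiv i (b t)) x)).
  apply: (L2_sum mO) => i; apply: (L2Z mO); apply: (L2D mO).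
    exact: (convoo_L2 oO oa (Ldda i)).
  exact: (convoo_L2 oO ob (Lddb i)).
apply: (L1_eq mO _ (L1D mO (div_v_L1 La) (L2M mO div_v_L2 Lb))) => x _.
rewrite -mulrDr; congr (_ * _); rewrite -big_split; apply: eq_bigr => i _ /=.
by rewrite -mulrDr addrA.
Qed.

Variable w : 'I_n -> 'I_n -> V -> R.
Hypothesis W : forall k j, weak_pderiv Om k (pderiv j (v j t)) (w k j).
Hypothesis Lw : forall k j, L2 mu Om (w k j).
Local Notation dw k x := (\sum_j w k j x).

(** The third derivatives of the phase get paired with the gradient [dmass] of
    the mass, and [eps / 2] times the latter is the modulated quantity
    [a A + b B], in which the velocity cancels. *)
Lemma lap_mass_by_parts : Rintegral mu Om (fun x => div_v t x * lap_mass t x) =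
  - Rintegral mu Om (fun x => \sum_k dw k x * dmass k t x).
Proof.
have cM k : c1 Om (dmass k t).
  apply: (c1Z 2 oO); apply: (c1D oO).
    exact: (c1M oO (cp_c1 ca tT') (@cp_c1d _ _ _ _ _ _ ca k t tT')).
  exact: (c1M oO (cp_c1 cb tT') (@cp_c1d _ _ _ _ _ _ cb k t tT')).
have dM x : Om x -> \sum_k pderiv k (dmass k t) x = lap_mass t x.
  move=> Ox; apply: eq_bigr => k _; apply: is_pder_val.
  have Ha := is_pderM (pa k Ox) (c1_pder k (@cp_c1d _ _ _ _ _ _ ca k t tT') Ox).
  have Hb := is_pderM (pb k Ox) (pdb k k Ox).
  apply: (is_pder_eq (is_pderZ 2 (is_pderD Ha Hb))).
  by rewrite -!expr2 addrACA addrA.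
have bD : bounded_near_boundary Om (div_v t).
  apply: bdry_sum => j; have [_ [M HM] _] := @lf_doo _ _ _ _ _ _ lf j j t tT'.
  exact: bounded_bdry HM.
have nM : no_flux Om (fun k x => div_v t x * dmass k t x).
  apply: no_fluxM bD _; apply: no_fluxZ; apply: no_fluxD; apply: no_fluxM.
  - exact: convoo_bdry oa.
  - exact: (cp_nf ca tT').
  - exact: convoo_bdry ob.
  - exact: (cp_nf cb tT').
have cf j x : Om x -> pderiv j (v j t) y @[y --> x] --> pderiv j (v j t) x.
  by move=> Ox; exact: (c1_pderiv_cont (i := j) (@lf_c1 _ _ _ _ _ _ lf j t tT') Ox).
have LF k : L1 mu Om (fun x => div_v t x * dmass k t x) := L2M mO div_v_L2 (dmass_L2 k).
have LD : L1 mu Om (fun x => div_v t x * \sum_k pderiv k (dmass k t) x).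
  by apply: (L1_eq mO _ lap_mass_L1) => x Ox; rewrite dM.
have LW : L1 mu Om (fun x => \sum_k dw k x * dmass k t x).
  by apply: (L1_sum mO) => k; exact: (L2M mO (L2_sum mO _ _ (Lw k)) (dmass_L2 k)).
rewrite -(weak_no_flux_divergence oO (ex_test ex) (ex_01 ex) (ex_1 ex) (@ex_flux _ _ _ _ ex)
  cM W nM cf LF LD LW).
by apply: I_eq => x Ox; rewrite dM.
Qed.

Lemma energy_rate_integral : Rintegral mu Om (energy_rate t) =
  Rintegral mu Om (fun x => - strain t x - N t x ^+ 2 / 2 * div_v t x)
  - eps ^+ 2 / 4 * Rintegral mu Om (fun x => \sum_k dw k x * dmass k t x).
Proof.
have [LG _] := energy_is_derive oO ex eps0 wv lf tT.
have LH := L1Z mO (eps ^+ 2 / 4) lap_mass_L1.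
have LSH := L1D mO strain_L1 LH.
have LQ : L1 mu Om (fun x => \sum_i pderiv i (energy_flux i t) x).
  apply: (L1_eq mO _ (L1B mO LG LSH)) => x Ox.
  rewrite energy_rate_identity// addrAC subrr add0r; apply: eq_bigr => i _.
  by rewrite (is_pder_val (energy_flux_pder i Ox)).
have Z := no_flux_divergence oO (ex_test ex) (ex_01 ex) (ex_1 ex) (@ex_flux _ _ _ _ ex)
  energy_flux_c1 energy_flux_no_flux energy_flux_L1 LQ.
rewrite -[RHS]addr0 -[X in _ = _ + X]Z -mulrN -lap_mass_by_parts.
rewrite -(I_Z mO _ lap_mass_L1) -(I_D mO strain_L1 LH) -(I_D mO LSH LQ).
apply: I_eq => x Ox; rewrite energy_rate_identity//; congr (_ + _).
by apply: eq_bigr => i _; rewrite (is_pder_val (energy_flux_pder i Ox)).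
Qed.

Variables (M K : R).
Hypothesis M0 : 0 <= M.
Hypothesis eps1 : eps <= 1.
Hypothesis dvM : forall i k x, Om x -> `|pderiv k (v i t) x| <= M.
Hypothesis rhoM : forall x, Om x -> `|rho t x| <= M.
Hypothesis wM : forall k x, Om x -> `|dw k x| <= M.
Hypothesis wK : Rintegral mu Om (fun x => \sum_k dw k x ^+ 2) <= K.

Lemma strain_bound x : Om x -> - strain t x - N t x ^+ 2 / 2 * div_v t x <=
  n%:R * M * (\sum_i (A i t x ^+ 2 + B i t x ^+ 2) + N t x ^+ 2 / 2).
Proof.
move=> Ox; rewrite mulrDr; apply: lerD.
  pose S i := A i t x ^+ 2 + B i t x ^+ 2.
  apply: (@le_trans _ _ (\sum_i \sum_k (S i + S k) / 2 * M)).
    rewrite /strain -sumrN; apply: ler_sum => i _; rewrite -sumrN; apply: ler_sum => k _.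
    have q0 : `|A i t x * A k t x + B i t x * B k t x| <= (S i + S k) / 2 by exact: pairing_bound.
    apply: le_trans (ler_norm _) _; rewrite normrN normrM.
    by rewrite ler_pM ?dvM.
  rewrite le_eqVlt; apply/orP; left; apply/eqP.
  transitivity (M / 2 * \sum_i \sum_k (S i + S k)).
    by rewrite mulr_sumr; apply: eq_bigr => i _; rewrite mulr_sumr; apply: eq_bigr => k _; ring.
  under eq_bigr do rewrite big_split /= sumr_const card_ord.
  by rewrite big_split /= sumr_const card_ord sumrMnl -mulr_natl; field.
rewrite -mulNr mulrC; apply: le_trans (ler_norm _) _.
rewrite normrM normrN [ `|_ / 2| ]ger0_norm; last by rewrite divr_ge0 ?sqr_ge0.
rewrite ler_wpM2r ?divr_ge0 ?sqr_ge0//.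
apply: le_trans (ler_norm_sum _ _ _) _.
apply: (@le_trans _ _ (\sum_(i < n) M)); first by apply: ler_sum => i _; exact: dvM.
by rewrite sumr_const card_ord mulr_natl.
Qed.

Lemma energy_rate_bound : Rintegral mu Om (energy_rate t) <=
  (2 * n%:R * M + n%:R + 1) * energy t + (M ^+ 2 + M) * K * eps ^+ 2.
Proof.
rewrite energy_rate_integral.
have LW k : L2 mu Om (fun x => dw k x) by exact: (L2_sum mO _ _ (Lw k)).
have LWm : L1 mu Om (fun x => \sum_k dw k x * dmass k t x).
  by apply: (L1_sum mO) => k; exact: (L2M mO (LW k) (dmass_L2 k)).
have LWW : L1 mu Om (fun x => \sum_k dw k x ^+ 2).
  by apply: (L1_sum mO) => k; exact: (LW k).2.
have LE := energy_density_L1 oO wv lf tT'.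
rewrite -(I_Z mO _ LWm) -(I_B mO strain_L1 (L1Z mO _ LWm)).
set C1 := 2 * _ * M + _ + 1; set C2 := M ^+ 2 + M.
apply: (@le_trans _ _ (Rintegral mu Om (fun x => C1 * energy_density t x +
    C2 * eps ^+ 2 * \sum_k dw k x ^+ 2))); last first.
  rewrite (I_D mO (L1Z mO C1 LE) (L1Z mO (C2 * eps ^+ 2) LWW)) (I_Z mO _ LE) (I_Z mO _ LWW).
  rewrite lerD2l [leRHS]mulrAC ler_wpM2l// mulr_ge0 ?sqr_ge0// addr_ge0 ?sqr_ge0//.
apply: (I_le mO).
- exact: (L1B mO strain_L1 (L1Z mO _ LWm)).
- exact: (L1D mO (L1Z mO C1 LE) (L1Z mO (C2 * eps ^+ 2) LWW)).
move=> x Ox; have HS := strain_bound Ox.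
have E1 : - (eps ^+ 2 / 4 * \sum_k dw k x * dmass k t x) =
    \sum_k - (eps / 2) * (dw k x * (a t x * A k t x + b t x * B k t x)).
  rewrite mulr_sumr -sumrN; apply: eq_bigr => k _; rewrite /dmass /mod_re /mod_im.
  by move: (\sum_j _) (pderiv k (a t) x) (pderiv k (b t) x) => W' da db; field.
have H1 : - (eps ^+ 2 / 4 * \sum_k dw k x * dmass k t x) <=
    \sum_k ((A k t x ^+ 2 + B k t x ^+ 2) / 2 + N t x ^+ 2 / 2 + C2 * (eps ^+ 2 * dw k x ^+ 2)).
  rewrite E1; apply: ler_sum => k _; apply: dispersive_bound; last exact: erefl.
  - by rewrite eps0.
  - exact: wM.
  - exact: rhoM.
have E2 : \sum_k ((A k t x ^+ 2 + B k t x ^+ 2) / 2 + N t x ^+ 2 / 2 + C2 * (eps ^+ 2 * dw k x ^+ 2)) =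
    (\sum_i (A i t x ^+ 2 + B i t x ^+ 2)) / 2 + n%:R * (N t x ^+ 2 / 2) +
    C2 * eps ^+ 2 * \sum_k dw k x ^+ 2.
  rewrite big_split big_split /= sumr_const card_ord mulr_natl; congr (_ + _ + _).
    by rewrite mulr_suml.
  by rewrite mulr_sumr; apply: eq_bigr => k _; rewrite mulrA.
rewrite E2 in H1.
apply: (le_trans (lerD HS H1)); rewrite addrA lerD2r /energy_density /C1.
have P0 : 0 <= \sum_i (A i t x ^+ 2 + B i t x ^+ 2).
  by apply: sumr_ge0 => i _; rewrite addr_ge0 ?sqr_ge0.
move: (\sum_i _) P0 (sqr_ge0 (N t x)) => P P0 Q0.
move: (N t x ^+ 2) Q0 => Q Q0.
have m0 : 0 <= n%:R :> R by exact: ler0n.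
have mM0 : 0 <= n%:R * M by rewrite mulr_ge0.
have := mulr_ge0 m0 P0; have := mulr_ge0 mM0 Q0; have := mulr_ge0 m0 Q0; have := mulr_ge0 mM0 P0.
lra.
Qed.

End fixed_time.
End energy_estimate.

(** * Gronwall's lemma *)
Section gronwall.
Context {R : realType}.

(** The function [expR (- C s) * (H s + e)] is nonincreasing. Derivatives are needed
    at interior times only, with continuity up to the end points. *)
Lemma gronwall (H D : R -> R) (T C e : R) : 0 < T -> 0 <= C -> 0 <= e ->
  (forall t, 0 <= t <= T -> H s @[s --> within `[0, T]%classic (nbhs t)] --> H t) ->
  (forall t, 0 < t < T -> is_derive t (1 : R) H (D t)) ->
  (forall t, 0 < t < T -> D t <= C * (H t + e)) ->
  forall t, 0 <= t <= T -> 0 <= H t -> H t <= expR (C * T) * (H 0 + e).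
Proof.
move=> T0 C0 e0 cH dH DH t /andP[t0 tT] Ht0.
pose G s := expR (- (C * s)) * (H s + e).
have dexp s : is_derive s (1 : R) (fun s => expR (- (C * s))) (expR (- (C * s)) * - C).
  have d1 : is_derive s (1 : R) (fun s => - (C * s)) (- C).
    have d0 : is_derive s (1 : R) (fun s : R => C *: s) (C *: 1).
      by apply: is_deriveZ; exact: is_derive_id.
    rewrite [C *: 1]mulr1 in d0; exact: (is_deriveN d0).
  exact: (@is_derive1_comp R expR (fun s => - (C * s)) s _ _ (is_derive_expR _) d1).
have dG s : 0 < s < T -> is_derive s (1 : R) G (expR (- (C * s)) * (D s - C * (H s + e))).
  move=> sT; have d1 := is_deriveM (dexp s) (is_deriveD (dH s sT) (is_derive_cst e s 1)).
  by apply: is_derive_eq d1 _; rewrite /GRing.scale /= ?fctE; ring.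
have cG : {within `[0, T], continuous G}.
  apply/subspace_continuousP => s sT.
  have FF : Filter (within `[0, T]%classic (nbhs s)) by exact: within_filter.
  apply: cvgM.
    have ce : expR (- (C * x)) @[x --> s] --> expR (- (C * s)).
      have [dd _] := dexp s.
      by have /derivable1_diffP/differentiable_continuous := dd.
    apply/cvgrPdist_le => r r0; move/cvgrPdist_le : ce => /(_ _ r0).
    by apply: (@filterS _ (nbhs s)) => x Hx _.
  apply: cvgD; last exact: cvg_cst.
  by apply: cH; move: sT; rewrite /= in_itv.
have mono : G t <= G 0.
  apply: (@ler0_derive1_nincr _ G 0 T) => //.
  - by move=> s; rewrite in_itv/= => sT; have [dd _] := dG s sT.
  - move=> s; rewrite in_itv/= => sT; have [_ dd] := dG s sT.
    rewrite derive1E dd mulr_ge0_le0 ?expR_ge0// subr_le0; exact: DH.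
have : H t + e <= expR (C * t) * (H 0 + e).
  move: mono; rewrite /G mulr0 oppr0 expR0 mul1r => mono.
  have E : H t + e = expR (C * t) * (expR (- (C * t)) * (H t + e)).
    by rewrite mulrA -expRD subrr expR0 mul1r.
  by rewrite [leLHS]E ler_wpM2l ?expR_ge0.
move=> h; apply: (@le_trans _ _ (H t + e)); first by rewrite lerDl.
apply: (le_trans h); rewrite ler_wpM2r ?ler_expR ?ler_wpM2l//.
have : 0 <= expR (C * t) * (H 0 + e) by apply: le_trans h; rewrite addr_ge0.
by rewrite pmulr_rge0 ?expR_gt0.
Qed.

End gronwall.

(** * Classical solutions under the Neumann condition *)
Section regularity.
Context {R : realType} {n : nat}.
Local Notation mu := (lebesgue_rV n).
Local Notation V := 'rV[R]_n.
Local Notation near_t T t := (within `[0, T]%classic (nbhs (t : R))).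
Variables (Om : set V) (T : R).
Hypothesis oO : open Om.
Implicit Types w : R -> V -> R.

Lemma jointly_continuous_near (I : set R) (O : set V) w t p : jointly_continuous I O w ->
  I t -> O p -> w t y @[y --> within O (nbhs p)] --> w t p.
Proof.
move=> /subspace_continuousP jw It Op.
have /cvgrPdist_le H := jw (t, p) (conj It Op).
apply/cvgrPdist_le => e /H [[A B] /= [nA nB] AB].
rewrite /within/=; apply: filterS nB => y By Oy.
apply: (AB (t, y)); last by split.
by split=> //=; exact: nbhs_singleton.
Qed.

Lemma jointly_continuous_at (I : set R) w t x : jointly_continuous I Om w ->
  I t -> Om x -> w t y @[y --> x] --> w t x.
Proof.
move=> jw It Ox; have /cvgrPdist_le H := jointly_continuous_near jw It Ox.
apply/cvgrPdist_le => e /H; rewrite /within/= => He.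
by apply: filterS2 (open_nbhs_nbhs (conj oO Ox)) He => y Oy; apply.
Qed.

Lemma C1_in_space_c1 w t : C1_in_space T Om w -> 0 <= t <= T -> c1 Om (w t).
Proof.
move=> [jw dw] tT x Ox; have It : `[0, T]%classic t by rewrite /= in_itv.
split; first exact: jointly_continuous_at jw It Ox.
move=> i; have [pw jdw] := dw i; split; first exact: pw.
exact: (jointly_continuous_at jdw It Ox).
Qed.

Lemma C1_in_time_derive w t x : C1_in_time T Om w -> 0 < t < T -> Om x ->
  is_derive t (1 : R) (w^~ x) (tderiv w t x).
Proof.
move=> [dw _] tT Ox; have := derivableP (dw t x tT Ox).
by rewrite /tderiv derive1E.
Qed.

Lemma jointly_continuous_itvoo w : jointly_continuous `[0, T]%classic Om w ->
  jointly_continuous `]0, T[%classic Om w.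
Proof.
apply: continuous_subspaceW => -[s x] /= [sT Ox]; split=> //.
by move: sT; rewrite !in_itv/= => /andP[s0 sT]; rewrite !ltW.
Qed.

Lemma jointly_continuousD (I : set R) w w' : jointly_continuous I Om w ->
  jointly_continuous I Om w' -> jointly_continuous I Om (fun t x => w t x + w' t x).
Proof. by move=> jw jw' p; apply: cvgD; [exact: jw|exact: jw']. Qed.

Lemma jointly_continuousM (I : set R) w w' : jointly_continuous I Om w ->
  jointly_continuous I Om w' -> jointly_continuous I Om (fun t x => w t x * w' t x).
Proof. by move=> jw jw' p; apply: cvgM; [exact: jw|exact: jw']. Qed.

Lemma jointly_continuousN (I : set R) w : jointly_continuous I Om w ->
  jointly_continuous I Om (fun t x => - w t x).
Proof. by move=> jw p; apply: cvgN; exact: jw. Qed.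

Lemma jointly_continuous_sum (I : set R) (J : Type) (r : seq J) (w : J -> R -> V -> R) :
  (forall j, jointly_continuous I Om (w j)) ->
  jointly_continuous I Om (fun t x => \sum_(j <- r) w j t x).
Proof.
move=> jw; elim: r => [|j r IH].
  rewrite (_ : (fun t x => _) = (fun _ _ => 0)); first by move=> p; exact: cvg_cst.
  by apply/funext => t; apply/funext => x; rewrite big_nil.
rewrite (_ : (fun t x => _) = (fun t x => w j t x + \sum_(k <- r) w k t x)).
  exact: (jointly_continuousD (jw j) IH).
by apply/funext => t; apply/funext => x; rewrite big_cons.
Qed.

Lemma gradient_bdry w i t : continuous_up_to_boundary T Om (fun t => pderiv i (w t)) ->
  0 <= t <= T -> bounded_near_boundary Om (pderiv i (w t)).
Proof.
move=> [w' jw' ww'] tT p bp; have It : `[0, T]%classic t by rewrite /= in_itv.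
have clp : closure Om p by have [] := bp.
have /cvgrPdist_le/(_ _ ltr01) H := jointly_continuous_near jw' It clp.
exists (`|w' t p| + 1); apply: (@filterS _ (nbhs p) _ _ _ _ H) => x Hx Ox.
have {}Hx := Hx (subset_closure Ox).
rewrite ww'// -[w' t x](subrK (w' t p)) addrC (le_trans (ler_normD _ _))// lerD2l.
by rewrite distrC.
Qed.

(** The Neumann condition bears on the normal at the boundary point; nearby
    gradients of the defining function differ little from it, and the gradient
    of the solution is bounded. *)
Lemma Neumann_no_flux w t : classical_Neumann T Om w -> Neumann_condition T Om w ->
  0 <= t <= T -> no_flux Om (fun i => pderiv i (w t)).
Proof.
move=> [_ _ _ cw] nw tT p g bp dg.
have [U [[oU Up C1g gg] _]] := dg.
have cg : c1 U g by apply/(c1P _ oU).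
pose nu := (enorm (grad g p))^-1 *: grad g p.
have H := nw t p nu tT bp (ex_intro _ g (conj dg erefl)).
have en0 : enorm (grad g p) != 0.
  apply/negP => /eqP; rewrite /enorm => /eqP; rewrite sqrtr_eq0 => h0.
  have := gg p Up; apply/negP; rewrite negbK; apply/eqP/rowP => i; rewrite [RHS]mxE.
  apply/eqP; rewrite -sqrf_eq0 eq_le sqr_ge0 andbT; apply: le_trans h0.
  rewrite /dotv (bigD1 i)//= -expr2 lerDl sumr_ge0// => j _.
  by rewrite -expr2 sqr_ge0.
have H1 : \sum_i pderiv i (w t) x * pderiv i g p @[x --> within Om (nbhs p)] --> (0 : R).
  have H2 : enorm (grad g p) * dotv (grad (w t) x) nu @[x --> within Om (nbhs p)] --> (enorm (grad g p) * 0 : R).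
    by apply: cvgM; [exact: cvg_cst|exact: H].
  rewrite mulr0 in H2; apply: cvg_ext H2 => x; rewrite /dotv mulr_sumr.
  by apply: eq_bigr => i _; rewrite /nu !mxE mulrCA mulVKf.
have H3 i : pderiv i (w t) x * (pderiv i g x - pderiv i g p) @[x --> within Om (nbhs p)] --> (0 : R).
  have [M HM] := gradient_bdry (cw i) tT bp.
  have M1 : 0 < `|M| + 1 by rewrite ltr_wpDl.
  apply/cvgrPdist_le => e e0; have eM : 0 < e / (`|M| + 1) by rewrite divr_gt0.
  have /cvgrPdist_le/(_ _ eM) Hg := c1_pderiv_cont (i := i) cg Up.
  have Hg' : \forall x \near within Om (nbhs p), `|pderiv i g p - pderiv i g x| <= e / (`|M| + 1).
    by rewrite /within/=; apply: filterS Hg => x h _.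
  apply: filterS2 HM Hg' => x wM gx.
  rewrite sub0r normrN normrM distrC (le_trans (ler_pM _ _ (_ : _ <= `|M| + 1) gx))//.
    by rewrite (le_trans wM)// (le_trans (ler_norm _))// lerDl.
  by rewrite mulrC divfK// gt_eqF.
have H4 : (\sum_i pderiv i (w t) x * pderiv i g p) +
    \sum_i pderiv i (w t) x * (pderiv i g x - pderiv i g p)
    @[x --> within Om (nbhs p)] --> (0 + \sum_(i < n) 0 : R).
  by apply: cvgD; [exact: H1|apply: cvg_sumr => i; exact: H3].
rewrite big1// addr0 in H4; apply: cvg_ext H4 => x.
by rewrite -big_split; apply: eq_bigr => i _ /=; ring.
Qed.

Lemma component_of w : classical_Neumann T Om w -> Neumann_condition T Om w ->
  C_X T Om 2 w -> component Om T w (tderiv w).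
Proof.
move=> cw nw Xw; have [tw [sw s2w] bw gw] := cw.
have c1w t := C1_in_space_c1 (t := t) sw.
have c1dw i t : 0 <= t <= T -> c1 Om (pderiv i (w t)) by exact: C1_in_space_c1 (s2w i).
split.
- by move=> t; exact: c1w.
- by move=> i t; exact: c1dw.
- by move=> t; apply: (C_X_convoo oO Xw) => s x sT Ox; exact: c1_cont (c1w s sT) Ox.
- by move=> i t; exact: (C_X_pderiv oO i Xw c1w).
- by move=> i t; exact: (C_X_pderiv2 oO i Xw c1w (c1dw i)).
- by move=> t; exact: Neumann_no_flux.
- by move=> i t; exact: gradient_bdry.
- by move=> t x; exact: C1_in_time_derive.
- exact: tw.2.
Qed.

End regularity.

(** * The limit flow *)
Section hydrodynamics.
Context {R : realType} {n : nat}.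
Local Notation mu := (lebesgue_rV n).
Local Notation V := 'rV[R]_n.
Local Notation near_t T t := (within `[0, T]%classic (nbhs (t : R))).
Variables (Om : set V) (T : R).
Hypothesis oO : open Om.
Let mO : measurable Om := open_measurable_rV oO.
Variables (rho phi : R -> V -> R).
Local Notation v := (fun (i : 'I_n) (t : R) => pderiv i (phi t)).
Hypothesis sol : hydro_solution T Om rho phi.
Hypothesis rho_reg : C_X T Om 1 rho.
Hypothesis rho_far : C_L2 T Om (fun t x => rho t x - 1).
Hypothesis phi_reg1 : forall i, C_L2Loo T Om (fun t => pderiv i (phi t)).
Hypothesis phi_reg2 : forall i j, C_L2Loo T Om (fun t => pderiv j (pderiv i (phi t))).

Lemma hydro_rho_c1 t : 0 <= t <= T -> c1 Om (rho t).
Proof. by have [[_ sr] _ _ _ _] := sol => tT; exact: (C1_in_space_c1 oO sr tT). Qed.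

Lemma hydro_phi_c1 t : 0 <= t <= T -> c1 Om (phi t).
Proof. by have [_ [_ [sp _] _ _] _ _ _] := sol => tT; exact: (C1_in_space_c1 oO sp tT). Qed.

Lemma hydro_v_c1 i t : 0 <= t <= T -> c1 Om (pderiv i (phi t)).
Proof. by have [_ [_ [_ sp] _ _] _ _ _] := sol => tT; exact: (C1_in_space_c1 oO (sp i) tT). Qed.

Lemma hydro_rhot t x : 0 < t < T -> Om x -> tderiv rho t x = rhot rho v t x.
Proof.
move=> tT Ox; have [_ _ eqr _ _] := sol; have tT' := ltW_itv tT.
apply/eqP; rewrite -subr_eq0 opprK -[X in _ == X](eqr t x tT Ox); apply/eqP; congr (_ + _).
apply: eq_bigr => i _; apply/esym/is_pder_val.
rewrite (_ : (fun y => _) = (fun y => rho t y * pderiv i (phi t) y)); last first.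
  by apply/funext => y; rewrite !mxE.
exact: (is_pderM (c1_pder i (hydro_rho_c1 tT') Ox) (c1_pder i (hydro_v_c1 i tT') Ox)).
Qed.

Lemma hydro_phit t x : 0 < t < T -> Om x ->
  tderiv phi t x = 1 - rho t x - (\sum_k pderiv k (phi t) x ^+ 2) / 2.
Proof.
move=> tT Ox; have [_ _ _ eqp _] := sol; have := eqp t x tT Ox.
have -> : enorm (grad (phi t) x) ^+ 2 = \sum_k pderiv k (phi t) x ^+ 2.
  rewrite /enorm sqr_sqrtr /dotv; last by apply: sumr_ge0 => i _; rewrite -expr2 sqr_ge0.
  by apply: eq_bigr => i _; rewrite mxE expr2.
by move=> H; apply/eqP; rewrite -subr_eq0 -[X in _ == X]H; apply/eqP; ring.
Qed.

Lemma hydro_jointly_vt i : jointly_continuous `]0, T[%classic Om (vt rho v i).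
Proof.
have [[_ [_ dr]] [_ [[_ dp] ddp] _ _] _ _ _] := sol.
apply: jointly_continuousD.
  by apply: jointly_continuousN; apply: jointly_continuous_itvoo; exact: (dr i).2.
apply: jointly_continuousN; apply: jointly_continuous_sum => k.
apply: jointly_continuousM; apply: jointly_continuous_itvoo; first exact: (dp k).2.
exact: ((ddp k).2 i).2.
Qed.

Lemma hydro_jointly_rhot : jointly_continuous `]0, T[%classic Om (rhot rho v).
Proof.
have [[_ [jr dr]] [_ [[_ dp] ddp] _ _] _ _ _] := sol.
apply: jointly_continuousN; apply: jointly_continuous_sum => i; apply: jointly_continuousD.
  apply: jointly_continuousM; apply: jointly_continuous_itvoo; first exact: (dr i).2.
  exact: (dp i).2.
apply: jointly_continuousM; apply: jointly_continuous_itvoo; first exact: jr.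
exact: ((ddp i).2 i).2.
Qed.

Lemma jointly_continuous_line w i t x (e : R) : jointly_continuous `]0, T[%classic Om w ->
  0 < t < T -> Om x -> 0 < e ->
  exists2 d, 0 < d & forall s h, `|s - t| < d -> `|h - 0| < d ->
    `|w s (x + h *: ei i) - w t x| <= e.
Proof.
move=> jw tT Ox e0.
have [A [B [nA nB AB]]] := jointly_continuous_local oO jw tT Ox e0.
have nB' : nbhs (x + (0 : R) *: ei i) B by rewrite scale0r addr0.
have [r r0 Hr] := nbhs_linei nB'.
have /nbhs_ballP[d /= d0 Hd] := nA.
exists (Num.min r d); first by rewrite lt_min r0.
move=> s h; rewrite !lt_min => /andP[sr sd] /andP[hr hd].
rewrite distrC; apply: AB; last exact: Hr.
by apply: Hd; rewrite /ball/= distrC.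
Qed.

(** The velocity is differentiable in time because the time derivative of the
    potential, given by the Bernoulli equation, has continuous gradient. *)
Lemma hydro_vt i t x : 0 < t < T -> Om x ->
  is_derive t (1 : R) (fun s => pderiv i (phi s) x) (vt rho v i t x).
Proof.
move=> tT Ox; have [_ [tphi _ _ _] _ _ _] := sol.
have [r1 r10 H1] : exists2 r, 0 < r & forall k : R, `|k - 0| < r -> Om (x + k *: ei i).
  by apply: nbhs_linei; rewrite scale0r addr0; exact: open_nbhs_nbhs.
have /nbhs_ballP[r2 /= r20 H2] := near_itvoo tT.
have H2' s : `|s - t| < r2 -> 0 < s < T by move=> sr; apply: H2; rewrite /ball/= distrC.
have := @schwarz R (fun s h => phi s (x + h *: ei i)) (fun s h => tderiv phi s (x + h *: ei i))
  (fun s h => vt rho v i s (x + h *: ei i)) (fun s => pderiv i (phi s) x) t 0 (Num.min r1 r2).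
rewrite scale0r addr0; apply.
- by rewrite lt_min r10.
- move=> s h; rewrite !lt_min => /andP[_ sr] /andP[hr _]; have sT := H2' s sr.
  have Oy := H1 h hr; split; first exact: (C1_in_time_derive tphi sT Oy).
  apply/is_pder_line.
  have Hb := @is_pder_bernoulli _ _ (rho s) (fun k => pderiv k (phi s)) i _
    (c1_pder i (hydro_rho_c1 (ltW_itv sT)) Oy) (fun k => c1_pder i (hydro_v_c1 k (ltW_itv sT)) Oy).
  apply: is_pder_near Hb.
  by apply: filterS (open_nbhs_nbhs (conj oO Oy)) => y Oy'; rewrite hydro_phit.
- move=> s; rewrite lt_min => /andP[_ sr]; apply/is_pder0.
  exact: (c1_pder i (hydro_phi_c1 (ltW_itv (H2' s sr))) Ox).
- by move=> e e0; exact: (jointly_continuous_line i (@hydro_jointly_vt i) tT Ox e0).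
Qed.

Lemma limit_flow_of : limit_flow Om T rho v.
Proof.
have [[tr sr] cp _ _ np] := sol.
have cdv i j s x : 0 <= s <= T -> Om x ->
    pderiv j (pderiv i (phi s)) y @[y --> x] --> pderiv j (pderiv i (phi s)) x.
  by move=> sT Ox; exact: (c1_pderiv_cont (i := j) (hydro_v_c1 i sT) Ox).
have cv i s x : 0 <= s <= T -> Om x -> pderiv i (phi s) y @[y --> x] --> pderiv i (phi s) x.
  by move=> sT Ox; exact: c1_cont (hydro_v_c1 i sT) Ox.
split.
- exact: hydro_rho_c1.
- by apply: (C_X_convoo oO rho_reg) => s x sT Ox; exact: c1_cont (hydro_rho_c1 sT) Ox.
- by move=> i t; exact: (C_X_pderiv oO i rho_reg hydro_rho_c1).
- by move=> t; exact: (C_L2_conv oO rho_far).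
- exact: hydro_v_c1.
- move=> i j t x tT Ox.
  exact: (pderiv_sym _ _ oO (hydro_phi_c1 tT) (fun k => hydro_v_c1 k tT) Ox).
- by move=> i; exact: (C_L2Loo_convoo oO (phi_reg1 i) (cv i)).
- by move=> i j; exact: (C_L2Loo_convoo oO (phi_reg2 i j) (cdv i j)).
- by move=> i; exact: (C_L2_conv oO (C_L2Loo_L2 (phi_reg1 i))).
- by move=> i j; exact: (C_L2_conv oO (C_L2Loo_L2 (phi_reg2 i j))).
- by move=> t; exact: Neumann_no_flux.
- move=> t x tT Ox; rewrite -hydro_rhot//; exact: (C1_in_time_derive tr tT Ox).
- by move=> i t x; exact: hydro_vt.
- exact: hydro_jointly_rhot.
- exact: hydro_jointly_vt.
Qed.

End hydrodynamics.

(** * Bounded weak derivatives *)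
Section bounded_representative.
Context {R : realType} {n : nat}.
Local Notation mu := (lebesgue_rV n).
Local Notation V := 'rV[R]_n.
Variables (Om : set V).
Hypothesis oO : open Om.
Let mO : measurable Om := open_measurable_rV oO.

Lemma weak_pderiv_ae i (f g g' : V -> R) : measurable_fun Om g' ->
  {ae mu, forall x, Om x -> g' x = g x} -> weak_pderiv Om i f g -> weak_pderiv Om i f g'.
Proof.
move=> mg' gg' [lf [mg lg] H].
have aeS (K : set V) : K `<=` Om -> {ae mu, forall x, K x -> g' x = g x}.
  by move=> KO; apply: filterS gg' => x h /KO; exact: h.
split=> //.
  split=> // K cK KO; have mK := compact_measurable_rV cK.
  have := lg K cK KO; rewrite /Lp_norm !Lnorm1E//.
  have mabs (h : V -> R) : measurable_fun Om h -> measurable_fun K (fun x => `|h x|%:E).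
    move=> mh; apply/measurable_EFinP.
    exact: (measurableT_comp (@normr_measurable R setT) (measurable_funS mO KO mh)).
  rewrite (@ae_eq_integral _ _ _ mu K (fun x => `|g' x|%:E) (fun x => `|g x|%:E))//.
  - exact: mabs.
  - exact: mabs.
  - by apply: filterS (aeS K KO) => x h Kx; rewrite h.
move=> psi tpsi; rewrite H//; congr (- _)%E; apply: ae_eq_integral => //.
- apply/measurable_EFinP; apply: measurable_funM => //.
  by apply: cont_measurable => // x _; exact: (c1_cont (test_c1 tpsi) I).
- apply/measurable_EFinP; apply: measurable_funM => //.
  by apply: cont_measurable => // x _; exact: (c1_cont (test_c1 tpsi) I).
- by apply: filterS gg' => x h Ox; rewrite h.
Qed.

(** Truncating at the essential bound changes a weak derivative on a null set
    only, and replaces almost everywhere bounds by pointwise ones. *)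
Lemma bounded_representative i (f g : V -> R) (M : R) : 0 <= M ->
  weak_pderiv Om i f g -> L2 mu Om g -> {ae mu, forall x, Om x -> `|g x| <= M} ->
  exists g', [/\ weak_pderiv Om i f g', L2 mu Om g', n2 mu Om g' = n2 mu Om g &
    forall x, `|g' x| <= M].
Proof.
move=> M0 W Lg gM; pose g' x := Num.max (- M) (Num.min M (g x)).
have mg' : measurable_fun Om g'.
  apply: measurable_maxr; first exact: measurable_cst.
  by apply: measurable_minr; [exact: measurable_cst|exact: Lg.1].
have gg' : {ae mu, forall x, Om x -> g' x = g x}.
  apply: filterS gM => x h Ox; have := h Ox; rewrite ler_norml => /andP[h1 h2].
  by rewrite /g' (min_idPr h2) (max_idPr h1).
exists g'; have [Lg' ng'] := L2_ae_eq mO mg' Lg gg'; split=> //.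
  exact: weak_pderiv_ae mg' gg' W.
move=> x; rewrite /g' ler_norml le_max lexx/= ge_max ge_min lexx/= andbT.
by rewrite (le_trans _ M0)// oppr_le0.
Qed.

End bounded_representative.

(** * The energy bound, uniformly in the semiclassical parameter *)
Section complex_parts.
Variable R : realType.
Implicit Types z w : R[i].

Lemma complex_ReM z w : complex.Re (z * w) =
  complex.Re z * complex.Re w - complex.Im z * complex.Im w.
Proof. by case: z w => a b [c d]. Qed.

Lemma complex_ImM z w : complex.Im (z * w) =
  complex.Re z * complex.Im w + complex.Im z * complex.Re w.
Proof. by case: z w => a b [c d]. Qed.

Lemma complex_ReD z w : complex.Re (z + w) = complex.Re z + complex.Re w.
Proof. by case: z w => a b [c d]. Qed.

Lemma complex_ImD z w : complex.Im (z + w) = complex.Im z + complex.Im w.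
Proof. by case: z w => a b [c d]. Qed.

Lemma complex_ReB z w : complex.Re (z - w) = complex.Re z - complex.Re w.
Proof. by case: z w => a b [c d]. Qed.

Lemma complex_ImB z w : complex.Im (z - w) = complex.Im z - complex.Im w.
Proof. by case: z w => a b [c d]. Qed.

Lemma sqr_normcE z : ComplexField.Normc.normc z ^+ 2 = complex.Re z ^+ 2 + complex.Im z ^+ 2.
Proof. by case: z => a b /=; rewrite sqr_sqrtr ?addr_ge0 ?sqr_ge0. Qed.

Lemma normr_sqr_complex z : `|z| ^+ 2 = ((complex.Re z ^+ 2 + complex.Im z ^+ 2)%:C)%C.
Proof.
have -> : `|z| = ((ComplexField.Normc.normc z)%:C)%C by case: z.
by rewrite -sqr_normcE !expr2 rmorphM.
Qed.

End complex_parts.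

Section uniform_estimate.
Context {R : realType} {n : nat}.
Local Notation mu := (lebesgue_rV n).
Local Notation V := 'rV[R]_n.
Local Notation near_t T t := (within `[0, T]%classic (nbhs (t : R))).
Variables (Om : set V) (T : R).
Hypothesis oO : open Om.
Hypothesis T0 : 0 < T.
Let mO : measurable Om := open_measurable_rV oO.

Lemma wave_of (eps : R) (u : R -> V -> R[i]) : GP_solution T Om eps u ->
  C_X T Om 2 (fun t => reP (u t)) -> C_X T Om 2 (fun t => imP (u t)) ->
  C_L2 T Om (fun t x => density (u t) x - 1) ->
  wave Om T eps (fun t => reP (u t)) (fun t => imP (u t))
    (tderiv (fun t => reP (u t))) (tderiv (fun t => imP (u t))).
Proof.
move=> [cr ci eq nr ni] Xr Xi u_far; split.
- exact: (component_of oO cr nr Xr).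
- exact: (component_of oO ci ni Xi).
- move=> t tT; have H := C_L2_conv oO u_far tT; apply: (conv2_eq mO _ _ H).
    by apply: nearW => s x _; rewrite /density sqr_normcE.
  by move=> x _; rewrite /density sqr_normcE.
- move=> t x tT Ox; have := congr1 (@complex.Re R) (eq t x tT Ox).
  rewrite normr_sqr_complex complex_ReD !complex_ReM !complex_ImM complex_ReB /= => H.
  rewrite !(mul0r, mul1r, mulr0, subr0, add0r, oppr0) in H.
  by rewrite mulNr; exact: H.
- move=> t x tT Ox; have := congr1 (@complex.Im R) (eq t x tT Ox).
  rewrite normr_sqr_complex complex_ImD !complex_ImM !complex_ReM complex_ReB complex_ImB /= => H.
  rewrite !(mul0r, mul1r, mulr0, subr0, add0r, addr0, oppr0) in H.
  exact: H.
Qed.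

Variables (rho : R -> V -> R) (v : 'I_n -> R -> V -> R).
Hypothesis lf : limit_flow Om T rho v.

Lemma n2_sum (J : Type) (r : seq J) (f : J -> V -> R) : (forall j, L2 mu Om (f j)) ->
  n2 mu Om (fun x => \sum_(j <- r) f j x) <= \sum_(j <- r) n2 mu Om (f j).
Proof.
move=> Lf; elim: r => [|j r IH].
  rewrite big_nil (@n2_eq _ _ _ mu Om _ (fun=> 0)).
    by rewrite /n2 (@I_eq _ _ _ mu Om _ (fun=> 0)) ?I_0 ?sqrtr0// => x _; rewrite expr0n.
  by move=> x _; rewrite big_nil.
rewrite big_cons (@n2_eq _ _ _ mu Om _ (fun x => f j x + \sum_(k <- r) f k x)); last first.
  by move=> x _; rewrite big_cons.
apply: le_trans (n2D mO (Lf j) (L2_sum mO _ _ Lf)) _.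
by rewrite lerD2l.
Qed.

Lemma uniform_choice (J : finType) (P : J -> R -> Prop) :
  (forall j M M', M <= M' -> P j M -> P j M') -> (forall j, exists M, P j M) ->
  exists2 M, 0 <= M & forall j, P j M.
Proof.
move=> mono /choice[M HM]; exists (\sum_j `|M j|); first exact: sumr_ge0.
move=> j; apply: mono (HM j); rewrite (bigD1 j)//=.
by rewrite (le_trans (ler_norm _))// lerDl sumr_ge0.
Qed.

Hypothesis third : forall k j : 'I_n, exists2 w : R -> V -> R,
  (forall t, 0 <= t <= T -> weak_pderiv Om k (pderiv j (v j t)) (w t)) & C_L2Loo T Om w.

(** Summing over [j] turns the weak derivatives of the [d_j v_j] into those of
    [div v]; the constants do not depend on the time. *)
Lemma third_derivatives_bounded : exists M K : R, 0 <= M /\ 0 <= K /\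
  forall t, 0 <= t <= T -> exists w : 'I_n -> 'I_n -> V -> R,
    [/\ forall k j, weak_pderiv Om k (pderiv j (v j t)) (w k j),
        forall k j, L2 mu Om (w k j),
        forall k x, `|\sum_j w k j x| <= M &
        Rintegral mu Om (fun x => \sum_k (\sum_j w k j x) ^+ 2) <= K].
Proof.
have [M M0 HM] : exists2 M : R, 0 <= M & forall kj : 'I_n * 'I_n, forall t, 0 <= t <= T ->
    exists g, [/\ weak_pderiv Om kj.1 (pderiv kj.2 (v kj.2 t)) g, L2 mu Om g,
      n2 mu Om g <= M & forall x, `|g x| <= M].
  apply: uniform_choice.
    move=> kj M M' MM' H t tT; have [g [? ? h1 h2]] := H t tT; exists g; split=> //.
      exact: le_trans MM'.
    by move=> x; exact: le_trans MM'.
  move=> [k j] /=; have [w Ww Cw] := third k j.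
  have [M1 H1] := C_L2Loo_ae_bounded Cw.
  have [M2 H2] := conv2_bounded oO (C_L2_conv oO (C_L2Loo_L2 Cw)).
  exists (`|M1| + `|M2|) => t tT.
  have Lw : L2 mu Om (w t) by exact: conv2_L2 (C_L2_conv oO (C_L2Loo_L2 Cw) tT).
  have aM : {ae mu, forall x, Om x -> `|w t x| <= `|M1|}.
    by apply: filterS (H1 t tT) => x h Ox; exact: le_trans (h Ox) (ler_norm _).
  have [g [Wg Lg ng gM]] := bounded_representative oO (normr_ge0 M1) (Ww t tT) Lw aM.
  exists g; split=> //.
    by rewrite ng (le_trans (H2 t tT))// (le_trans (ler_norm _))// lerDr.
  by move=> x; rewrite (le_trans (gM x))// lerDl.
exists (n%:R * M), (n%:R * (n%:R * M) ^+ 2); split; first by rewrite mulr_ge0.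
split; first by rewrite mulr_ge0 ?sqr_ge0.
move=> t tT; have /choice[g Hg] := fun kj => HM kj t tT.
have Lg k j : L2 mu Om (g (k, j)) by have [] := Hg (k, j).
exists (fun k j => g (k, j)); split.
- by move=> k j; have [] := Hg (k, j).
- exact: Lg.
- move=> k x; apply: le_trans (ler_norm_sum _ _ _) _.
  apply: (@le_trans _ _ (\sum_(j < n) M)); last by rewrite sumr_const card_ord mulr_natl.
  by apply: ler_sum => j _; have [] := Hg (k, j).
- have Lk k := L2_sum mO (index_enum 'I_n) xpredT (Lg k).
  rewrite (I_sum mO _ _ (fun k => (Lk k).2)).
  apply: (@le_trans _ _ (\sum_(k < n) (n%:R * M) ^+ 2)); last first.
    by rewrite sumr_const card_ord [leRHS]mulr_natl.
  apply: ler_sum => k _; rewrite -n2_sqr lerXn2r ?nnegrE ?n2_ge0 ?mulr_ge0//.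
  apply: le_trans (n2_sum _ (Lg k)) _.
  apply: (@le_trans _ _ (\sum_(j < n) M)); last by rewrite sumr_const card_ord mulr_natl.
  by apply: ler_sum => j _; have [] := Hg (k, j).
Qed.

Lemma energy_density_ge0 eps (a b : R -> V -> R) t x :
  0 <= energy_density eps a b rho v t x.
Proof.
by rewrite divr_ge0// addr_ge0 ?sqr_ge0// sumr_ge0// => i _; rewrite addr_ge0 ?sqr_ge0.
Qed.

Lemma rho_bounded : exists2 M, 0 <= M & forall t x, 0 <= t <= T -> Om x -> `|rho t x| <= M.
Proof.
have [M HM] := convoo_bounded (@lf_rhooo _ _ _ _ _ _ lf).
by exists `|M| => // t x tT Ox; exact: le_trans (HM t x tT Ox) (ler_norm _).
Qed.

Variable chi : nat -> V -> R.
Hypothesis ex : exhausting Om chi.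

(** The constant depends on [T] and on the limit flow, not on [eps]: the latter
    enters the rate of the energy through the source term [eps ^+ 2] alone. *)
Lemma energy_bound : exists2 C, 0 <= C & forall (eps : R) a b at_ bt, 0 < eps <= 1 ->
  wave Om T eps a b at_ bt -> forall t, 0 <= t <= T ->
  energy Om eps a b rho v t <= C * (energy Om eps a b rho v 0 + eps ^+ 2).
Proof.
have [Mw [K [Mw0 [K0 Hw]]]] := third_derivatives_bounded.
have [Mr Mr0 Hr] := rho_bounded.
have [Mv Mv0 Hv] : exists2 M : R, 0 <= M & forall ik : 'I_n * 'I_n, forall t x, 0 <= t <= T ->
    Om x -> `|pderiv ik.2 (v ik.1 t) x| <= M.
  apply: uniform_choice; last by move=> [i k]; exact: (convoo_bounded (@lf_doo _ _ _ _ _ _ lf i k)).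
  by move=> ik M M' MM' H t x tT Ox; exact: le_trans (H t x tT Ox) MM'.
pose M := Mw + Mr + Mv.
have M0 : 0 <= M by rewrite !addr_ge0.
have MwM : Mw <= M by rewrite /M; lra. have MrM : Mr <= M by rewrite /M; lra.
have MvM : Mv <= M by rewrite /M; lra.
pose C1 := 2 * n%:R * M + n%:R + 1; pose C2 := (M ^+ 2 + M) * K.
have C10 : 0 <= C1 by rewrite !addr_ge0 ?mulr_ge0.
have C20 : 0 <= C2 by rewrite mulr_ge0 ?addr_ge0 ?sqr_ge0.
exists (expR ((C1 + C2) * T)); first exact: expR_ge0.
move=> eps a b at_ bt /andP[e0 e1] wv.
move=> t tT; apply: (@gronwall R (energy Om eps a b rho v)
  (fun t => Rintegral mu Om (energy_rate eps a b at_ bt rho v t)) T (C1 + C2) (eps ^+ 2) T0).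
- by rewrite addr_ge0.
- exact: sqr_ge0.
- by move=> s sT; exact: (energy_continuous oO wv lf sT).
- by move=> s sT; have [_] := energy_is_derive oO ex e0 wv lf sT.
- move=> s sT; have sT' := ltW_itv sT; have [w [Ww Lw wM wK]] := Hw s sT'.
  have B := @energy_rate_bound _ _ _ _ _ _ oO ex e0 _ _ _ _ _ _ wv lf s sT w Ww Lw M K M0 e1.
  apply: (le_trans (B _ _ _ _)).
  + by move=> i k x Ox; exact: le_trans (Hv (i, k) s x sT' Ox) MvM.
  + by move=> x Ox; exact: le_trans (Hr s x sT' Ox) MrM.
  + by move=> k x _; exact: le_trans (wM k x) MwM.
  + exact: wK.
  have H0 : 0 <= energy Om eps a b rho v s by apply: I_ge0 => x _; exact: energy_density_ge0.
  rewrite -/C1 -/C2 -subr_ge0; set Es := energy _ _ _ _ _ _ s.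
  rewrite (_ : _ - _ = C2 * Es + C1 * eps ^+ 2); last by ring.
  by rewrite addr_ge0// mulr_ge0// sqr_ge0.
- exact: tT.
- by apply: I_ge0 => x _; exact: energy_density_ge0.
Qed.

End uniform_estimate.

(** * Convergence of the density and of the momentum *)
Section conclusions.
Context {R : realType} {n : nat}.
Local Notation mu := (lebesgue_rV n).
Local Notation V := 'rV[R]_n.

Lemma enorm_le_sum (z : V) : enorm z <= \sum_i `|z ord0 i|.
Proof.
have S0 : 0 <= \sum_i `|z ord0 i| by exact: sumr_ge0.
rewrite -[leRHS]ger0_norm// -sqrtr_sqr ler_sqrt ?sqr_ge0// /dotv expr2 mulr_suml.
apply: ler_sum => i _; rewrite -[leLHS]ger0_norm -?expr2 ?sqr_ge0// expr2 normrM.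
by rewrite ler_wpM2l// (bigD1 i)//= lerDl sumr_ge0.
Qed.

(** Young's inequality with weight [e] gives [e |a B| <= (e^2 a^2 + B^2) / 2] and
    alike for the other products; the mass is then written [N + r]. *)
Lemma momentum_component_bound (e a b A B N r v M : R) : 0 < e <= 1 -> `|r| <= M ->
  N = a ^+ 2 + b ^+ 2 - r ->
  e * `|a * B - b * A + N * v| <=
  (A ^+ 2 + B ^+ 2) / 2 + N ^+ 2 + e ^+ 2 * (1 + M + v ^+ 2).
Proof.
move=> /andP[e0 e1] rM NE; have mE : a ^+ 2 + b ^+ 2 = N + r by rewrite NE; ring.
have h1 : e * `|a * B| <= (e ^+ 2 * a ^+ 2 + B ^+ 2) / 2.
  rewrite normrM -(real_normK (num_real a)) -(real_normK (num_real B)).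
  by move: `|a| `|B| => x y; have := sqr_ge0 (e * x - y); nra.
have h2 : e * `|b * A| <= (e ^+ 2 * b ^+ 2 + A ^+ 2) / 2.
  rewrite normrM -(real_normK (num_real b)) -(real_normK (num_real A)).
  by move: `|b| `|A| => x y; have := sqr_ge0 (e * x - y); nra.
have h3 : e * `|N * v| <= (N ^+ 2 + e ^+ 2 * v ^+ 2) / 2.
  rewrite normrM -(real_normK (num_real N)) -(real_normK (num_real v)).
  by move: `|N| `|v| => x y; have := sqr_ge0 (x - e * y); nra.
have h4 : `|a * B - b * A + N * v| <= `|a * B| + `|b * A| + `|N * v|.
  by rewrite (le_trans (ler_normD _ _))// lerD2r ler_normB.
have {}h4 : e * `|a * B - b * A + N * v| <= e * `|a * B| + e * `|b * A| + e * `|N * v|.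
  by rewrite -!mulrDr ler_wpM2l// ltW.
have e2 : e ^+ 2 <= 1 by have := ler_pM (ltW e0) (ltW e0) e1 e1; rewrite mul1r expr2.
have e20 := sqr_ge0 e.
have h5 : e ^+ 2 * a ^+ 2 + e ^+ 2 * b ^+ 2 = e ^+ 2 * N + e ^+ 2 * r by rewrite -!mulrDr mE.
have h6 : e ^+ 2 * r <= e ^+ 2 * M by rewrite ler_wpM2l// (le_trans (ler_norm _)).
have h7 : e ^+ 2 * N <= N ^+ 2 + e ^+ 2.
  by have := sqr_ge0 N; have := sqr_ge0 (N - e ^+ 2); nra.
have M0 : 0 <= M by exact: le_trans rM.
have h8 : 0 <= e ^+ 2 * M by rewrite mulr_ge0.
have h9 : 0 <= e ^+ 2 * v ^+ 2 by rewrite mulr_ge0 ?sqr_ge0.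
have h10 := sqr_ge0 N.
rewrite [e ^+ 2 * (_ + _)]mulrDr [e ^+ 2 * (1 + M)]mulrDr mulr1.
move: (e * `|a * B|) (e * `|b * A|) (e * `|N * v|) (e * `|a * B - b * A + N * v|) h1 h2 h3 h4.
move: (e ^+ 2 * a ^+ 2) (e ^+ 2 * b ^+ 2) (e ^+ 2 * N) (e ^+ 2 * r) (e ^+ 2 * M)
  (e ^+ 2 * v ^+ 2) (e ^+ 2) (N ^+ 2) (A ^+ 2) (B ^+ 2) h5 h6 h7 h8 h9 h10 e20.
by move=> *; lra.
Qed.

Variables (Om : set V) (T : R).
Hypothesis oO : open Om.
Let mO : measurable Om := open_measurable_rV oO.

Lemma cvg_sqrt (f : V -> R) x : f y @[y --> x] --> f x ->
  Num.sqrt (f y) @[y --> x] --> Num.sqrt (f x).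
Proof. by move=> cf; apply: continuous_cvg => //; exact: sqrt_continuous. Qed.

Lemma c1_within (f : V -> R) : c1 Om f -> {within Om, continuous f}.
Proof. by move=> /(c1P _ oO)[]. Qed.

Section fixed_solution.
Variables (rho : R -> V -> R) (v : 'I_n -> R -> V -> R).
Hypothesis lf : limit_flow Om T rho v.
Variables (eps : R) (a b at_ bt : R -> V -> R).
Hypothesis eps01 : 0 < eps <= 1.
Hypothesis wv : wave Om T eps a b at_ bt.
Local Notation A := (mod_re eps a b v).
Local Notation B := (mod_im eps a b v).
Local Notation N := (density_gap a b rho).

(** The difference between [eps (a grad b - b grad a)] and [rho v]: the terms
    in [|u|^2 v] of the modulated gradient are compensated by [N v]. *)
Definition momentum_gap t x : V :=
  \row_i (a t x * B i t x - b t x * A i t x + N t x * v i t x).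

Lemma momentum_gap_c1 i t : 0 <= t <= T -> c1 Om (fun x => momentum_gap t x ord0 i).
Proof.
move=> tT; have ca := cp_c1 (wv_a wv) tT; have cb := cp_c1 (wv_b wv) tT.
have cA := mod_re_c1 oO wv lf i tT; have cB := mod_im_c1 oO wv lf i tT.
have cN := gap_c1 oO wv lf tT; have cv := @lf_c1 _ _ _ _ _ _ lf i t tT.
have H := c1D oO (c1B oO (c1M oO ca cB) (c1M oO cb cA)) (c1M oO cN cv).
by apply: (c1_near oO _ H) => x _; rewrite mxE.
Qed.

Lemma gap_n2 t : 0 <= t <= T -> n2 mu Om (N t) ^+ 2 <= 2 * energy Om eps a b rho v t.
Proof.
move=> tT; have LE := energy_density_L1 oO wv lf tT; have LN := conv2_L2 (gap_conv oO wv lf tT).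
rewrite n2_sqr -(I_Z mO 2 LE); apply: (I_le mO LN.2 (L1Z mO 2 LE)) => x _.
rewrite /energy_density mulrC divfK ?pnatr_eq0// lerDr sumr_ge0// => i _.
by rewrite addr_ge0 ?sqr_ge0.
Qed.

Lemma energy_initial t : 0 <= t <= T ->
  L2 mu Om (fun x => Num.sqrt (\sum_i (A i t x ^+ 2 + B i t x ^+ 2))) /\
  energy Om eps a b rho v t =
  (n2 mu Om (fun x => Num.sqrt (\sum_i (A i t x ^+ 2 + B i t x ^+ 2))) ^+ 2 +
   n2 mu Om (N t) ^+ 2) / 2.
Proof.
move=> tT; have LN := conv2_L2 (gap_conv oO wv lf tT).
pose S x := \sum_i (A i t x ^+ 2 + B i t x ^+ 2).
have S0 x : 0 <= S x by apply: sumr_ge0 => i _; rewrite addr_ge0 ?sqr_ge0.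
have LS : L1 mu Om S.
  apply: (L1_sum mO) => i; apply: (L1D mO).
    exact: (conv2_L2 (mod_re_conv oO wv lf i tT)).2.
  exact: (conv2_L2 (mod_im_conv oO wv lf i tT)).2.
have cS x : Om x -> S y @[y --> x] --> S x.
  move=> Ox; apply: cvg_sumr => i.
  have cA := c1_cont (mod_re_c1 oO wv lf i tT) Ox; have cB := c1_cont (mod_im_c1 oO wv lf i tT) Ox.
  by apply: cvgD; rewrite expr2; apply: cvgM.
have LC : L2 mu Om (fun x => Num.sqrt (S x)).
  split; first by apply: (cont_measurable oO) => x Ox; apply: cvg_sqrt; exact: cS.
  by apply: (L1_eq mO _ LS) => x _; rewrite sqr_sqrtr.
split; first exact: LC.
rewrite !n2_sqr (@I_eq _ _ _ mu Om (fun x => Num.sqrt (S x) ^+ 2) S); last first.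
  by move=> x _; rewrite sqr_sqrtr.
rewrite -(I_D mO LS LN.2) mulrC -(I_Z mO _ (L1D mO LS LN.2)).
by apply: I_eq => x _; rewrite mulrC.
Qed.

(** The finite volume of [K] makes the constant part of the bound integrable;
    dividing by [eps] leaves [O(eps)] once the energy is [O(eps^2)]. *)
Lemma momentum_gap_L1 (K : set V) (M t : R) : compact K -> K `<=` Om -> 0 <= t <= T ->
  (forall x, Om x -> `|rho t x| <= M) ->
  L1 mu K (fun x => enorm (momentum_gap t x)) /\
  eps * Rintegral mu K (fun x => enorm (momentum_gap t x)) <=
  (2 * n%:R + 1) * energy Om eps a b rho v t +
  eps ^+ 2 * (n%:R * (1 + M) * fine (mu K) +
    Rintegral mu Om (fun x => \sum_i v i t x ^+ 2)).
Proof.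
move=> cK KO tT rM; have mK := compact_measurable_rV cK; have /andP[e0 e1] := eps01.
have LE := energy_density_L1 oO wv lf tT.
pose C1 : R := 2 * n%:R + 1.
have LV : L1 mu Om (fun x => \sum_i v i t x ^+ 2).
  by apply: (L1_sum mO) => i; exact: (conv2_L2 (@lf_2 _ _ _ _ _ _ lf i t tT)).2.
have S_L1 f : L1 mu Om f -> L1 mu K f by exact: integrableS.
have L1K : L1 mu K (fun=> 1).
  apply/integrableP; split; first exact: measurable_cst.
  rewrite (eq_integral (cst 1%E)); last by move=> x _; rewrite /= normr1.
  by rewrite integral_cst// mul1e; exact: compact_lty.
have IK1 : Rintegral mu K (fun=> 1) = fine (mu K).
  by rewrite /Rintegral integral_cst// mul1e.
have sub_I f : L1 mu Om f -> (forall x, Om x -> 0 <= f x) -> Rintegral mu K f <= Rintegral mu Om f.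
  move=> Lf f0; rewrite -lee_fin !I_EFin//; last exact: S_L1.
  apply: ge0_subset_integral; [exact: mK|exact: mO| | |exact: KO].
    by apply/measurable_EFinP; exact: (L1_measurable Lf).
  by move=> x Ox; rewrite lee_fin f0.
pose g x := C1 * energy_density eps a b rho v t x +
  eps ^+ 2 * (n%:R * (1 + M) * 1 + \sum_i v i t x ^+ 2).
have LgK : L1 mu K g.
  apply: (L1D mK (L1Z mK C1 (S_L1 _ LE))); apply: (L1Z mK).
  exact: (L1D mK (L1Z mK _ L1K) (S_L1 _ LV)).
have bound x : Om x -> eps * enorm (momentum_gap t x) <= g x.
  move=> Ox; apply: (@le_trans _ _ (\sum_i ((A i t x ^+ 2 + B i t x ^+ 2) / 2 + N t x ^+ 2 +
      eps ^+ 2 * (1 + M + v i t x ^+ 2)))).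
    apply: (@le_trans _ _ (eps * \sum_i `|momentum_gap t x ord0 i|)).
      by rewrite ler_wpM2l ?enorm_le_sum// ltW.
    rewrite mulr_sumr; apply: ler_sum => i _; rewrite mxE.
    by apply: momentum_component_bound (rM x Ox) _.
  have -> : \sum_i ((A i t x ^+ 2 + B i t x ^+ 2) / 2 + N t x ^+ 2 + eps ^+ 2 * (1 + M + v i t x ^+ 2)) =
      (\sum_i (A i t x ^+ 2 + B i t x ^+ 2)) / 2 + n%:R * N t x ^+ 2 +
      eps ^+ 2 * (n%:R * (1 + M) + \sum_i v i t x ^+ 2).
    rewrite big_split big_split /= sumr_const card_ord mulr_natl; congr (_ + _ + _).
      by rewrite mulr_suml.
    by rewrite -mulr_sumr; congr (_ * _); rewrite big_split /= sumr_const card_ord mulr_natl.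
  rewrite /g mulr1 lerD2r /energy_density /C1.
  have : 0 <= \sum_i (A i t x ^+ 2 + B i t x ^+ 2).
    by apply: sumr_ge0 => i _; rewrite addr_ge0 ?sqr_ge0.
  have : 0 <= n%:R :> R by exact: ler0n.
  have := sqr_ge0 (N t x); move: (N t x ^+ 2) (\sum_i _) n%:R => q p m q0 m0 p0.
  have := mulr_ge0 m0 p0; nra.
have cG : measurable_fun Om (fun x => enorm (momentum_gap t x)).
  apply: (cont_measurable oO) => x Ox; apply: cvg_sqrt; apply: cvg_sumr => i.
  by apply: cvgM; exact: c1_cont (momentum_gap_c1 i tT) Ox.
have en0 x : 0 <= enorm (momentum_gap t x) by exact: sqrtr_ge0.
have LG : L1 mu K (fun x => enorm (momentum_gap t x)).
  apply: (L1_le mK (measurable_funS mO KO cG) _ (L1Z mK eps^-1 LgK)) => x /KO Ox.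
  by rewrite ger0_norm// mulrC ler_pdivlMr// mulrC bound.
split=> //; rewrite -(I_Z mK _ LG).
apply: (@le_trans _ _ (Rintegral mu K g)).
  by apply: (I_le mK (L1Z mK _ LG) LgK) => x /KO; exact: bound.
rewrite /g (I_D mK (L1Z mK C1 (S_L1 _ LE)) (L1Z mK _ (L1D mK (L1Z mK _ L1K) (S_L1 _ LV)))).
rewrite (I_Z mK _ (S_L1 _ LE)) (I_Z mK _ (L1D mK (L1Z mK _ L1K) (S_L1 _ LV))).
rewrite (I_D mK (L1Z mK _ L1K) (S_L1 _ LV)) (I_Z mK _ L1K) IK1.
apply: lerD.
  rewrite ler_wpM2l ?addr_ge0 ?mulr_ge0//.
  by apply: sub_I => // x _; exact: energy_density_ge0.
rewrite ler_wpM2l ?sqr_ge0// lerD2l; apply: sub_I => // x _.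
by apply: sumr_ge0 => i _; exact: sqr_ge0.
Qed.

End fixed_solution.
End conclusions.

(** * The semiclassical limit *)
Theorem theorem6p1 (R : realType) (n : nat) (hn : n = 2%N \/ n = 3%N)
  (Omega : set 'rV[R]_n) (hOmega : regular_domain Omega)
  (hbdry : bounded_set (boundary Omega))
  (hbe : bounded_set Omega \/ bounded_set (~` Omega))
  (T : R) (hT : 0 < T)
  (u : R -> R -> 'rV[R]_n -> R[i]) (rho phi : R -> 'rV[R]_n -> R)
  (u_sol : forall eps : R, 0 < eps <= 1 -> GP_solution T Omega eps (u eps))
  (rhophi_sol : hydro_solution T Omega rho phi)
  (u_reg : forall eps : R, 0 < eps <= 1 ->
     C_X T Omega 2 (fun t => reP (u eps t)) /\
     C_X T Omega 2 (fun t => imP (u eps t)))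
  (u_far : forall eps : R, 0 < eps <= 1 ->
     C_L2 T Omega (fun t x => density (u eps t) x - 1))
  (rho_reg : C_X T Omega 1 rho)
  (rho_far : C_L2 T Omega (fun t x => rho t x - 1))
  (phi_reg1 : forall i, C_L2Loo T Omega (fun t => pderiv i (phi t)))
  (phi_reg2 : forall i j, C_L2Loo T Omega (fun t => pderiv j (pderiv i (phi t))))
  (phi_reg3 : forall i j k, exists2 w : R -> 'rV[R]_n -> R,
     (forall t : R, 0 <= t <= T ->
        weak_pderiv Omega k (pderiv j (pderiv i (phi t))) (w t)) &
     C_L2Loo T Omega w)
  (h0 : big_O_eps (fun eps =>
     (Lp_norm Omega 2%:E
        (fun x => cenorm (modulated_gradient eps (u eps 0) (phi 0) x))%R +
      Lp_norm Omega 2%:E (fun x => density (u eps 0) x - rho 0 x)%R)%E)) :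
  ((forall eps t : R, 0 < eps <= 1 -> 0 <= t <= T ->
      measurable_fun Omega (fun x => density (u eps t) x - rho t x)) /\
   big_O_eps (fun eps =>
     LooLp_norm T Omega 2%:E (fun t x => density (u eps t) x - rho t x))) /\
  ((forall eps t : R, 0 < eps <= 1 -> 0 <= t <= T -> measurable_fun Omega
      (fun x => momentum eps (u eps t) x - rho t x *: grad (phi t) x)) /\
   forall K : set 'rV[R]_n, compact K -> K `<=` Omega ->
     big_O_eps (fun eps => LooLp_norm T K 1%:E
       (fun t x =>
          enorm (momentum eps (u eps t) x - rho t x *: grad (phi t) x)))).
Proof.
have oO : open Omega by have [] := hOmega.
have mO := open_measurable_rV oO.
have [chi [tchi chi01 chi1 chiF]] := exhausting_tests oO hOmega hbdry.
have ex : exhausting Omega chi := Exhausting tchi chi01 chi1 chiF.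
have lf := limit_flow_of oO rhophi_sol rho_reg rho_far phi_reg1 phi_reg2.
set v := (fun (i : 'I_n) (t : R) => pderiv i (phi t)) in lf.
have third k j : exists2 w : R -> 'rV[R]_n -> R,
    (forall t, 0 <= t <= T -> weak_pderiv Omega k (pderiv j (v j t)) (w t)) & C_L2Loo T Omega w.
  exact: phi_reg3.
have [C C0 HC] := energy_bound oO hT lf third ex.
pose a (eps t : R) := reP (u eps t); pose b (eps t : R) := imP (u eps t).
have wv eps : 0 < eps <= 1 -> wave Omega T eps (a eps) (b eps) (tderiv (a eps)) (tderiv (b eps)).
  move=> e01; have [Xr Xi] := u_reg eps e01.
  exact: (wave_of oO (u_sol eps e01) Xr Xi (u_far eps e01)).
have zT : 0 <= (0 : R) <= T by rewrite lexx ltW.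
have gapE eps t : (fun x => density (u eps t) x - rho t x) = density_gap (a eps) (b eps) rho t.
  by apply/funext => x; rewrite /density sqr_normcE.
have mgE eps : (fun x => cenorm (modulated_gradient eps (u eps 0) (phi 0) x)) =
    (fun x => Num.sqrt (\sum_i (mod_re eps (a eps) (b eps) v i 0 x ^+ 2 +
                                mod_im eps (a eps) (b eps) v i 0 x ^+ 2))).
  apply/funext => x; congr Num.sqrt; apply: eq_bigr => i _.
  rewrite sqr_normcE !mxE complex_ReB complex_ImB; set z := _ * (_)%:C%C.
  have zr : complex.Re z = - (imP (u eps 0) x * v i 0 x).
    by rewrite /z !complex_ReM !complex_ImM /= !(mul0r, mul1r, mulr0, subr0, sub0r) mulNr.
  have zi : complex.Im z = reP (u eps 0) x * v i 0 x.
    by rewrite /z !complex_ImM !complex_ReM /= !(mul0r, mul1r, mulr0, add0r).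
  rewrite zr zi !complex_ReM !complex_ImM /=.
  by rewrite /mod_re /mod_im /a /b; congr (_ ^+ 2 + _ ^+ 2); rewrite mul0r ?subr0 ?addr0 ?opprK.
have momE eps t : (fun x => momentum eps (u eps t) x - rho t x *: grad (phi t) x) =
    momentum_gap rho v eps (a eps) (b eps) t.
  apply/funext => x; apply/rowP => i; rewrite !mxE complex_ImM /=.
  rewrite /mod_re /mod_im /density_gap /a /b /v.
  rewrite (_ : complex.Re (conjc (u eps t x)) = reP (u eps t) x); last by rewrite /reP; case: (u eps t x).
  rewrite (_ : complex.Im (conjc (u eps t x)) = - imP (u eps t) x); last by rewrite /imP; case: (u eps t x).
  by ring.
have [C1 C10 HE] : exists2 C1 : R, 0 <= C1 & forall eps, 0 < eps <= 1 -> forall t, 0 <= t <= T ->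
    energy Omega eps (a eps) (b eps) rho v t <= C1 * eps ^+ 2.
  have [c0 Hc0] := h0; exists (C * (c0 ^+ 2 + 1)).
    by rewrite mulr_ge0// addr_ge0 ?sqr_ge0.
  move=> eps e01 t tT; apply: (le_trans (HC eps _ _ _ _ e01 (wv eps e01) t tT)).
  rewrite -mulrA ler_wpM2l// mulrDl mul1r lerD2r.
  have [LC ->] := energy_initial oO lf (wv eps e01) zT.
  have LN := conv2_L2 (gap_conv oO (wv eps e01) lf zT).
  have := Hc0 eps e01; rewrite mgE gapE (Lp_norm2 oO LC) (Lp_norm2 oO LN) -EFinD lee_fin.
  have p0 := n2_ge0 (lebesgue_rV n) Omega (fun x => Num.sqrt (\sum_i (mod_re eps (a eps) (b eps) v i 0 x ^+ 2 +
                                mod_im eps (a eps) (b eps) v i 0 x ^+ 2))).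
  have q0 := n2_ge0 (lebesgue_rV n) Omega (density_gap (a eps) (b eps) rho 0).
  rewrite -exprMn; move: (n2 _ _ _) (n2 _ _ _) p0 q0 => p q p0 q0 pq.
  by move: (c0 * eps) pq => r pq; nra.
split; split.
- move=> eps t e01 tT; rewrite gapE; apply: (cont_measurable oO) => x Ox.
  exact: c1_cont (gap_c1 oO (wv eps e01) lf tT) Ox.
- exists (Num.sqrt (2 * C1)) => eps e01; have /andP[e0 e1] := e01.
  apply: ge_ereal_sup => _ [t tT <-]; rewrite /= in_itv/= in tT.
  rewrite gapE (Lp_norm2 oO (conv2_L2 (gap_conv oO (wv eps e01) lf tT))) lee_fin.
  rewrite -ler_sqr ?nnegrE ?n2_ge0 ?mulr_ge0 ?sqrtr_ge0 ?(ltW e0)//.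
  apply: (le_trans (gap_n2 oO lf (wv eps e01) tT)).
  by rewrite exprMn sqr_sqrtr ?mulr_ge0// -mulrA ler_wpM2l// HE.
- move=> eps t e01 tT; rewrite momE; apply: (measurable_row_on oO) => i.
  exact: (c1_within oO (momentum_gap_c1 oO lf (wv eps e01) i tT)).
- move=> K cK KO; have mK := compact_measurable_rV cK.
  have [M M0 HM] := rho_bounded lf.
  have [Mv Mv0 HMv] : exists2 M : R, 0 <= M & forall i : 'I_n, forall t, 0 <= t <= T ->
      n2 (lebesgue_rV n) Omega (v i t) <= M.
    apply: uniform_choice; last by move=> i; exact: (conv2_bounded oO (@lf_2 _ _ _ _ _ _ lf i)).
    by move=> i M1 M2 MM' H t tT; exact: le_trans (H t tT) MM'.
  exists ((2 * n%:R + 1) * C1 + (n%:R * (1 + M) * fine (lebesgue_rV n K) + n%:R * Mv ^+ 2)).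
  move=> eps e01; have /andP[e0 e1] := e01.
  apply: ge_ereal_sup => _ [t tT <-]; rewrite /= in_itv/= in tT.
  have rM x : Omega x -> `|rho t x| <= M by exact: HM.
  have [LG HG] := momentum_gap_L1 oO lf e01 (wv eps e01) cK KO tT rM.
  rewrite (_ : (fun x => enorm _) = (fun x => enorm (momentum_gap rho v eps (a eps) (b eps) t x))); last first.
    by rewrite -momE.
  rewrite /Lp_norm (Lnorm1_I mK LG) lee_fin.
  rewrite (@I_eq _ _ _ _ _ _ (fun x => enorm (momentum_gap rho v eps (a eps) (b eps) t x))); last first.
    by move=> x _; rewrite ger0_norm// sqrtr_ge0.
  rewrite -(ler_pM2l e0); apply: (le_trans HG).
  have LV i : L2 (lebesgue_rV n) Omega (v i t) by exact: conv2_L2 (@lf_2 _ _ _ _ _ _ lf i t tT).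
  have -> : eps * (((2 * n%:R + 1) * C1 + (n%:R * (1 + M) * fine (lebesgue_rV n K) + n%:R * Mv ^+ 2)) * eps) =
      (2 * n%:R + 1) * (C1 * eps ^+ 2) +
      eps ^+ 2 * (n%:R * (1 + M) * fine (lebesgue_rV n K) + n%:R * Mv ^+ 2) by ring.
  apply: lerD; first by rewrite ler_wpM2l ?addr_ge0 ?mulr_ge0// HE.
  rewrite ler_wpM2l ?sqr_ge0// lerD2l (I_sum mO _ _ (fun i => (LV i).2)).
  apply: (@le_trans _ _ (\sum_(i < n) Mv ^+ 2)); last by rewrite sumr_const card_ord mulr_natl.
  by apply: ler_sum => i _; rewrite -n2_sqr lerXn2r ?nnegrE ?n2_ge0// HMv.
Qed.
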